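(* Suppose that $p,q\in(M,\tau)$ are Hermitian, freely independent operators whose spectral measures are $$\mu_p=\tfrac12\delta_\alpha+\tfrac12\delta_{\alpha'},\qquad \mu_q=\tfrac12\delta_\beta+\tfrac12\delta_{\beta'}$$ for some real $\alpha\neq\alpha'$, $\beta\ne\beta'$, and let $X=p+iq$. Consider only points $z\in\mathbb{C}$ such that $\mathcal{G}_{\mathbf X}(z_\epsilon)$ is in the domain of $\mathcal{B}_{\mathbf X}$ for all sufficiently small $\epsilon>0$. Then the support of the Brown measure of $X$ is the closure of the set of such $z$ for which either $$\lim_{\epsilon\to0^+}\mathcal{G}_{\mathbf X}(z_\epsilon)=\begin{pmatrix}A&i\overline B\\ iB&\overline A\end{pmatrix}$$ for some $A,B\in\mathbb{C}$ with $B\neq0$, or the limit $\lim_{\epsilon\to0^+}\mathcal{G}_{\mathbf X}(z_\epsilon)$ does not exist.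
   Context: $(M,\tau)$ is a von Neumann algebra with faithful normal tracial state. The Brown measure of $X$ is $\mu_X=\frac1{2\pi}\nabla^2\log\Delta(z-X)$ (distributional Laplacian in $z$), with $\Delta(x)=\exp\int_0^\infty\log t\,d\mu_{|x|}(t)$ the Fuglede–Kadison determinant. Quaternions: $\mathbb{H}=\left\{Q=\begin{pmatrix}A&i\overline B\\ iB&\overline A\end{pmatrix}:A,B\in\mathbb{C}\right\}\subset M_2(\mathbb{C})$ with norm $|Q|=\sqrt{\det Q}$ (limits are with respect to it). Write $A=x_0+ix_3$, $B=x_1+ix_2$; $g=x_0+i\sqrt{x_1^2+x_2^2+x_3^2}$ is the eigenvalue of $Q$ with non-negative imaginary part and $g^I=-x_3+i\sqrt{x_0^2+x_1^2+x_2^2}$ the eigenvalue of $Qi$ with non-negative imaginary part, $i$ being $\mathrm{diag}(i,-i)$. For $z\in\mathbb{C}$, $\epsilon>0$: $z_\epsilon=\begin{pmatrix}z&i\epsilon\\i\epsilon&\overline z\end{pmatrix}\in\mathbb{H}$. The Quaternionic Green's function is $\mathcal{G}_{\mathbf X}(Q)=\mathrm{bTr}[(Q-\mathrm{diag}(X,X^* ))^{-1}]$, where $\mathrm{bTr}:M_2(M)\to M_2(\mathbb{C})$ applies $\tau$ entrywise; thus, with $X_z=z-X$, $\mathcal{G}_{\mathbf X}(z_\epsilon)=\begin{pmatrix}\tau[(X_z^*X_z+\epsilon^2)^{-1}X_z^*]&-i\epsilon\,\tau[(X_z^*X_z+\epsilon^2)^{-1}]\\-i\epsilon\,\tau[(X_z^*X_z+\epsilon^2)^{-1}]&\tau[X_z(X_z^*X_z+\epsilon^2)^{-1}]\end{pmatrix}$.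 $\mathcal{B}_{\mathbf X}$ is the Inverse Quaternionic Green's function (functional inverse of $\mathcal{G}_{\mathbf X}$); its domain consists of the $Q\in\mathbb{H}$ with $g\notin I_p\cup\{0\}$ and $g^I\notin I_q\cup\{0\}$, where $I_p=\{iy:|y|>1/|\alpha'-\alpha|\}$ and $I_q=\{iy:|y|>1/|\beta'-\beta|\}$. *)

(* Defs.v *)
From HB Require Import structures.
From mathcomp Require Import all_boot all_order all_algebra.
From mathcomp Require Import all_classical all_reals all_analysis.
From mathcomp Require Import complex.

Set Implicit Arguments.
Unset Strict Implicit.
Unset Printing Implicit Defensive.

Import Order.TTheory GRing.Theory Num.Theory.
Import numFieldNormedType.Exports.

Local Open Scope classical_set_scope.
Local Open Scope ring_scope.
Local Open Scope complex_scope.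

(** * Von Neumann algebras *)

(* Complex Hilbert spaces; [{dot V for Num.Def.conjC}] is linear in its first argument
   and conjugate-linear in the second. *)
Record hilbertSpace (R : realType) := HilbertSpace {
  hspace :> completeNormedModType R[i] ;
  hdot : {dot hspace for Num.Def.conjC} ;
  hdotE : forall x : hspace, `|x| ^+ 2 = hdot x x }.

(* A von Neumann algebra is presented as a unital complex algebra with an
   involution, together with a faithful unital *-representation on a Hilbert
   space whose image is equal to its bicommutant. *)
Record vonNeumannAlgebra (R : realType) := VonNeumannAlgebra {
  vn_alg :> algType R[i] ;
  vn_space : hilbertSpace R ;
  vn_rep : vn_alg -> {linear vn_space -> vn_space} ;
  star : vn_alg -> vn_alg ;
  vn_repP : forall (c : R[i]) (a b : vn_alg) (x : vn_space),
    vn_rep (c *: a + b) x = c *: vn_rep a x + vn_rep b x ;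
  vn_rep1 : forall x : vn_space, vn_rep 1 x = x ;
  vn_repM : forall (a b : vn_alg) (x : vn_space),
    vn_rep (a * b) x = vn_rep a (vn_rep b x) ;
  vn_rep_star : forall (a : vn_alg) (x y : vn_space),
    hdot vn_space (vn_rep a x) y = hdot vn_space x (vn_rep (star a) y) ;
  vn_rep_bounded : forall a : vn_alg, continuous (vn_rep a) ;
  vn_rep_inj : forall a b : vn_alg, vn_rep a =1 vn_rep b -> a = b ;
  vn_bicommutant : forall T : {linear vn_space -> vn_space},
    continuous T ->
    (forall S : {linear vn_space -> vn_space}, continuous S ->
      (forall (a : vn_alg) (x : vn_space), S (vn_rep a x) = vn_rep a (S x)) ->
      forall x : vn_space, T (S x) = S (T x)) ->
    exists a : vn_alg, vn_rep a =1 T }.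

Section VonNeumann.
Context {R : realType} {M : vonNeumannAlgebra R}.
Implicit Types (a b e s x y : M) (tau : M -> R[i]).

Definition hermitian_elt a := star a = a.

Definition vn_pos a := exists y, a = star y * y.

Definition vn_le a b := vn_pos (b - a).

Definition projection_elt e := star e = e /\ e * e = e.

(* Least upper bounds are taken in the ordered space of Hermitian elements. *)
Definition vn_is_sup (D : set M) s :=
  [/\ hermitian_elt s, forall d, D d -> vn_le d s &
      forall b, hermitian_elt b -> (forall d, D d -> vn_le d b) -> vn_le s b].

Definition vn_directed (D : set M) :=
  D !=set0 /\
  forall a b, D a -> D b -> exists c : M, [/\ D c, vn_le a c & vn_le b c].

Definition normal_functional tau :=
  forall (D : set M) s,
    D `<=` hermitian_elt -> vn_directed D -> vn_is_sup D s ->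
    forall c : R[i], (forall d, D d -> tau d <= c) -> tau s <= c.

Definition faithful_normal_tracial_state tau :=
  [/\ forall (c : R[i]) a b, tau (c *: a + b) = c * tau a + tau b,
      tau 1 = 1 /\ (forall a, 0 <= tau (star a * a)),
      forall a, tau (star a * a) = 0 -> a = 0,
      normal_functional tau &
      forall a b, tau (a * b) = tau (b * a)].

(** * Free independence *)

Inductive in_star_alg a : M -> Prop :=
| in_star_alg_gen : in_star_alg a a
| in_star_alg_comb (c : R[i]) x y :
    in_star_alg a x -> in_star_alg a y -> in_star_alg a (c *: x + y)
| in_star_alg_one : in_star_alg a 1
| in_star_alg_mul x y :
    in_star_alg a x -> in_star_alg a y -> in_star_alg a (x * y)
| in_star_alg_star x : in_star_alg a x -> in_star_alg a (star x).

(* A word is a list of letters [(i, x)], the tag [i] saying which of the two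
   generated algebras [x] is taken from. *)
Definition freely_independent tau a b :=
  forall w : seq (bool * M),
    (0 < size w)%N ->
    sorted (fun u v => u.1 != v.1) w ->
    (forall l, l \in w ->
       in_star_alg (if l.1 then a else b) l.2 /\ tau l.2 = 0) ->
    tau (\prod_(l <- w) l.2) = 0.

(** * Spectral measures, Fuglede-Kadison determinant *)

(* [E] is the spectral resolution of the Hermitian element [a]: a
   projection-valued measure on the line, concentrated on a bounded set, with
   [a] the integral of [t] against [E]. Countable additivity of [E] is that of
   the measures [m = <E(.) xi, xi>]. *)
Definition spectral_resolution a (E : set (measurableTypeR R) -> M) :=
  [/\ hermitian_elt a,
      forall B, measurable B -> projection_elt (E B),
      E setT = 1,
      exists r : R, E `[- r, r]%classic = 1 &
      forall xi : vn_space M,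
        exists m : {measure set (measurableTypeR R) -> \bar R},
          (forall B, measurable B ->
             m B = (complex.Re (hdot _ (vn_rep (E B) xi) xi))%:E) /\
          (\int[m]_t t%:E)%E = (complex.Re (hdot _ (vn_rep a xi) xi))%:E].

Definition spectral_measure tau a (mu : set (measurableTypeR R) -> \bar R) :=
  exists2 E, spectral_resolution a E &
    forall B, measurable B -> mu B = (complex.Re (tau (E B)))%:E.

Definition is_abs x a := vn_pos a /\ a * a = star x * x.

(* [lne 0 = -oo] and [expeR -oo = 0], so that the determinant vanishes as soon
   as the spectral measure of [|x|] charges 0. *)
Definition FK_det tau x (d : \bar R) :=
  exists (a : M) (mu : {measure set (measurableTypeR R) -> \bar R}),
    [/\ is_abs x a, spectral_measure tau a mu &
        d = expeR (\int[mu]_(t in `[0%R, +oo[) lne t%:E)%E].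

End VonNeumann.

(** * Brown measure *)

Section Plane.
Context {R : realType}.

(* The complex number [x + iy] is identified with the point [(x, y)]. *)
Definition toC (z : R * R) : R[i] := z.1 +i* z.2.

(* Iterated directional derivatives, the last direction of the list first. *)
Definition iter_derive (vs : seq (R * R)) (f : R * R -> R) : R * R -> R :=
  foldr (fun v (g : R * R -> R) z => 'D_v g z) f vs.

Definition smooth (f : R * R -> R) :=
  forall vs : seq (R * R),
    continuous (iter_derive vs f) /\
    forall z v, derivable (iter_derive vs f) z v.

Definition test_function (f : R * R -> R) :=
  smooth f /\ exists2 K : set (R * R), compact K & forall z, ~ K z -> f z = 0.

Definition laplacian (f : R * R -> R) (z : R * R) : R :=
  iter_derive [:: (1, 0); (1, 0)] f z + iter_derive [:: (0, 1); (0, 1)] f z.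

Definition msupport
    (mu : set (measurableTypeR R * measurableTypeR R) -> \bar R) :
    set (R * R) :=
  [set z | forall U : set (R * R), open U -> U z -> (0 < mu U)%E].

(* [mu] is 1/(2 pi) times the distributional Laplacian of
   [z |-> log Delta (z - X)], tested against compactly supported smooth
   functions. *)
Definition brown_measure {M : vonNeumannAlgebra R} (tau : M -> R[i]) (X : M)
    (mu : {measure set (measurableTypeR R * measurableTypeR R) -> \bar R}) :=
  exists2 Delta : M -> \bar R, forall x, FK_det tau x (Delta x) &
    forall f : R * R -> R, test_function f ->
      (\int[mu]_z (f z)%:E =
       ((2 * pi)^-1)%:E *
       \int[(@lebesgue_measure R \x @lebesgue_measure R)%E]_z
         ((laplacian f z)%:E * lne (Delta ((toC z)%:A - X)%R)))%E.

Definition two_point (a a' : R) : set (measurableTypeR R) -> \bar R :=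
  fun B => ((2^-1)%:E * \d_a B + (2^-1)%:E * \d_a' B)%E.

End Plane.

(** * Quaternions and the quaternionic Green's function *)

Section Quaternion.
Context {R : realType}.
Implicit Types (A B z : R[i]) (Q : 'M[R[i]]_2).

Definition quat A B : 'M[R[i]]_2 :=
  \matrix_(i, j)
    if i == 0 then (if j == 0 then A else 'i * B^*)
    else (if j == 0 then 'i * B else A^*).

Definition qnorm Q : R := Num.sqrt (complex.Re (\det Q)).

(* For [A = x0 + i x3] and [B = x1 + i x2], the eigenvalues with nonnegative
   imaginary part of [quat A B] and of [quat A B *m diag(i, -i)]. *)
Definition eig A B : R[i] :=
  let: x0 +i* x3 := A in let: x1 +i* x2 := B in
  x0 +i* Num.sqrt (x1 ^+ 2 + x2 ^+ 2 + x3 ^+ 2).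

Definition eigI A B : R[i] :=
  let: x0 +i* x3 := A in let: x1 +i* x2 := B in
  (- x3) +i* Num.sqrt (x0 ^+ 2 + x1 ^+ 2 + x2 ^+ 2).

(* The cut [{iy : |y| > 1 / |a' - a|}]. *)
Definition imag_cut (a a' : R) : set R[i] :=
  [set z | exists2 y : R, `|y| > 1 / `|a' - a| & z = 0 +i* y].

Definition inv_green_domain (alpha alpha' beta beta' : R) : set 'M[R[i]]_2 :=
  [set Q | exists A B, [/\ Q = quat A B,
     ~ (imag_cut alpha alpha' `|` [set 0]) (eig A B) &
     ~ (imag_cut beta beta' `|` [set 0]) (eigI A B)]].

Definition zeps z (eps : R) : 'M[R[i]]_2 := quat z eps%:C.

Context {M : vonNeumannAlgebra R}.

Definition diag_star (X : M) : 'M[M]_2 :=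
  \matrix_(i, j) if i == j then (if i == 0 then X else star X) else 0.

(* The inverse in [M_2(M)], with default value 0 on non-invertible elements. *)
Definition minv (P : 'M[M]_2) : 'M[M]_2 :=
  xget 0 [set Y | P *m Y = 1%:M /\ Y *m P = 1%:M].

Definition bTr (tau : M -> R[i]) (P : 'M[M]_2) : 'M[R[i]]_2 := map_mx tau P.

Definition green (tau : M -> R[i]) (X : M) Q : 'M[R[i]]_2 :=
  bTr tau (minv (map_mx (fun c : R[i] => c%:A) Q - diag_star X)).

(* [L] is the limit of [G(z_eps)] as [eps -> 0+], in the norm of H. *)
Definition green_limit (tau : M -> R[i]) (X : M) z (L : 'M[R[i]]_2) :=
  (exists A B, L = quat A B) /\
  qnorm (green tau X (zeps z eps) - L) @[eps --> (0 : R)^'+] --> (0 : R).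

End Quaternion.

(* Main.v *)
Require Import Defs.
From HB Require Import structures.
From mathcomp Require Import all_boot all_order all_algebra.
From mathcomp Require Import all_classical all_reals all_analysis.
From mathcomp Require Import measurable_realfun complex.
From mathcomp Require Import ring lra.
Import Order.TTheory GRing.Theory Num.Theory.
Import numFieldNormedType.Exports.
Local Open Scope classical_set_scope.
Local Open Scope ring_scope.
Local Open Scope complex_scope.
Set Implicit Arguments.
Unset Strict Implicit.
Unset Printing Implicit Defensive.

(** The operators [p] and [q] are affine functions of two symmetries [u] and [v]
(Hermitian, of square 1, of trace 0) which are free, so that every alternating
product of [u] and [v] has trace 0. With [a] and [b] half of the signed distances
between the atoms and [w] the position of [z] relative to [tau X], we have
[z - X = w - (a u + i b v)]. Let [kappa = (w^2 - a^2 + b^2) / (2 i a b)]. Both sides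
of the theorem are equal to the [arc] of those [z] with [kappa] in [-1, 1], a closed
piece of a rectangular hyperbola.

The reason is that [h = (u v + v u) / 2] commutes with [u] and [v], and
[(w - (a u + i b v)) (w + (a u + i b v)) = 2 i a b (kappa - h)]. Multiplying
[x^* x + e], where [x = z - X], by a similar quadratic element therefore gives
[4 a^2 b^2 (zeta - h) (zeta^* - h)], with an explicit point [zeta] depending on [e].
Finally [h] has the arcsine distribution: if [n + n^-1 = 2 zeta] and [|n| < 1], then
[2 n (zeta - h) = (1 - n u v) (1 - n v u)], and the traces of the inverses are read
off from Neumann series ([half_sum_resolvent], [model_resolvent]).

For the Green's function the consequence is a closed formula ([green_model]). Off the
arc [zeta] stays away from [-1, 1] as [eps] tends to 0, so the limit exists and its
off-diagonal part is 0. At a point of the arc other than the end points and the points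
on the axes, the quaternion lies in the domain of the inverse function, and its
off-diagonal part is bounded away from 0. Those points are dense in the arc
([closure_green_exceptional]).

For the Brown measure, the derivative in [e] of [tau (ln (x^* x + e))] is the trace of
the resolvent, which integrates in closed form. Hence
[ln Delta (z - X) = (ln |a b| - ln |n|) / 2] for all [z], where [n] is the root
attached to [kappa] ([FK_det_model]). This function is harmonic off the arc, so the
measure vanishes there ([support_arc]). It is continuous and attains its minimum
exactly on the arc; a test function built from the logarithm of the distance to a point shows that it is
not harmonic in the weak sense near any point of the arc
([bump_detects_minimum], [arc_support]).

The link between the determinant, defined through a spectral resolution of [|x|], and
resolvents goes through Riemann sums in operator norm ([spectral_resolvent],
[FK_det_resolvent]). Operator-norm limits stay in the algebra by the bicommutant
property ([vn_complete]), and they are controlled by the trace because [1 - y] is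
positive as soon as [y] is a strict Hermitian contraction ([vn_pos_1B], [cabs_tau_le]). *)

(** * The inverse Joukowski map *)

Section ComplexModulus.
Context {R : realType}.
Implicit Types (z w n : R[i]).

(** The modulus as an element of [R]: the norm of [R[i]] takes its values in [R[i]]. *)
Definition cabs z : R := Num.sqrt (complex.Re z ^+ 2 + complex.Im z ^+ 2).

Lemma cabsE z : `|z| = (cabs z)%:C.
Proof. by rewrite normc_def. Qed.

Lemma cabsM z w : cabs (z * w) = cabs z * cabs w.
Proof. by apply: complexI; rewrite rmorphM /= -!cabsE normrM. Qed.

Lemma cabsV z : cabs z^-1 = (cabs z)^-1.
Proof. by apply: complexI; rewrite fmorphV /= -!cabsE normfV. Qed.

Lemma cabsN z : cabs (- z) = cabs z.
Proof. by apply: complexI; rewrite -!cabsE normrN. Qed.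

Lemma cabs_triangle z w : cabs (z + w) <= cabs z + cabs w.
Proof. by rewrite -lecR rmorphD /= -!cabsE ler_normD. Qed.

Lemma cabs_ge0 z : 0 <= cabs z.
Proof. exact: sqrtr_ge0. Qed.

Lemma cabs_sqr z : cabs z ^+ 2 = complex.Re z ^+ 2 + complex.Im z ^+ 2.
Proof. by rewrite sqr_sqrtr// addr_ge0// sqr_ge0. Qed.

Lemma cabs_eq0 z : (cabs z == 0) = (z == 0).
Proof. by rewrite -(inj_eq (@complexI R)) -cabsE normr_eq0. Qed.

Lemma cabs_gt0 z : (0 < cabs z) = (z != 0).
Proof. by rewrite lt_neqAle cabs_ge0 andbT eq_sym cabs_eq0. Qed.

Lemma cabs_real (r : R) : cabs r%:C = `|r|.
Proof. by rewrite /cabs /= expr0n addr0 sqrtr_sqr. Qed.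

Lemma cabs1 : cabs 1 = 1.
Proof. by have := cabs_real 1; rewrite normr1. Qed.

Lemma ler_Re_cabs z : `|complex.Re z| <= cabs z.
Proof. by rewrite -ler_sqr ?nnegrE ?cabs_ge0// real_normK ?num_real// cabs_sqr lerDl sqr_ge0. Qed.

Lemma ler_Im_cabs z : `|complex.Im z| <= cabs z.
Proof. by rewrite -ler_sqr ?nnegrE ?cabs_ge0// real_normK ?num_real// cabs_sqr lerDr sqr_ge0. Qed.

Lemma ler_cabs_ReIm z : cabs z <= `|complex.Re z| + `|complex.Im z|.
Proof.
rewrite -ler_sqr ?nnegrE ?cabs_ge0 ?addr_ge0// cabs_sqr sqrrD !real_normK ?num_real//.
by rewrite -addrA lerD2l lerDr mulrn_wge0// mulr_ge0.
Qed.

Lemma cabs_distC z w : cabs (z - w) = cabs (w - z).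
Proof. by rewrite -cabsN opprB. Qed.

Lemma ReM z w : complex.Re (z * w) =
  complex.Re z * complex.Re w - complex.Im z * complex.Im w.
Proof. by case: z w => ? ? [? ?]. Qed.

Lemma ImM z w : complex.Im (z * w) =
  complex.Re z * complex.Im w + complex.Im z * complex.Re w.
Proof. by case: z w => ? ? [? ?]. Qed.

Lemma ReD z w : complex.Re (z + w) = complex.Re z + complex.Re w.
Proof. by case: z w => ? ? [? ?]. Qed.

Lemma ImD z w : complex.Im (z + w) = complex.Im z + complex.Im w.
Proof. by case: z w => ? ? [? ?]. Qed.

Lemma ReN z : complex.Re (- z) = - complex.Re z. Proof. by case: z. Qed.
Lemma ImN z : complex.Im (- z) = - complex.Im z. Proof. by case: z. Qed.

Lemma ReV z : complex.Re z^-1 = complex.Re z / cabs z ^+ 2.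
Proof. by rewrite cabs_sqr; case: z. Qed.

Lemma ImV z : complex.Im z^-1 = - complex.Im z / cabs z ^+ 2.
Proof. by rewrite cabs_sqr; case: z => a b /=; rewrite mulNr. Qed.

Lemma complex_ext z w : complex.Re z = complex.Re w ->
  complex.Im z = complex.Im w -> z = w.
Proof. by case: z w => ? ? [? ?] /= -> ->. Qed.

End ComplexModulus.

Section Joukowski.
Context {R : realType}.
Implicit Types (z w n : R[i]).

(** The root of modulus at most 1 of [n + n^-1 = 2 z]. *)
Definition joukowski_inv z : R[i] :=
  let s := sqrtc (z ^+ 2 - 1) in
  if cabs (z + s) <= 1 then z + s else z - s.

Lemma joukowski_invP z : joukowski_inv z * (2 * z - joukowski_inv z) = 1.
Proof.
rewrite /joukowski_inv; set s := sqrtc _.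
have hs : s ^+ 2 = z ^+ 2 - 1 by rewrite sqr_sqrtc.
by case: ifP => _; rewrite mulrBr ?mulrDl; ring: hs.
Qed.

Lemma joukowski_inv_neq0 z : joukowski_inv z != 0.
Proof.
by apply/eqP => h; have := joukowski_invP z; rewrite h mul0r => /eqP; rewrite eq_sym oner_eq0.
Qed.

Lemma joukowski_invE z : joukowski_inv z + (joukowski_inv z)^-1 = 2 * z.
Proof.
have h := joukowski_invP z; set n := joukowski_inv z in h *.
have n0 : n != 0 := joukowski_inv_neq0 z.
apply: (mulfI n0); rewrite mulrDr divff//.
have -> : n * n + 1 = n * n + n * (2 * z - n) by rewrite h.
ring.
Qed.

Lemma cabs_joukowski_inv_le1 z : cabs (joukowski_inv z) <= 1.
Proof.
have h := joukowski_invP z; move: h; rewrite /joukowski_inv; set s := sqrtc _.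
case: ifP => // /negbT; rewrite -ltNge => h1 h2.
have : cabs (z - s) * cabs (z + s) = 1.
  by rewrite -cabsM -cabs1 -h2; congr cabs; congr (_ * _); ring.
move=> h3; rewrite leNgt; apply/negP => h4.
by have := mulr_egt1 h4 h1; rewrite h3 ltxx.
Qed.

Lemma cabs_joukowski_inv_gt0 z : 0 < cabs (joukowski_inv z).
Proof. by rewrite cabs_gt0 joukowski_inv_neq0. Qed.

(** With [n + n^-1 = 2 z], the numbers [z - 1] and [z + 1] are [(n - 1)^2 / 2 n] and
[(n + 1)^2 / 2 n], and the parallelogram law applies: [z] lies on the ellipse
with foci -1 and 1 that is the image of the circle through [n]. *)
Lemma focal_sum z :
  cabs (z - 1) + cabs (z + 1) = cabs (joukowski_inv z) + (cabs (joukowski_inv z))^-1.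
Proof.
have n0 := joukowski_inv_neq0 z; have := joukowski_invE z.
set n := joukowski_inv z in n0 * => h.
have c0 : cabs n != 0 by rewrite cabs_eq0.
have two : cabs (2 : R[i]) = 2 by have := @cabs_real R 2; rewrite rmorph_nat normr_nat.
have hz : z = (n + n^-1) / 2 by rewrite h mulrAC divff ?mul1r// pnatr_eq0.
have e1 : z - 1 = (n - 1) ^+ 2 / (2 * n).
  by rewrite hz; field; rewrite ?n0 ?pnatr_eq0.
have e2 : z + 1 = (n + 1) ^+ 2 / (2 * n).
  by rewrite hz; field; rewrite ?n0 ?pnatr_eq0.
rewrite e1 e2 expr2 (expr2 (n + 1)) !cabsM !cabsV !cabsM two -!expr2 !cabs_sqr.
have hn : complex.Re n ^+ 2 + complex.Im n ^+ 2 = cabs n ^+ 2 by rewrite cabs_sqr.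
have -> : cabs n + (cabs n)^-1 = (cabs n ^+ 2 + 1) / cabs n.
  by field.
rewrite -hn.
move: c0 {hn e1 e2 hz h n0}; set c := cabs n; case: n @c => a b c c0 /=.
by field.
Qed.

Lemma cabs_joukowski_inv_lt1 z :
  (cabs (joukowski_inv z) < 1) = (2 < cabs (z - 1) + cabs (z + 1)).
Proof.
rewrite focal_sum; have := cabs_joukowski_inv_le1 z; have := cabs_joukowski_inv_gt0 z.
set c := cabs _ => c0 c1.
have -> : (2 < c + c^-1) = (0 < (c - 1) ^+ 2 / c).
  rewrite -subr_gt0; congr (_ < _); field; exact: lt0r_neq0.
by rewrite pmulr_lgt0 ?invr_gt0// exprn_even_gt0//= subr_eq0 lt_neqAle c1 andbT.
Qed.

Lemma joukowski_inv_dist z w :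
  (joukowski_inv w - joukowski_inv z) * (joukowski_inv z * joukowski_inv w - 1) =
  2 * (w - z) * (joukowski_inv z * joukowski_inv w).
Proof.
have := joukowski_invE z; have := joukowski_invE w.
have := joukowski_inv_neq0 z; have := joukowski_inv_neq0 w.
set m := joukowski_inv w; set n := joukowski_inv z => m0 n0 hm hn.
by rewrite (mulrBr 2) -hm -hn; field; rewrite ?m0 ?n0.
Qed.

Lemma joukowski_inv_mul_neq1 z w : cabs (joukowski_inv z) < 1 ->
  joukowski_inv z * joukowski_inv w - 1 != 0.
Proof.
move=> h; rewrite subr_eq0; apply/eqP => /(congr1 cabs); rewrite cabsM cabs1 => e.
have := cabs_joukowski_inv_le1 w => w1.
have := ler_wpM2l (ltW (cabs_joukowski_inv_gt0 z)) w1; rewrite e mulr1 leNgt h//.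
Qed.

(** The difference quotient is explicit and its denominator is bounded away from 0
as soon as one of the two roots is inside the disk; this gives continuity without
any discussion of branches of the square root. *)
Lemma joukowski_inv_lipschitz z w : cabs (joukowski_inv z) < 1 ->
  cabs (joukowski_inv w - joukowski_inv z) <=
  2 * cabs (w - z) / (1 - cabs (joukowski_inv z)).
Proof.
move=> h; have := joukowski_inv_dist z w.
set m := joukowski_inv w; set n := joukowski_inv z => e.
have m1 : cabs m <= 1 := cabs_joukowski_inv_le1 w.
have n0 : 0 < cabs n := cabs_joukowski_inv_gt0 z.
have two : cabs (2 : R[i]) = 2 by have := @cabs_real R 2; rewrite rmorph_nat normr_nat.
have := congr1 cabs e; rewrite !cabsM two => e'.
have tri : 1 - cabs n <= cabs (n * m - 1).
  have := cabs_triangle (1 - n * m) (n * m); rewrite subrK cabs1 cabsM cabs_distC => t.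
  have := ler_wpM2l (ltW n0) m1; rewrite mulr1 => t2; lra.
rewrite ler_pdivlMr ?subr_gt0//.
apply: (@le_trans _ _ (cabs (m - n) * cabs (n * m - 1))).
  exact: ler_wpM2l (cabs_ge0 _) _ _ tri.
rewrite e' -[leRHS]mulr1 ler_wpM2l ?mulr_ge0 ?cabs_ge0//.
by rewrite mulr_ile1 ?cabs_ge0// ltW.
Qed.

(** The Cauchy transform of the arcsine law on [-1, 1]. *)
Definition arcsine_cauchy z : R[i] :=
  2 * joukowski_inv z / (1 - joukowski_inv z ^+ 2).

Lemma joukowski_sqr_neq1 z : cabs (joukowski_inv z) < 1 ->
  1 - joukowski_inv z ^+ 2 != 0.
Proof.
by move=> h; rewrite -opprB oppr_eq0 expr2; exact: joukowski_inv_mul_neq1.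
Qed.

Lemma Re_joukowski z : 2 * complex.Re z =
  complex.Re (joukowski_inv z) * (1 + (cabs (joukowski_inv z) ^+ 2)^-1).
Proof.
have := congr1 (@complex.Re R) (joukowski_invE z); rewrite mulr_natl mulr2n !ReD ReV => e.
by rewrite mulr_natl mulr2n -e mulrDr mulr1.
Qed.

Lemma Im_joukowski z : 2 * complex.Im z =
  complex.Im (joukowski_inv z) * (1 - (cabs (joukowski_inv z) ^+ 2)^-1).
Proof.
have := congr1 (@complex.Im R) (joukowski_invE z); rewrite mulr_natl mulr2n !ImD ImV => e.
by rewrite mulr_natl mulr2n -e mulrBr mulr1 mulNr.
Qed.

Lemma Re_arcsine_cauchy z : complex.Re (arcsine_cauchy z) =
  2 * complex.Re (joukowski_inv z) * (1 - cabs (joukowski_inv z) ^+ 2) /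
  cabs (1 - joukowski_inv z ^+ 2) ^+ 2.
Proof.
rewrite /arcsine_cauchy [cabs (joukowski_inv z) ^+ 2]cabs_sqr ReM ReV ImV.
move: (joukowski_inv z) => n; move: (cabs _ ^+ 2) => D.
by rewrite mulr_natl mulr2n expr2 !(ReD, ImD, ReN, ImN, ReM, ImM) /=; ring.
Qed.

Lemma Im_arcsine_cauchy z : complex.Im (arcsine_cauchy z) =
  2 * complex.Im (joukowski_inv z) * (1 + cabs (joukowski_inv z) ^+ 2) /
  cabs (1 - joukowski_inv z ^+ 2) ^+ 2.
Proof.
rewrite /arcsine_cauchy [cabs (joukowski_inv z) ^+ 2]cabs_sqr ImM ReV ImV.
move: (joukowski_inv z) => n; move: (cabs _ ^+ 2) => D.
by rewrite mulr_natl mulr2n expr2 !(ReD, ImD, ReN, ImN, ReM, ImM) /=; ring.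
Qed.

(** The integral of the squared modulus of the resolvent at [z] against the
arcsine law; unlike [- Im (arcsine_cauchy z) / Im z], this form stays meaningful
at real [z] outside of [-1, 1]. *)
Definition arcsine_square z : R :=
  4 * cabs (joukowski_inv z) ^+ 2 * (1 + cabs (joukowski_inv z) ^+ 2) /
  (cabs (1 - joukowski_inv z ^+ 2) ^+ 2 * (1 - cabs (joukowski_inv z) ^+ 2)).

Lemma arcsine_squareE z : cabs (joukowski_inv z) < 1 ->
  complex.Im z * arcsine_square z = - complex.Im (arcsine_cauchy z).
Proof.
move=> h; rewrite Im_arcsine_cauchy /arcsine_square.
have -> : complex.Im z = complex.Im (joukowski_inv z) *
    (1 - (cabs (joukowski_inv z) ^+ 2)^-1) / 2.
  by rewrite -Im_joukowski mulrAC divff ?mul1r.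
have c0 := cabs_joukowski_inv_gt0 z.
have : 0 < cabs (1 - joukowski_inv z ^+ 2) by rewrite cabs_gt0 joukowski_sqr_neq1.
move: h c0; set c := cabs (joukowski_inv z); set d := cabs (1 - _) => h c0 d0.
have c2 : 1 - c ^+ 2 != 0.
  by rewrite subr_eq0 eq_sym lt_eqF// expr_lt1// ltW.
by field; rewrite c2 !lt0r_neq0.
Qed.

Lemma arcsine_square_gt0 z : cabs (joukowski_inv z) < 1 -> 0 < arcsine_square z.
Proof.
move=> h; have c0 := cabs_joukowski_inv_gt0 z.
have d0 : 0 < cabs (1 - joukowski_inv z ^+ 2) by rewrite cabs_gt0 joukowski_sqr_neq1.
have p1 : 0 < 1 - cabs (joukowski_inv z) ^+ 2 by rewrite subr_gt0 expr_lt1// ltW.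
have p2 : 0 < 1 + cabs (joukowski_inv z) ^+ 2 by rewrite addr_gt0 ?exprn_gt0.
by apply: divr_gt0; repeat (apply: mulr_gt0 || apply: exprn_gt0).
Qed.

End Joukowski.

(** * Limits and derivatives of complex-valued functions *)

Section ComplexLimits.
Context {R : realType}.
Implicit Types (z w l : R[i]).

(** Convergence of the real and imaginary parts: a limit of complex-valued functions
stated with the topology of [R] only. *)
Definition ccvg {T : Type} (F : set_system T) (f : T -> R[i]) l :=
  complex.Re (f x) @[x --> F] --> complex.Re l /\
  complex.Im (f x) @[x --> F] --> complex.Im l.

Context {T : Type} {F : set_system T} {FF : Filter F}.
Implicit Types (f g : T -> R[i]).

Lemma ccvg_cst l : ccvg F (fun=> l) l.
Proof. by split; exact: cvg_cst. Qed.

Lemma ccvgD f g l m : ccvg F f l -> ccvg F g m -> ccvg F (fun x => f x + g x) (l + m).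
Proof.
move=> [h1 h2] [k1 k2]; split; rewrite ?ReD ?ImD.
  by under eq_fun do rewrite ReD; exact: cvgD.
by under eq_fun do rewrite ImD; exact: cvgD.
Qed.

Lemma ccvgN f l : ccvg F f l -> ccvg F (fun x => - f x) (- l).
Proof.
move=> [h1 h2]; split; rewrite ?ReN ?ImN.
  by under eq_fun do rewrite ReN; exact: cvgN.
by under eq_fun do rewrite ImN; exact: cvgN.
Qed.

Lemma ccvgM f g l m : ccvg F f l -> ccvg F g m -> ccvg F (fun x => f x * g x) (l * m).
Proof.
move=> [h1 h2] [k1 k2]; split; rewrite ?ReM ?ImM.
  by under eq_fun do rewrite ReM; apply: cvgB; exact: cvgM.
by under eq_fun do rewrite ImM; apply: cvgD; exact: cvgM.
Qed.

Lemma ccvg_cabs2 f l : ccvg F f l -> cabs (f x) ^+ 2 @[x --> F] --> cabs l ^+ 2.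
Proof.
move=> [h1 h2]; rewrite cabs_sqr; under eq_fun do rewrite cabs_sqr.
by rewrite !expr2; under eq_fun do rewrite !expr2; apply: cvgD; exact: cvgM.
Qed.

Lemma ccvg_cabs f l : ccvg F f l -> cabs (f x) @[x --> F] --> cabs l.
Proof.
move=> h; have := ccvg_cabs2 h => h2.
have e z : cabs z = Num.sqrt (cabs z ^+ 2) by rewrite sqrtr_sqr ger0_norm ?cabs_ge0.
rewrite e; under eq_fun do rewrite e.
exact: (cvg_comp _ _ h2 (@sqrt_continuous R _)).
Qed.

Lemma ccvgV f l : l != 0 -> ccvg F f l -> ccvg F (fun x => (f x)^-1) l^-1.
Proof.
move=> l0 h; have h2 := ccvg_cabs2 h; case: h => h1 h3.
have c0 : cabs l ^+ 2 != 0 by rewrite expf_neq0// cabs_eq0.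
split; rewrite ?ReV ?ImV.
  under eq_fun do rewrite ReV; apply: cvgM => //; exact: cvgV.
under eq_fun do rewrite ImV; apply: cvgM; [exact: cvgN|exact: cvgV].
Qed.

Lemma ccvg_real (f : T -> R) (l : R) : f @ F --> l -> ccvg F (fun x => (f x)%:C) l%:C.
Proof. by move=> h; split => //=; exact: cvg_cst. Qed.

Lemma ccvg_conj f l : ccvg F f l -> ccvg F (fun x => conjc (f x)) (conjc l).
Proof.
have re z : complex.Re (conjc z) = complex.Re z by case: z.
have im z : complex.Im (conjc z) = - complex.Im z by case: z.
move=> [h1 h2]; split; rewrite ?re ?im.
  by under eq_fun do rewrite re.
by under eq_fun do rewrite im; exact: cvgN.
Qed.

(** Both parts of [f x - l] are squeezed between minus and plus its modulus. *)
Lemma ccvg_dist f l : cabs (f x - l) @[x --> F] --> 0 -> ccvg F f l.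
Proof.
move=> h.
have hN : - cabs (f x - l) @[x --> F] --> (0 : R) by rewrite -oppr0; exact: cvgN.
have key (p : R[i] -> R) : (forall z w, p (z - w) = p z - p w) ->
    (forall z, `|p z| <= cabs z) -> p (f x) @[x --> F] --> p l.
  move=> pB pc; apply/subr_cvg0.
  apply: (squeeze_cvgr _ hN h); near=> x.
  by rewrite -pB -ler_norml pc.
by split; apply: key => *; rewrite ?(ReD, ImD, ReN, ImN) ?ler_Re_cabs ?ler_Im_cabs.
Unshelve. all: by end_near.
Qed.

End ComplexLimits.

Section ComplexDerivatives.
Context {R : realType}.
Implicit Types (f g : R -> R[i]) (t : R).

(** The derivative at [t] of a complex-valued function of a real variable, stated on
its real and imaginary parts. *)
Definition cderive_at f t (D : R[i]) :=
  is_derive t 1 (fun s => complex.Re (f s)) (complex.Re D) /\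
  is_derive t 1 (fun s => complex.Im (f s)) (complex.Im D).

Lemma is_derive_cvg (h : R -> R) t (d : R) :
  is_derive t 1 h d <-> e^-1 * (h (e + t) - h t) @[e --> 0^'] --> d.
Proof.
have E : (fun e => e^-1 *: (h (e *: 1 + t) - h t)) = (fun e => e^-1 * (h (e + t) - h t)).
  by apply/funext => e; rewrite [e *: 1]mulr1.
split=> [[dh <-]|hd].
  by rewrite -E; exact: dh.
split; first by rewrite /derivable E; apply/cvg_ex; exists d.
by rewrite /derive E; exact: cvg_lim.
Qed.

Lemma cderive_atP f t D :
  cderive_at f t D <-> ccvg 0^' (fun e : R => e^-1%:C * (f (e + t) - f t)) D.
Proof.
have re (e : R) z : complex.Re (e%:C * z) = e * complex.Re z.
  by rewrite ReM /= mul0r subr0.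
have im (e : R) z : complex.Im (e%:C * z) = e * complex.Im z.
  by rewrite ImM /= mul0r addr0.
rewrite /cderive_at /ccvg !is_derive_cvg.
have -> : (fun e => complex.Re (e^-1%:C * (f (e + t) - f t))) =
    (fun e => e^-1 * (complex.Re (f (e + t)) - complex.Re (f t))).
  by apply/funext => e; rewrite re ReD ReN.
have -> // : (fun e => complex.Im (e^-1%:C * (f (e + t) - f t))) =
    (fun e => e^-1 * (complex.Im (f (e + t)) - complex.Im (f t))).
by apply/funext => e; rewrite im ImD ImN.
Qed.

Lemma cderive_at_cst (c : R[i]) t : cderive_at (fun=> c) t 0.
Proof. by split; exact: is_derive_cst. Qed.

Lemma cderive_atD f g t D E : cderive_at f t D -> cderive_at g t E ->
  cderive_at (fun s => f s + g s) t (D + E).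
Proof.
move=> [h1 h2] [k1 k2]; split; rewrite ?ReD ?ImD.
  by under eq_fun do rewrite ReD; exact: is_deriveD.
by under eq_fun do rewrite ImD; exact: is_deriveD.
Qed.

Lemma cderive_atM f g t D E : cderive_at f t D -> cderive_at g t E ->
  cderive_at (fun s => f s * g s) t (f t * E + D * g t).
Proof.
move=> [h1 h2] [k1 k2]; split; rewrite ?ReD ?ImD ?ReM ?ImM.
  under eq_fun do rewrite ReM; apply: is_derive_eq; rewrite /GRing.scale /=; ring.
under eq_fun do rewrite ImM; apply: is_derive_eq; rewrite /GRing.scale /=; ring.
Qed.

Lemma cderive_at_ccvg f t D : cderive_at f t D -> ccvg 0^' (fun e : R => f (e + t)) (f t).
Proof.
have key (h : R -> R) d : is_derive t 1 h d -> h (e + t) @[e --> 0^'] --> h t.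
  move=> [dh _]; have c := differentiable_continuous ((derivable1_diffP h t).1 dh).
  have shift : e + t @[e --> 0^'] --> t.
    rewrite -[X in _ --> X]add0r; apply: cvgD; last exact: cvg_cst.
    by apply: cvg_within_filter; exact: cvg_id.
  exact: cvg_comp shift c.
by move=> [h1 h2]; split; [exact: key h1|exact: key h2].
Qed.

(** The exact formula for the difference of two values of [joukowski_inv] gives the
limit of the difference quotients. *)
Lemma cderive_at_joukowski_inv f t D : cderive_at f t D ->
  cabs (joukowski_inv (f t)) < 1 ->
  cderive_at (fun s => joukowski_inv (f s)) t
    (- (joukowski_inv (f t) * arcsine_cauchy (f t) * D)).
Proof.
move=> df lt1.
have cE : ccvg 0^' (fun e : R => joukowski_inv (f (e + t))) (joukowski_inv (f t)).
  apply: ccvg_dist.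
  have h0 : 2 * cabs (f (e + t) - f t) / (1 - cabs (joukowski_inv (f t)))
      @[e --> 0^'] --> (0 : R).
    rewrite -[X in _ --> X](mul0r (1 - cabs (joukowski_inv (f t)))^-1).
    apply: cvgMl; rewrite -[X in _ --> X](mulr0 2); apply: cvgMr.
    have e0 : cabs (f t - f t) = 0 by rewrite subrr (@cabs_real R 0) normr0.
    rewrite -[X in _ --> X]e0.
    apply: ccvg_cabs; apply: ccvgD; [exact: cderive_at_ccvg df|exact: ccvg_cst].
  apply: (squeeze_cvgr _ (cvg_cst 0) h0); near=> e.
  by rewrite cabs_ge0 joukowski_inv_lipschitz.
move: df => /cderive_atP df; apply/cderive_atP.
set n := joukowski_inv (f t) in cE lt1 *.
have n1 : n * n - 1 != 0 by exact: joukowski_inv_mul_neq1.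
have -> : - (n * arcsine_cauchy (f t) * D) = 2 * D * (n * n) * (n * n - 1)^-1.
  rewrite /arcsine_cauchy -/n.
  have n2 : 1 - n ^+ 2 != 0 := joukowski_sqr_neq1 lt1.
  have e2 : 1 - n ^+ 2 = - (n * n - 1) by ring.
  by rewrite e2; field.
under [X in ccvg _ X _]eq_fun => e.
  have -> : e^-1%:C * (joukowski_inv (f (e + t)) - n) =
      2 * (e^-1%:C * (f (e + t) - f t)) * (n * joukowski_inv (f (e + t))) *
      (n * joukowski_inv (f (e + t)) - 1)^-1.
    have := joukowski_inv_dist (f t) (f (e + t)); rewrite -/n => hh.
    have m1 : n * joukowski_inv (f (e + t)) - 1 != 0 by exact: joukowski_inv_mul_neq1.
    apply: (mulIf m1); rewrite mulfVK// -[LHS]mulrA hh; ring.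
  over.
apply: ccvgM; last first.
  apply: ccvgV => //; apply: ccvgD; last exact: ccvg_cst.
  by apply: ccvgM => //; exact: ccvg_cst.
apply: ccvgM; first by apply: ccvgM => //; exact: ccvg_cst.
by apply: ccvgM => //; exact: ccvg_cst.
Unshelve. all: by end_near.
Qed.

Lemma cderive_atV f t D : f t != 0 -> cderive_at f t D ->
  cderive_at (fun s => (f s)^-1) t (- (D / f t ^+ 2)).
Proof.
move=> f0 df; have cf := cderive_at_ccvg df.
have c2 := ccvg_cabs2 cf.
move: (df) => /cderive_atP df'; apply/cderive_atP.
have nz : \forall e \near (0 : R)^', f (e + t) != 0.
  have : 0 < cabs (f t) ^+ 2 by rewrite exprn_gt0// cabs_gt0.
  move=> /(cvgr_gt _ (c2 _)) => h; apply: filterS h => e.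
  by rewrite exprn_even_gt0//= cabs_eq0.
have lim : ccvg 0^' (fun e : R => - ((e^-1%:C * (f (e + t) - f t)) / (f t * f (e + t))))
   (- (D / f t ^+ 2)).
  apply: ccvgN; apply: ccvgM => //; apply: ccvgV; first by rewrite mulf_neq0.
  by apply: ccvgM => //; exact: ccvg_cst.
have eqn : \forall e \near (0 : R)^', - ((e^-1%:C * (f (e + t) - f t)) / (f t * f (e + t))) =
    e^-1%:C * ((f (e + t))^-1 - (f t)^-1).
  near=> e; have ne : f (e + t) != 0 by near: e.
  by move: (e^-1%:C) (f (e + t)) ne (f t) f0 => c y y0 x x0; field; rewrite x0 y0.
case: lim => l1 l2; split.
  by apply: (cvg_trans _ l1); apply: near_eq_cvg; apply: filterS eqn => e ->.
by apply: (cvg_trans _ l2); apply: near_eq_cvg; apply: filterS eqn => e ->.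
Unshelve. all: by end_near.
Qed.

(** The logarithmic derivative of the modulus is the real part of the complex
logarithmic derivative. *)
Lemma is_derive_ln_cabs f t D : f t != 0 -> cderive_at f t D ->
  is_derive t 1 (fun s => ln (cabs (f s))) (complex.Re (D / f t)).
Proof.
move=> f0 [d1 d2].
have E : (fun s => ln (cabs (f s))) =
    (fun s => 2^-1 * ln (complex.Re (f s) ^+ 2 + complex.Im (f s) ^+ 2)).
  apply/funext => s; rewrite -cabs_sqr.
  have [->|] := eqVneq (cabs (f s)) 0; first by rewrite expr0n/= ln0// mulr0.
  by move=> c0; rewrite lnXn ?lt_def ?c0 ?cabs_ge0//; lra.
rewrite E.
have p0 : 0 < complex.Re (f t) ^+ 2 + complex.Im (f t) ^+ 2.
  by rewrite -cabs_sqr exprn_gt0// cabs_gt0.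
have dl := is_derive1_ln p0.
have dq : is_derive t 1 (fun s => complex.Re (f s) ^+ 2 + complex.Im (f s) ^+ 2)
  (2 * (complex.Re (f t) * complex.Re D + complex.Im (f t) * complex.Im D)).
  by apply: is_derive_eq; rewrite /GRing.scale /=; ring.
pose q s := complex.Re (f s) ^+ 2 + complex.Im (f s) ^+ 2.
have dc := @is_derive1_comp R (@ln R) q t _ _ dl dq.
have dz : is_derive t 1 (fun s => 2^-1 *: (@ln R \o q) s) _ := is_deriveZ _ dc.
apply: (is_derive_eq dz).
rewrite ReM ReV ImV cabs_sqr /GRing.scale /=; field.
exact: lt0r_neq0.
Qed.

End ComplexDerivatives.

Section JoukowskiContinuity.
Context {R : realType}.

Lemma ccvg_sqr {T : Type} {F : set_system T} {FF : Filter F} (f : T -> R[i]) l :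
  ccvg F f l -> ccvg F (fun x => f x ^+ 2) (l ^+ 2).
Proof. by move=> h; exact: (ccvgM h h). Qed.

Lemma joukowski_inv_ccvg {T : Type} {F : set_system T} {FF : Filter F} (f : T -> R[i]) l :
  cabs (joukowski_inv l) < 1 -> ccvg F f l ->
  ccvg F (fun x => joukowski_inv (f x)) (joukowski_inv l).
Proof.
move=> l1 hf; apply: ccvg_dist.
have z0 : cabs (l - l) = 0 by apply/eqP; rewrite subrr cabs_eq0.
have zc : cabs (f x - l) @[x --> F] --> (0 : R).
  suff : cabs (f x - l) @[x --> F] --> cabs (l - l) by rewrite z0.
  by apply: ccvg_cabs; apply: ccvgD => //; exact: ccvg_cst.
apply: (@squeeze_cvgr _ _ _ _ (fun=> 0)
  (fun x => 2 * cabs (f x - l) / (1 - cabs (joukowski_inv l)))).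
- by apply: nearW => e; rewrite cabs_ge0 joukowski_inv_lipschitz.
- exact: cvg_cst.
- rewrite -[X in _ --> X](mul0r (1 - cabs (joukowski_inv l))^-1).
  apply: cvgM; last exact: cvg_cst.
  by rewrite -[X in _ --> X](mulr0 2); apply: cvgM => //; exact: cvg_cst.
Qed.

Lemma arcsine_cauchy_ccvg {T : Type} {F : set_system T} {FF : Filter F} (f : T -> R[i]) l :
  cabs (joukowski_inv l) < 1 -> ccvg F f l ->
  ccvg F (fun x => arcsine_cauchy (f x)) (arcsine_cauchy l).
Proof.
move=> l1 /(joukowski_inv_ccvg l1) jc.
apply: ccvgM; first by apply: ccvgM => //; exact: ccvg_cst.
apply: ccvgV; first exact: joukowski_sqr_neq1.
apply: ccvgD; first exact: ccvg_cst.
by apply: ccvgN; exact: ccvg_sqr.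
Qed.

Lemma arcsine_square_cvg {T : Type} {F : set_system T} {FF : Filter F} (f : T -> R[i]) l :
  cabs (joukowski_inv l) < 1 -> ccvg F f l ->
  arcsine_square (f x) @[x --> F] --> arcsine_square l.
Proof.
move=> l1 /(joukowski_inv_ccvg l1) jc; have j2 := ccvg_cabs2 jc.
have d2 : cabs (1 - joukowski_inv (f x) ^+ 2) ^+ 2 @[x --> F] -->
    cabs (1 - joukowski_inv l ^+ 2) ^+ 2.
  apply: ccvg_cabs2; apply: ccvgD; first exact: ccvg_cst.
  by apply: ccvgN; exact: ccvg_sqr.
have c2 : cabs (joukowski_inv l) ^+ 2 < 1 by rewrite expr_lt1// cabs_ge0.
apply: cvgM.
  apply: cvgM; first by apply: cvgM; [exact: cvg_cst|exact: j2].
  by apply: cvgD; [exact: cvg_cst|exact: j2].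
apply: cvgV.
  rewrite mulf_neq0 ?expf_neq0 ?cabs_eq0 ?joukowski_sqr_neq1//.
  by rewrite subr_eq0 gt_eqF.
by apply: cvgM; [exact: d2|apply: cvgB; [exact: cvg_cst|exact: j2]].
Qed.

(** The derivative of [arcsine_cauchy], from that of [joukowski_inv]. *)
Definition arcsine_cauchy_deriv (z : R[i]) : R[i] :=
  - joukowski_inv z * arcsine_cauchy z * (2 * (1 + joukowski_inv z ^+ 2)) /
  (1 - joukowski_inv z ^+ 2) ^+ 2.

Lemma arcsine_cauchy_deriv_ccvg {T : Type} {F : set_system T} {FF : Filter F} (f : T -> R[i]) l :
  cabs (joukowski_inv l) < 1 -> ccvg F f l ->
  ccvg F (fun x => arcsine_cauchy_deriv (f x)) (arcsine_cauchy_deriv l).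
Proof.
move=> l1 hf.
have jc : ccvg F (fun x => joukowski_inv (f x)) (joukowski_inv l) by exact: joukowski_inv_ccvg.
have ac : ccvg F (fun x => arcsine_cauchy (f x)) (arcsine_cauchy l) by exact: arcsine_cauchy_ccvg.
have jc2 : ccvg F (fun x => joukowski_inv (f x) ^+ 2) (joukowski_inv l ^+ 2).
  exact: ccvg_sqr.
have d0 := joukowski_sqr_neq1 l1.
have dc : ccvg F (fun x => 1 - joukowski_inv (f x) ^+ 2) (1 - joukowski_inv l ^+ 2).
  by apply: ccvgD; [exact: ccvg_cst|exact: ccvgN].
apply: ccvgM.
  apply: ccvgM; first by apply: ccvgM => //; exact: ccvgN.
  by apply: ccvgM; [exact: ccvg_cst|apply: ccvgD => //; exact: ccvg_cst].
apply: ccvgV; first by rewrite expf_neq0.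
exact: ccvg_sqr.
Qed.

Lemma cderive_at_arcsine_cauchy (f : R -> R[i]) t D : cderive_at f t D ->
  cabs (joukowski_inv (f t)) < 1 ->
  cderive_at (fun s => arcsine_cauchy (f s)) t (arcsine_cauchy_deriv (f t) * D).
Proof.
move=> df l1; have dj := cderive_at_joukowski_inv df l1; have d0 := joukowski_sqr_neq1 l1.
have d1 : cderive_at (fun s => 2 * joukowski_inv (f s)) t _ := cderive_atM (cderive_at_cst 2 t) dj.
have d2 := cderive_atD (cderive_at_cst 1 t)
  (cderive_atM (cderive_atM (cderive_at_cst (- 1) t) dj) dj).
have e0 : 1 + - 1 * joukowski_inv (f t) * joukowski_inv (f t) != 0.
  by rewrite mulN1r mulNr -expr2.
have d3 := cderive_atM d1 (cderive_atV e0 d2).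
have E : (fun s => arcsine_cauchy (f s)) = (fun s => 2 * joukowski_inv (f s) *
    (1 + - 1 * joukowski_inv (f s) * joukowski_inv (f s))^-1).
  by apply/funext => s; rewrite /arcsine_cauchy mulN1r mulNr -expr2.
rewrite E.
have -> : arcsine_cauchy_deriv (f t) * D = 2 * joukowski_inv (f t) *
    (- ((0 + ((-1) * joukowski_inv (f t) * (- (joukowski_inv (f t) * arcsine_cauchy (f t) * D)) +
      ((-1) * (- (joukowski_inv (f t) * arcsine_cauchy (f t) * D)) + 0 * joukowski_inv (f t)) * joukowski_inv (f t))) /
      (1 + - 1 * joukowski_inv (f t) * joukowski_inv (f t)) ^+ 2)) +
    (2 * (- (joukowski_inv (f t) * arcsine_cauchy (f t) * D)) + 0 * joukowski_inv (f t)) *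
    (1 + - 1 * joukowski_inv (f t) * joukowski_inv (f t))^-1.
  rewrite /arcsine_cauchy_deriv; move: (arcsine_cauchy (f t)) => a.
  by move: (joukowski_inv (f t)) d0 e0 => j d0 e0; field; exact: e0.
exact: d3.
Qed.

End JoukowskiContinuity.

(** * Operator norm and traces in a von Neumann algebra *)

Section HilbertNorm.
Context {R : realType} {H : hilbertSpace R}.
Implicit Types (x y : H) (c : R[i]).

(** The norm as an element of [R]. *)
Definition hnorm x : R := complex.Re `|x|.

Lemma hnormE x : `|x| = (hnorm x)%:C.
Proof. by rewrite /hnorm RRe_real// normr_real. Qed.

Lemma hnorm_ge0 x : 0 <= hnorm x.
Proof. by rewrite -ler0c -hnormE normr_ge0. Qed.

Lemma hnorm_triangle x y : hnorm (x + y) <= hnorm x + hnorm y.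
Proof. by rewrite -lecR rmorphD /= -!hnormE ler_normD. Qed.

Lemma hnormN x : hnorm (- x) = hnorm x.
Proof. by rewrite /hnorm normrN. Qed.

Lemma hnorm_distC x y : hnorm (x - y) = hnorm (y - x).
Proof. by rewrite /hnorm distrC. Qed.

Lemma hnormZ c x : hnorm (c *: x) = cabs c * hnorm x.
Proof. by apply: complexI; rewrite rmorphM /= -!hnormE normrZ cabsE. Qed.

Lemma hnorm0 : hnorm (0 : H) = 0.
Proof. by rewrite /hnorm normr0. Qed.

Lemma hnorm_eq0 x : hnorm x = 0 -> x = 0.
Proof. by move=> h; apply/eqP; rewrite -normr_eq0 hnormE h. Qed.

Lemma hnorm_small x : (forall e, 0 < e -> hnorm x <= e) -> x = 0.
Proof.
move=> h; apply: hnorm_eq0; apply/eqP; rewrite eq_le hnorm_ge0 andbT leNgt.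
apply/negP => x0; have := h _ (divr_gt0 x0 (ltr0Sn R 1)); lra.
Qed.

Definition ip x y : R[i] := hdot H x y.

Lemma ipDl x y z : ip (x + y) z = ip x z + ip y z.
Proof. by rewrite /ip linearDl. Qed.

Lemma ipDr x y z : ip x (y + z) = ip x y + ip x z.
Proof. by rewrite /ip linearDr. Qed.

Lemma ipNl x y : ip (- x) y = - ip x y.
Proof. by rewrite /ip linearNl. Qed.

Lemma ipNr x y : ip x (- y) = - ip x y.
Proof. by rewrite /ip linearNr. Qed.

Lemma ipZl c x y : ip (c *: x) y = c * ip x y.
Proof. by rewrite /ip linearZl. Qed.

Lemma ipZr c x y : ip x (c *: y) = conjc c * ip x y.
Proof. by rewrite /ip linearZr. Qed.

Definition ipE := (ipDl, ipDr, ipNl, ipNr, ipZl, ipZr).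

Lemma ipee x : ip x x = (hnorm x ^+ 2)%:C.
Proof. by rewrite /ip -hdotE hnormE rmorphXn. Qed.

Lemma hnorm_sqr x : hnorm x ^+ 2 = complex.Re (ip x x).
Proof. by rewrite ipee. Qed.

Lemma ipC x y : ip x y = conjc (ip y x).
Proof. by rewrite /ip hermC /= expr0 mul1r. Qed.

Lemma ip_eq x y : (forall z, ip z x = ip z y) -> x = y.
Proof.
move=> h; apply/eqP; rewrite -subr_eq0; apply/eqP; apply: hnorm_eq0.
have : ip (x - y) (x - y) = 0 by rewrite ipDr ipNr h subrr.
rewrite ipee => /complexI/eqP; rewrite sqrf_eq0 => /eqP//.
Qed.

Lemma parallelogram x y :
  hnorm (x + y) ^+ 2 + hnorm (x - y) ^+ 2 = 2 * (hnorm x ^+ 2 + hnorm y ^+ 2).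
Proof.
rewrite !hnorm_sqr !ipE !(ReD, ReN, ipE); ring.
Qed.

End HilbertNorm.

Section OperatorNorm.
Context {R : realType} {M : vonNeumannAlgebra R}.
Local Notation H := (vn_space M).
Local Notation rep := (@vn_rep R M).
Implicit Types (a b : M) (x y : H) (c d : R[i]).

Lemma repD a b x : rep (a + b) x = rep a x + rep b x.
Proof. by have := vn_repP 1 a b x; rewrite !scale1r. Qed.

Lemma repZ c a x : rep (c *: a) x = c *: rep a x.
Proof.
have r0 : rep 0 x = 0.
  by have := repD 0 0 x; rewrite addr0 => /esym/(canRL (addrK _)); rewrite subrr.
by have := vn_repP c a 0 x; rewrite addr0 r0 addr0.
Qed.

Lemma rep0 x : rep 0 x = 0.
Proof. by rewrite -[0](scale0r 1) repZ scale0r. Qed.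

Lemma repN a x : rep (- a) x = - rep a x.
Proof. by rewrite -scaleN1r repZ scaleN1r. Qed.

Lemma repB a b x : rep (a - b) x = rep a x - rep b x.
Proof. by rewrite repD repN. Qed.

Lemma rep_eq a b : (forall x, rep a x = rep b x) -> a = b.
Proof. by move=> h; apply: vn_rep_inj. Qed.

Lemma ip_rep a x y : ip (rep a x) y = ip x (rep (star a) y).
Proof. exact: vn_rep_star. Qed.

Lemma ip_star a x y : ip x (rep a y) = ip (rep (star a) x) y.
Proof. by rewrite ipC ip_rep -ipC. Qed.

Lemma starK a : star (star a) = a.
Proof.
apply: rep_eq => x; apply: ip_eq => y.
by rewrite -[LHS]ip_rep -ip_star.
Qed.

Lemma starD a b : star (a + b) = star a + star b.
Proof.
apply: rep_eq => x; apply: ip_eq => y.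
by rewrite -ip_rep !repD ipDl ipDr -!ip_rep.
Qed.

Lemma starZ c a : star (c *: a) = conjc c *: star a.
Proof.
apply: rep_eq => x; apply: ip_eq => y.
by rewrite -ip_rep !repZ ipZl ipZr conjcK -ip_rep.
Qed.

Lemma star_scalar c : star (c%:A : M) = (conjc c)%:A.
Proof.
rewrite starZ; congr (_ *: _).
by apply: rep_eq => x; apply: ip_eq => y; rewrite -ip_rep !vn_rep1.
Qed.

Lemma star1 : star (1 : M) = 1.
Proof. by have := star_scalar 1; rewrite conjc1 !scale1r. Qed.

Lemma starM a b : star (a * b) = star b * star a.
Proof.
apply: rep_eq => x; apply: ip_eq => y.
by rewrite -ip_rep !vn_repM !ip_rep.
Qed.

Lemma starN a : star (- a) = - star a.
Proof. by rewrite -scaleN1r starZ rmorphN1 scaleN1r. Qed.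

Lemma starB a b : star (a - b) = star a - star b.
Proof. by rewrite starD starN. Qed.

Lemma star0 : star (0 : M) = 0.
Proof. by rewrite -[0](scale0r 1) starZ rmorph0 !scale0r. Qed.

(** [k] bounds the operator norm of [a]; no norm is chosen on the algebra itself. *)
Definition opbound a (k : R) := forall x, hnorm (rep a x) <= k * hnorm x.

Lemma opbound_le a k l : k <= l -> opbound a k -> opbound a l.
Proof. by move=> kl h x; apply: (le_trans (h x)); rewrite ler_wpM2r ?hnorm_ge0. Qed.

Lemma opboundD a b k l : opbound a k -> opbound b l -> opbound (a + b) (k + l).
Proof.
move=> h1 h2 x; rewrite repD mulrDl; apply: (le_trans (hnorm_triangle _ _)).
exact: lerD.
Qed.

Lemma opboundN a k : opbound a k -> opbound (- a) k.
Proof. by move=> h x; rewrite repN hnormN. Qed.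

Lemma opboundM a b k l : 0 <= k -> opbound a k -> opbound b l -> opbound (a * b) (k * l).
Proof.
move=> k0 h1 h2 x; rewrite vn_repM; apply: (le_trans (h1 _)).
by rewrite -mulrA ler_wpM2l.
Qed.

Lemma opboundZ c a k : opbound a k -> opbound (c *: a) (cabs c * k).
Proof. by move=> h x; rewrite repZ hnormZ -mulrA ler_wpM2l ?cabs_ge0. Qed.

Lemma opbound1 : opbound 1 1.
Proof. by move=> x; rewrite vn_rep1 mul1r. Qed.

Lemma opbound_small a : (forall e, 0 < e -> opbound a e) -> a = 0.
Proof.
move=> h; apply: rep_eq => x; rewrite rep0; apply: hnorm_small => e e0.
have d0 : 0 < e / (1 + hnorm x) by rewrite divr_gt0// ltr_pwDl// hnorm_ge0.
apply: (le_trans (h _ d0 x)); rewrite mulrAC ler_pdivrMr ?ltr_pwDl ?hnorm_ge0//.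
by rewrite ler_pM2l// lerDr.
Qed.

Lemma opbound_ex a : exists2 k, 0 < k & opbound a k.
Proof.
have := (linear_bounded_continuous (rep a)).2 (vn_rep_bounded (a := a)).
move=> /linear_boundedP [r [rr h]].
have rE : r = (complex.Re r)%:C by rewrite RRe_real.
exists (`|complex.Re r| + 1); first by rewrite ltr_wpDl.
move=> x; rewrite -lecR rmorphM /= -!hnormE; apply: h.
rewrite rE ltcR; apply: (le_lt_trans (ler_norm _)); by rewrite ltrDl.
Qed.

(** The vector [a y], with [y = a^* x], satisfies [<a y, x> = |y|^2], and the
Cauchy-Schwarz inequality bounds the left-hand side by [k |y| |x|]. *)
Lemma opbound_star a k : 0 <= k -> opbound a k -> opbound (star a) k.
Proof.
move=> k0 h x; set y := rep (star a) x.
have h1 : (hnorm y ^+ 2)%:C = ip (rep a y) x by rewrite ip_rep -ipee.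
(* Cauchy-Schwarz at this vector, from positivity of the squared norm of [a y - t x] *)
have [->|y0] := eqVneq (hnorm y) 0; first by rewrite mulr_ge0 ?hnorm_ge0.
have yp : 0 < hnorm y by rewrite lt_def y0 hnorm_ge0.
have [x0|x0] := eqVneq (hnorm x) 0.
  have : x = 0 by exact: hnorm_eq0.
  by move=> e; move: y0; rewrite /y e linear0 hnorm0 eqxx.
have xp : 0 < hnorm x by rewrite lt_def x0 hnorm_ge0.
set t := hnorm y ^+ 2 / hnorm x ^+ 2.
have : 0 <= hnorm (rep a y - t%:C *: x) ^+ 2 by rewrite sqr_ge0.
have -> : hnorm (rep a y - t%:C *: x) ^+ 2 = hnorm (rep a y) ^+ 2 - hnorm y ^+ 4 / hnorm x ^+ 2.
  rewrite hnorm_sqr !ipE ipee -h1 (ipC x) -h1 ipee !conjc_real.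
  rewrite !(ReD, ReN, ReM, ImM, ImD, ImN) /= /t; field.
  exact: x0.
have := h y; set p := hnorm (rep a y) => hp.
rewrite subr_ge0 ler_pdivrMr ?exprn_gt0// => hq.
have pq : p ^+ 2 <= (k * hnorm y) ^+ 2 by rewrite ler_sqr ?nnegrE ?mulr_ge0 ?hnorm_ge0.
have : hnorm y ^+ 4 <= (k * hnorm y) ^+ 2 * hnorm x ^+ 2.
  by apply: (le_trans hq); rewrite ler_wpM2r ?sqr_ge0.
have -> : (k * hnorm y) ^+ 2 * hnorm x ^+ 2 = (k * hnorm x) ^+ 2 * hnorm y ^+ 2 by ring.
have -> : hnorm y ^+ 4 = hnorm y ^+ 2 * hnorm y ^+ 2 by ring.
rewrite ler_pM2r ?exprn_gt0//.
by rewrite ler_sqr ?nnegrE ?mulr_ge0 ?hnorm_ge0.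
Qed.

(** The quadratic form is polarized at [x] and the suitably rescaled vector [a x]. *)
Lemma opbound_form a k : hermitian_elt a -> 0 <= k ->
  (forall x, `|complex.Re (ip (rep a x) x)| <= k * hnorm x ^+ 2) -> opbound a k.
Proof.
move=> ha k0 h x; set z := rep a x.
have pol y : complex.Re (ip z y) <= k / 2 * (hnorm x ^+ 2 + hnorm y ^+ 2).
  have e : 4 * complex.Re (ip z y) =
     complex.Re (ip (rep a (x + y)) (x + y)) - complex.Re (ip (rep a (x - y)) (x - y)).
    have sy : complex.Re (ip (rep a y) x) = complex.Re (ip z y).
      by rewrite ipC ip_star ha; case: (ip _ _).
    rewrite !linearD !linearN !ipE /= -/z.
    rewrite !(ReD, ReN) sy; ring.
  have := h (x + y); have := h (x - y); rewrite !ler_norml => /andP[h1 _] /andP[_ h2].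
  have := parallelogram x y; nra.
have [z0|z0] := eqVneq (hnorm z) 0; first by rewrite z0 mulr_ge0 ?hnorm_ge0.
have zp : 0 < hnorm z by rewrite lt_def z0 hnorm_ge0.
have := pol ((hnorm x / hnorm z)%:C *: z).
rewrite ipZr conjc_real ipee -rmorphM /=.
rewrite hnormZ cabs_real ger0_norm ?divr_ge0 ?hnorm_ge0//.
have -> : hnorm x / hnorm z * hnorm z ^+ 2 = hnorm x * hnorm z by field.
have -> : hnorm x / hnorm z * hnorm z = hnorm x by field.
have -> : k / 2 * (hnorm x ^+ 2 + hnorm x ^+ 2) = hnorm x * (k * hnorm x) by field.
have [x0|x0] := eqVneq (hnorm x) 0.
  have e : x = 0 by exact: hnorm_eq0.
  by move: z0; rewrite /z e linear0 hnorm0 eqxx.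
by rewrite ler_pM2l// lt_def x0 hnorm_ge0.
Qed.

End OperatorNorm.

Section OperatorLimits.
Context {R : realType} {M : vonNeumannAlgebra R}.
Local Notation H := (vn_space M).
Local Notation rep := (@vn_rep R M).
Implicit Types (a b : M) (x y : H) (c d : R[i]).

(** The pointwise limit of a Cauchy sequence commutes with the commutant, hence
belongs to the algebra by the bicommutant property. *)
Lemma vn_complete (u : nat -> M) (e : nat -> R) :
  (forall n m, (n <= m)%N -> opbound (u m - u n) (e n)) ->
  e n @[n --> \oo] --> (0 : R) ->
  exists a, forall n, opbound (a - u n) (e n).
Proof.
move=> ue e0.
have small x (r : R) : 0 < r -> \forall n \near \oo, e n * hnorm x < r.
  move=> r0; have : e n * hnorm x @[n --> \oo] --> (0 : R).
    by rewrite -[X in _ --> X](mul0r (hnorm x)); apply: cvgMl.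
  by move=> /cvgr_lt; apply.
have lim x : exists l : H, forall r : R, 0 < r ->
    \forall n \near \oo, hnorm (l - rep (u n) x) < r.
  have : cvg (rep (u n) x @[n --> \oo]).
    apply: cauchy_cvg; apply: cauchy_exP => r r0.
    have rE : r = (complex.Re r)%:C by rewrite RRe_real// gtr0_real.
    have r0' : 0 < complex.Re r by rewrite -ltcR -rE.
    have [N _ hN] := small x _ r0'.
    exists (rep (u N) x); exists N => // n /= Nn.
    rewrite -ball_normE /= hnormE rE ltcR hnorm_distC -repB.
    exact: le_lt_trans (ue _ _ Nn x) (hN N (leqnn N)).
  move=> /cvg_ex[l hl]; exists l => r r0.
  have rC : 0 < r%:C by rewrite ltcR.
  by move/cvgrPdist_lt: hl => /(_ _ rC); apply: filterS => n; rewrite hnormE ltcR.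
have /choice [T hT] := lim.
have near_pick (P : nat -> Prop) : (\forall n \near \oo, P n) -> exists n, P n.
  by move=> [N _ hN]; exists N; apply: hN => /=.
have T_lin : linear T.
  move=> c x y; apply/eqP; rewrite -subr_eq0; apply/eqP; apply: hnorm_small => r r0.
  have k0 : 0 < cabs c + 2 by rewrite ltr_wpDl ?cabs_ge0.
  have s0 : 0 < r / (cabs c + 2) by rewrite divr_gt0.
  have [n [[h1 h2] h3]] : exists n, (hnorm (T x - rep (u n) x) < r / (cabs c + 2) /\
     hnorm (T y - rep (u n) y) < r / (cabs c + 2)) /\
     hnorm (T (c *: x + y) - rep (u n) (c *: x + y)) < r / (cabs c + 2).
    by apply: near_pick; near=> n; repeat split; near: n; exact: hT.
  have -> : T (c *: x + y) - (c *: T x + T y) =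
      (T (c *: x + y) - rep (u n) (c *: x + y)) +
      (- (c *: (T x - rep (u n) x)) + - (T y - rep (u n) y)).
    rewrite [rep _ (_ + _)]linearD [rep _ (c *: x)]linearZ_LR scalerBr.
    by rewrite (opprB (c *: T x)) (opprB (T y)) [X in _ = _ + X]addrACA -[X in _ = _ + (_ + X)]opprD addrA subrK.
  apply: (le_trans (hnorm_triangle _ _)).
  apply: (le_trans (lerD (lexx _) (hnorm_triangle _ _))).
  rewrite !hnormN hnormZ.
  have : r / (cabs c + 2) * (cabs c + 2) = r by field; exact: lt0r_neq0.
  have := ler_wpM2l (cabs_ge0 c) (ltW h1); lra.
pose TL : {linear H -> H} := HB.pack T (GRing.isLinear.Build R[i] H H *:%R T T_lin).
have T_bound n x : hnorm (T x - rep (u n) x) <= e n * hnorm x.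
  apply/ler_addgt0Pr => r r0.
  have [m [nm hm]] : exists m, (n <= m)%N /\ hnorm (T x - rep (u m) x) < r.
    by apply: near_pick; near=> m; split; near: m; [exact: nbhs_infty_ge|exact: hT].
  have -> : T x - rep (u n) x = (rep (u m - u n) x) + (T x - rep (u m) x).
    by rewrite repB [RHS]addrC addrA subrK.
  apply: (le_trans (hnorm_triangle _ _)); apply: lerD; last exact: ltW.
  exact: ue.
have T_cont : continuous TL.
  apply/linear_bounded_continuous/linear_boundedP.
  have [k k0 hk] := opbound_ex (u 0%N).
  exists (k + e 0%N)%:C; split; first by rewrite complex_real.
  move=> r hr x; rewrite hnormE; apply: (@le_trans _ _ ((k + e 0%N) * hnorm x)%:C).
    rewrite lecR mulrDl; have := T_bound 0%N x; have := hk x.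
    have := hnorm_triangle (T x - rep (u 0%N) x) (rep (u 0%N) x); rewrite subrK /=; lra.
  by rewrite rmorphM /= -hnormE ler_wpM2r// ltW.
have T_comm (S : {linear H -> H}) : continuous S ->
    (forall a x, S (rep a x) = rep a (S x)) -> forall x, TL (S x) = S (TL x).
  move=> cS hS x; apply/eqP; rewrite -subr_eq0; apply/eqP; apply: hnorm_small => r r0.
  have [k k0 hk] : exists2 k, 0 < k & forall y, hnorm (S y) <= k * hnorm y.
    have /linear_boundedP [s [rs h]] := (linear_bounded_continuous S).2 cS.
    have sE : s = (complex.Re s)%:C by rewrite RRe_real.
    exists (`|complex.Re s| + 1); first by rewrite ltr_wpDl.
    move=> y; rewrite -lecR rmorphM /= -!hnormE; apply: h.
    by rewrite sE ltcR (le_lt_trans (ler_norm _))// ltrDl.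
  have s0 : 0 < r / (1 + k) by rewrite divr_gt0// addr_gt0.
  have [n [h1 h2]] : exists n, hnorm (T x - rep (u n) x) < r / (1 + k) /\
     hnorm (T (S x) - rep (u n) (S x)) < r / (1 + k).
    by apply: near_pick; near=> n; split; near: n; exact: hT.
  have -> : TL (S x) - S (TL x) = (T (S x) - rep (u n) (S x)) - S (T x - rep (u n) x).
    by rewrite linearB hS opprB addrA subrK.
  apply: (le_trans (hnorm_triangle _ _)); rewrite hnormN.
  have := hk (T x - rep (u n) x).
  have := ler_wpM2l (ltW k0) (ltW h1).
  have : r / (1 + k) * (1 + k) = r by field; rewrite lt0r_neq0// addr_gt0.
  lra.
have [a ha] := vn_bicommutant T_cont T_comm.
by exists a => n x; rewrite repB ha; exact: T_bound.
Unshelve. all: by end_near.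
Qed.

End OperatorLimits.

Section Contractions.
Context {R : realType} {M : vonNeumannAlgebra R}.
Implicit Types (a b : M) (c d : R[i]).

(** Banach's fixed point theorem on an operator-norm ball of the algebra. *)
Lemma opbound_fixpoint (F : M -> M) (k l : R) : 0 <= k < 1 -> 0 <= l ->
  (forall a, opbound a l -> opbound (F a) l) ->
  (forall a b m, opbound a l -> opbound b l -> 0 <= m -> opbound (a - b) m ->
     opbound (F a - F b) (k * m)) ->
  exists a, [/\ opbound a l, F a = a &
    forall m, 0 < m -> exists n, opbound (a - iter n F 0) m].
Proof.
move=> /andP[k0 k1] l0 Fl FL; pose u n := iter n F 0.
have ul n : opbound (u n) l.
  by elim: n => [|n ih]; [move=> x; rewrite rep0 hnorm0 mulr_ge0 ?hnorm_ge0|exact: Fl].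
have ud n m : (n <= m)%N -> opbound (u m - u n) (k ^+ n * l).
  elim: n m => [|n ih] [|m]//.
  - by move=> _; rewrite subrr expr0 mul1r => x; rewrite rep0 hnorm0 mulr_ge0 ?hnorm_ge0.
  - by move=> _; rewrite subr0 expr0 mul1r; exact: ul.
  move=> nm; rewrite exprS -mulrA; apply: FL; rewrite ?mulr_ge0 ?exprn_ge0//.
  exact: ih.
have ke : k ^+ n * l @[n --> \oo] --> (0 : R).
  rewrite -[X in _ --> X](mul0r l); apply: cvgMl; apply: cvg_expr.
  by rewrite ger0_norm.
have [a ha] := vn_complete ud ke.
have small m : 0 < m -> exists n, k ^+ n * l < m.
  by move=> m0; have /cvgr_lt/(_ _ m0)[N _ hN] := ke; exists N; exact: hN (leqnn N).
have al : opbound a l.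
  move=> x; apply/ler_addgt0Pr => r r0.
  have d0 : 0 < r / (1 + hnorm x) by rewrite divr_gt0// ltr_pwDl// hnorm_ge0.
  have [n hn] := small _ d0.
  have -> : vn_rep a x = vn_rep (u n) x + vn_rep (a - u n) x.
    by rewrite repB addrC subrK.
  apply: (le_trans (hnorm_triangle _ _)); apply: lerD; first exact: ul.
  apply: (le_trans (ha n x)); apply: (@le_trans _ _ (r / (1 + hnorm x) * hnorm x)).
    by rewrite ler_wpM2r ?hnorm_ge0// ltW.
  rewrite mulrAC ler_pdivrMr ?ltr_pwDl ?hnorm_ge0//.
  by rewrite ler_pM2l// lerDr.
exists a; split => //.
- apply/eqP; rewrite -subr_eq0; apply/eqP; apply: opbound_small => r r0.
  have r2 : 0 < r / 2 by rewrite divr_gt0.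
  have [n hn] := small _ r2.
  have -> : F a - a = (F a - F (u n)) + (F (u n) - a) by rewrite addrA subrK.
  rewrite (splitr r); apply: opboundD.
    apply: opbound_le (FL _ _ (k ^+ n * l) al (ul n) _ (ha n)).
      rewrite (le_trans _ (ltW hn))// ler_piMl ?(ltW k1)// mulr_ge0 ?exprn_ge0//.
    by rewrite mulr_ge0 ?exprn_ge0.
  rewrite -opprB; apply: opboundN; apply: opbound_le (ha n.+1).
  rewrite (le_trans _ (ltW hn))// exprS -mulrA ler_piMl ?(ltW k1)// mulr_ge0 ?exprn_ge0//.
- move=> m m0; have [n hn] := small _ m0; exists n; apply: opbound_le (ha n); exact: ltW.
Qed.

(** The square root of [1 - a] is [1 - y], where [y] is the fixed point of the
contraction [y |-> (a + y ^+ 2) / 2] on the ball of radius [1 - sqrt (1 - r)]. *)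
Lemma vn_pos_1B a (r : R) : hermitian_elt a -> 0 <= r < 1 -> opbound a r -> vn_pos (1 - a).
Proof.
move=> ha /andP[r0 r1] ar; pose k := 1 - Num.sqrt (1 - r).
have s0 : 0 < Num.sqrt (1 - r) by rewrite sqrtr_gt0 subr_gt0.
have s2 : Num.sqrt (1 - r) ^+ 2 = 1 - r by rewrite sqr_sqrtr// subr_ge0 ltW.
have k1 : k < 1 by rewrite /k; lra.
have k0 : 0 <= k.
  rewrite /k subr_ge0 -[leRHS]sqrtr1 ler_wsqrtr//; lra.
have kE : (r + k * k) / 2 = k by rewrite /k; move: s2; nra.
pose F y : M := (2^-1 : R)%:C *: (a + y * y).
have half : cabs (2^-1 : R)%:C = 2^-1 by rewrite cabs_real ger0_norm.
have [|||y [yk Fy yap]] := @opbound_fixpoint F k k _ k0.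
- by rewrite k0.
- move=> b bk; rewrite -[X in opbound _ X]kE mulrC -half; apply: opboundZ.
  by apply: opboundD => //; apply: opboundM.
- move=> b d m bk dk m0 bd.
  have -> : F b - F d = (2^-1 : R)%:C *: (b * (b - d) + (b - d) * d).
    by rewrite /F -scalerBr mulrBr mulrBl addrA subrK opprD addrACA subrr add0r.
  have -> : k * m = 2^-1 * (k * m + m * k) by field.
  rewrite -[X in opbound _ (X * _)]half; apply: opboundZ; apply: opboundD; exact: opboundM.
have hy : star y = y.
  apply/eqP; rewrite -subr_eq0; apply/eqP; apply: opbound_small => m m0.
  have m2 : 0 < m / 2 by rewrite divr_gt0.
  have [n hn] := yap _ m2.
  have hs : star (iter n F 0) = iter n F 0.
    elim: n {hn} => [|n ih]; first exact: star0.
    by rewrite iterS /F starZ starD starM ih ha conjc_real.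
  have -> : star y - y = star (y - iter n F 0) - (y - iter n F 0).
    by rewrite starB hs opprB addrA subrK.
  rewrite (splitr m); apply: opboundD; last exact: opboundN.
  by apply: opbound_star => //; exact: ltW.
have e2 : a + y * y = y + y.
  have := congr1 (fun t => (2 : R)%:C *: t) Fy.
  rewrite /F scalerA -rmorphM /= mulfV ?pnatr_eq0// scale1r => ->.
  by rewrite rmorph_nat scaler_nat mulr2n.
exists (1 - y); rewrite starB star1 hy mulrBr mulr1 mulrBl mul1r.
have -> : a = y + y - y * y by rewrite -e2 addrK.
by rewrite -[RHS]addrA -[X in _ = _ + X]opprD addrA.
Qed.

(** The resolvent [(1 - c u)^-1] of a unitary [u], as a Neumann series. *)
Lemma neumann (u : M) c : opbound u 1 -> cabs c < 1 ->
  exists V, [/\ V = 1 + c *: (u * V), V = 1 + c *: (V * u) &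
    forall b, b * u = u * b -> b * V = V * b].
Proof.
move=> u1 c1; pose F V : M := 1 + c *: (u * V).
have c1' : 0 < 1 - cabs c by rewrite subr_gt0.
have [||||V [Vl FV Vap]] := @opbound_fixpoint F (cabs c) (1 - cabs c)^-1.
- by rewrite cabs_ge0.
- by rewrite invr_ge0 ltW.
- move=> a al; have -> : (1 - cabs c)^-1 = 1 + cabs c * (1 * (1 - cabs c)^-1).
    by field; exact: lt0r_neq0.
  apply: opboundD; first exact: opbound1.
  by apply: opboundZ; apply: opboundM.
- move=> a b m _ _ m0 abm.
  rewrite /F opprD addrACA subrr add0r -scalerBr -mulrBr -[X in opbound _ (_ * X)]mul1r.
  by apply: opboundZ; apply: opboundM.
have comm b : b * u = u * b -> b * V = V * b.
  move=> bu; apply/eqP; rewrite -subr_eq0; apply/eqP; apply: opbound_small => m m0.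
  have [k k0 bk] := opbound_ex b.
  have m2 : 0 < m / 2 / k by rewrite !divr_gt0.
  have [n hn] := Vap _ m2.
  have cn : b * iter n F 0 = iter n F 0 * b.
    elim: n {hn} => [|n ih]; first by rewrite mulr0 mul0r.
    rewrite iterS /F mulrDr mulrDl mulr1 mul1r -scalerAr -scalerAl; congr (_ + _ *: _).
    by rewrite -mulrA -ih !mulrA bu.
  have -> : b * V - V * b = b * (V - iter n F 0) - (V - iter n F 0) * b.
    by rewrite mulrBr mulrBl cn opprB addrA subrK.
  have -> : m = k * (m / 2 / k) + (m / 2 / k) * k by field; exact: lt0r_neq0.
  apply: opboundD; first by apply: opboundM => //; exact: ltW.
  by apply: opboundN; apply: opboundM => //; exact: ltW.
exists V; split => //.
by rewrite -{1}FV /F comm.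
Qed.

End Contractions.

Section States.
Context {R : realType} {M : vonNeumannAlgebra R} {tau : M -> R[i]}.
Hypothesis htau : faithful_normal_tracial_state tau.
Implicit Types (a b : M) (c : R[i]).

Lemma tauD a b : tau (a + b) = tau a + tau b.
Proof. by case: htau => h _ _ _ _; have := h 1 a b; rewrite scale1r mul1r. Qed.

Lemma tau0 : tau 0 = 0.
Proof. by apply/eqP; rewrite -(inj_eq (addrI (tau 0))) -tauD !addr0. Qed.

Lemma tauZ c a : tau (c *: a) = c * tau a.
Proof. by case: htau => h _ _ _ _; have := h c a 0; rewrite !addr0 tau0 addr0. Qed.

Lemma tauN a : tau (- a) = - tau a.
Proof. by rewrite -scaleN1r tauZ mulN1r. Qed.

Lemma tauB a b : tau (a - b) = tau a - tau b.
Proof. by rewrite tauD tauN. Qed.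

Lemma tau1 : tau 1 = 1.
Proof. by case: htau => _ [h _] _ _ _. Qed.

Lemma tau_mulC a b : tau (a * b) = tau (b * a).
Proof. by case: htau. Qed.

Lemma tau_sum (I : Type) (r : seq I) (P : pred I) (F : I -> M) :
  tau (\sum_(i <- r | P i) F i) = \sum_(i <- r | P i) tau (F i).
Proof. by apply: (big_morph tau tauD tau0). Qed.

Lemma tau_pos a : vn_pos a -> 0 <= tau a.
Proof. by move=> [y ->]; case: htau => _ [_ h] _ _ _; exact: h. Qed.

(** Positivity makes a state contractive: [k - a] has a square root as soon as
[a] is Hermitian of norm less than [k]. *)
Lemma tau_hermitian_le a (k : R) : hermitian_elt a -> 0 <= k -> opbound a k ->
  tau a <= k%:C.
Proof.
move=> ha k0 ak.
have key (e : R) : 0 < e -> tau a <= (k + e)%:C.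
  move=> e0; have s0 : 0 < k + e by rewrite ltr_wpDl.
  have : vn_pos (1 - ((k + e)^-1)%:C *: a).
    apply: (@vn_pos_1B _ _ _ (k / (k + e))).
    - by rewrite /hermitian_elt starZ conjc_real ha.
    - by rewrite divr_ge0 ?(ltW s0)//= ltr_pdivrMr// mul1r ltrDl.
    - have ce : cabs ((k + e)^-1)%:C = (k + e)^-1.
        by rewrite cabs_real ger0_norm// invr_ge0 ltW.
      by rewrite mulrC -[X in opbound _ (X * _)]ce; exact: opboundZ.
  move=> /tau_pos; rewrite tauB tau1 tauZ subr_ge0 rmorphV ?unitfE ?lt0r_neq0//=.
  by rewrite mulrC ler_pdivrMr ?ltcR// mul1r.
have := key 1 ltr01; rewrite !lecE => /andP[/eqP im _]; rewrite im eqxx /=.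
by apply/ler_addgt0Pr => e /key; rewrite lecE => /andP[].
Qed.

Lemma tau_hermitian_Im a : hermitian_elt a -> complex.Im (tau a) = 0.
Proof.
move=> ha; have [k k0 ak] := opbound_ex a.
by have := tau_hermitian_le ha (ltW k0) ak; rewrite lecE => /andP[/eqP <-].
Qed.

Lemma tau_hermitian_norm a (k : R) : hermitian_elt a -> 0 <= k -> opbound a k ->
  `|complex.Re (tau a)| <= k.
Proof.
move=> ha k0 ak; have haN : hermitian_elt (- a) by rewrite /hermitian_elt starN ha.
have := tau_hermitian_le ha k0 ak; have := tau_hermitian_le haN k0 (opboundN ak).
rewrite tauN !lecE => /andP[_ h1] /andP[_ h2].
by rewrite ler_norml; move: h1 h2; rewrite ReN /=; lra.
Qed.

Definition re_part a : M := (2^-1 : R)%:C *: (a + star a).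
Definition im_part a : M := (0 -i* (2^-1 : R)) *: (a - star a).

Lemma re_part_hermitian a : hermitian_elt (re_part a).
Proof. by rewrite /hermitian_elt /re_part starZ conjc_real starD starK addrC. Qed.

Lemma im_part_hermitian a : hermitian_elt (im_part a).
Proof.
rewrite /hermitian_elt /im_part starZ starB starK -[star a - a]opprB scalerN -scaleNr.
by congr (_ *: _); apply: complex_ext; rewrite /= ?oppr0 ?opprK.
Qed.

Lemma re_im_part a : a = re_part a + 'i%C *: im_part a.
Proof.
rewrite /re_part /im_part scalerA.
have -> : 'i%C * (0 -i* (2^-1 : R)) = (2^-1 : R)%:C.
  by apply: complex_ext; rewrite ?ReM ?ImM /=; ring.
rewrite -scalerDr addrACA addrN addr0 scalerDr -scalerDl.
have -> : (2^-1 : R)%:C + (2^-1 : R)%:C = 1 :> R[i].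
  by apply: complex_ext; rewrite ?ReD ?ImD /=; field.
by rewrite scale1r.
Qed.

(** A state is real on Hermitian elements, to which the general case reduces through
real and imaginary parts. *)
Lemma tau_star a : tau (star a) = conjc (tau a).
Proof.
have := re_im_part a; move: (re_part_hermitian a) (im_part_hermitian a).
move: (re_part a) (im_part a) => h k hh hk ->.
rewrite starD starZ hh hk !(tauD, tauZ).
have := tau_hermitian_Im hh; have := tau_hermitian_Im hk.
case: (tau h) (tau k) => p q [r s] /= -> ->.
by apply: complex_ext; rewrite !(ReD, ImD, ReM, ImM) /=; ring.
Qed.

(** Applied to the two Hermitian parts of [a], contractivity costs a factor 2, which
is harmless in limits. *)
Lemma cabs_tau_le a (k : R) : 0 <= k -> opbound a k -> cabs (tau a) <= 2 * k.
Proof.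
move=> k0 ak; apply: (le_trans (ler_cabs_ReIm _)).
have half : cabs (2^-1 : R)%:C = 2^-1 by rewrite cabs_real ger0_norm.
have halfi : cabs (0 -i* (2^-1 : R)) = 2^-1.
  by rewrite /cabs /= expr0n /= add0r sqrrN sqrtr_sqr ger0_norm.
have ask := opbound_star k0 ak.
have b1 : opbound (re_part a) k.
  have -> : k = 2^-1 * (k + k) by field.
  by rewrite -[X in opbound _ (X * _)]half; apply: opboundZ; exact: opboundD.
have b2 : opbound (im_part a) k.
  have -> : k = 2^-1 * (k + k) by field.
  by rewrite -[X in opbound _ (X * _)]halfi; apply: opboundZ; apply: opboundD => //; exact: opboundN.
have h1 := tau_hermitian_norm (re_part_hermitian a) k0 b1.
have h2 := tau_hermitian_norm (im_part_hermitian a) k0 b2.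
have i1 := tau_hermitian_Im (re_part_hermitian a).
have i2 := tau_hermitian_Im (im_part_hermitian a).
have -> : tau a = tau (re_part a) + 'i%C * tau (im_part a).
  by rewrite {1}[a]re_im_part tauD (tauZ _ (im_part a)).
rewrite !(ReD, ImD, ReM, ImM) i1 i2 /=.
rewrite !mul0r !mulr0 !mul1r !subr0 !addr0 !add0r.
have -> : 2 * k = k + k by ring.
exact: lerD.
Qed.

End States.

(** * Spectral resolutions and Riemann sums *)

Section StepApproximation.
Context {R : realType} {d : measure_display} {T : measurableType d}.
Context (m : {measure set T -> \bar R}) (K : set T) (mass : R).
Hypotheses (mK : measurable K) (mT : m setT = mass%:E) (mKC : m (~` K) = 0%E).

Lemma fin_measure B : measurable B -> m B \is a fin_num.
Proof.
move=> mB; rewrite ge0_fin_numE//; apply: (@le_lt_trans _ _ (m setT)).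
  by apply: le_measure; rewrite ?inE.
by rewrite mT ltry.
Qed.

Context (n : nat) (B : nat -> set T) (c : nat -> R).
Hypotheses (mB : forall i, measurable (B i)) (tB : trivIset setT B).

Let s (x : T) : R := \sum_(i < n) c i * \1_(B i) x.

Let sE x i : (i < n)%N -> B i x -> s x = c i.
Proof.
move=> ilt Bix; rewrite /s (bigD1 (Ordinal ilt))//= indicE mem_set//= mulr1.
rewrite big1 ?addr0// => j ji; rewrite indicE memNset ?mulr0// => Bjx.
have := @tB i j I I; case/(_ (ex_intro _ x (conj Bix Bjx))) => e.
by move: ji; rewrite -val_eqE /= e eqxx.
Qed.

Lemma integrable_bounded (g : T -> R) : measurable_fun setT g ->
  (exists b, forall x, K x -> `|g x| <= b) -> m.-integrable setT (EFin \o g).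
Proof.
move=> mg [b gb]; have /measurable_EFinP mg' := mg.
apply/(negligible_integrable (measurableC mK) measurableT mg' mKC).
have -> : setT `\` ~` K = K by rewrite setTD setCK.
apply: measurable_bounded_integrable => //.
- by rewrite ltey_eq fin_measure.
- exact: measurable_funS mg.
- exists b; split; first exact: num_real.
  by move=> y /ltW by' x Kx /=; apply: le_trans by'; exact: gb.
Qed.

Lemma Rintegral_concentrated (g : T -> R) : m.-integrable setT (EFin \o g) ->
  \int[m]_x g x = \int[m]_(x in K) g x.
Proof.
move=> ig; rewrite /Rintegral (negligible_integral (measurableC mK) measurableT ig mKC).
by rewrite setTD setCK.
Qed.

(** The step function with values [c i] on [B i] is within [e] of [g] on [K], which
carries [m]. *)
Lemma integral_step_approx (g : T -> R) (e : R) : measurable_fun setT g -> 0 <= e ->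
  (forall x, K x -> exists i, [/\ (i < n)%N, B i x & `|g x - c i| <= e]) ->
  m.-integrable setT (EFin \o g) /\
  `|\int[m]_x g x - \sum_(i < n) c i * fine (m (B i))| <= e * mass.
Proof.
move=> mg e0 gs.
have ms : measurable_fun setT s.
  apply: measurable_sum => i; apply: measurable_funM; first exact: measurable_cst.
  exact: measurable_indic.
have sb : forall x, `|s x| <= \sum_(i < n) `|c i|.
  move=> x; apply: (le_trans (ler_norm_sum _ _ _)); apply: ler_sum => i _.
  rewrite normrM ler_piMr// indicE; case: (_ \in _); rewrite ?normr1 ?normr0//.
have is_ : m.-integrable setT (EFin \o s).
  by apply: integrable_bounded => //; exists (\sum_(i < n) `|c i|).
have ig : m.-integrable setT (EFin \o g).
  apply: integrable_bounded => //; exists (e + \sum_(i < n) `|c i|) => x Kx.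
  have [i [ilt Bix gi]] := gs x Kx.
  have -> : g x = (g x - c i) + s x by rewrite (sE ilt Bix) subrK.
  by apply: (le_trans (ler_normD _ _)); apply: lerD.
split => //.
have -> : \sum_(i < n) c i * fine (m (B i)) = \int[m]_x s x.
  rewrite /s.
  have -> : \int[m]_x (\sum_(i < n) c i * \1_(B i) x) =
     \sum_(i < n) \int[m]_x (c i * \1_(B i) x).
    rewrite /Rintegral.
    under eq_integral => x _ do rewrite -sumEFin.
    rewrite integral_sum//=; last first.
      move=> i; apply: (integrable_bounded (g := fun x => c i * \1_(B i) x)).
        by apply: measurable_funM; [exact: measurable_cst|exact: measurable_indic].
      exists `|c i| => x _; rewrite normrM ler_piMr// indicE.
      by case: (_ \in _); rewrite ?normr1 ?normr0.
    rewrite sum_fine// => i _; apply: integrable_fin_num => //.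
    apply: (integrable_bounded (g := fun x => c i * \1_(B i) x)).
      by apply: measurable_funM; [exact: measurable_cst|exact: measurable_indic].
    exists `|c i| => x _; rewrite normrM ler_piMr// indicE.
    by case: (_ \in _); rewrite ?normr1 ?normr0.
  apply: eq_bigr => i _; rewrite RintegralZl//; last first.
    apply: (integrable_bounded (g := \1_(B i))); first exact: measurable_indic.
    by exists 1 => x _; rewrite indicE; case: (_ \in _); rewrite ?normr1 ?normr0.
  by rewrite /Rintegral integral_indic// setIT.
have igs0 : m.-integrable setT (EFin \o (fun x => g x - s x)).
  exact: (integrableB measurableT ig is_).
rewrite -RintegralB// Rintegral_concentrated//.
have igs : m.-integrable K (EFin \o (fun x => g x - s x)).
  exact: (integrableS measurableT).
apply: (le_trans (le_normr_Rintegral mK igs)).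
apply: (@le_trans _ _ (\int[m]_(x in K) (cst e x))).
  apply: le_Rintegral => //.
  - exact: integrable_norm.
  - apply: measurable_bounded_integrable => //; first by rewrite ltey_eq fin_measure.
    by exists e; split; [exact: num_real|move=> y /ltW ey x _ /=; rewrite ger0_norm].
  - by move=> x Kx; have [i [ilt Bix gi]] := gs x Kx; rewrite (sE ilt Bix).
rewrite Rintegral_cst// ler_wpM2l// -lee_fin fineK ?fin_measure// -mT.
by apply: le_measure; rewrite ?inE.
Qed.

End StepApproximation.

Section SpectralResolution.
Context {R : realType} {M : vonNeumannAlgebra R}.
Local Notation H := (vn_space M).
Local Notation rep := (@vn_rep R M).
Local Notation TR := (measurableTypeR R).
Implicit Types (a b : M) (x y : H) (B C : set TR).

(** Additivity of a projection-valued measure is known only through its quadratic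
forms; this transfers it to operators. *)
Lemma hermitian_form_eq a b : hermitian_elt a -> hermitian_elt b ->
  (forall x, complex.Re (ip (rep a x) x) = complex.Re (ip (rep b x) x)) -> a = b.
Proof.
move=> ha hb h; apply/eqP; rewrite -subr_eq0; apply/eqP; apply: opbound_small => e e0.
apply: opbound_le (ltW e0) _; apply: opbound_form => //.
  by rewrite /hermitian_elt starB ha hb.
by move=> x; rewrite repB !ipE ReD ReN h subrr normr0 mul0r.
Qed.

Lemma hermitianD a b : hermitian_elt a -> hermitian_elt b -> hermitian_elt (a + b).
Proof. by rewrite /hermitian_elt starD => -> ->. Qed.

Lemma hermitianZ (r : R) a : hermitian_elt a -> hermitian_elt (r%:C *: a).
Proof. by rewrite /hermitian_elt starZ conjc_real => ->. Qed.

Lemma hermitian_sum (I : Type) (s : seq I) (P : pred I) (F : I -> M) :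
  (forall i, P i -> hermitian_elt (F i)) -> hermitian_elt (\sum_(i <- s | P i) F i).
Proof. by move=> h; elim/big_ind: _ => //; [exact: star0|exact: hermitianD]. Qed.

Lemma projection_form a x : projection_elt a -> ip (rep a x) x = (hnorm (rep a x) ^+ 2)%:C.
Proof. by move=> [h1 h2]; rewrite -ipee -{1}h2 vn_repM ip_rep h1. Qed.

Context (a : M) (E : set TR -> M).
Hypothesis hE : spectral_resolution a E.

Lemma spectral_projection B : measurable B -> projection_elt (E B).
Proof. by case: hE => _ h _ _ _; exact: h. Qed.

Lemma spectral_hermitian B : measurable B -> hermitian_elt (E B).
Proof. by move=> /spectral_projection[]. Qed.

Lemma spectral_setT : E setT = 1.
Proof. by case: hE. Qed.

Lemma spectral_form x : exists m : {measure set TR -> \bar R},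
  [/\ forall B, measurable B -> m B = (complex.Re (ip (rep (E B) x) x))%:E,
      m setT = (hnorm x ^+ 2)%:E &
      (\int[m]_t t%:E)%E = (complex.Re (ip (rep a x) x))%:E].
Proof.
case: hE => _ _ _ _ /(_ x) [m [h1 h2]]; exists m; split => //.
by rewrite h1// spectral_setT vn_rep1 -[hdot _ _ _]/(ip x x) ipee.
Qed.

Lemma spectralU B C : measurable B -> measurable C -> B `&` C = set0 ->
  E (B `|` C) = E B + E C.
Proof.
move=> mB mC BC; have mBC : measurable (B `|` C) by exact: measurableU.
apply: hermitian_form_eq; [exact: spectral_hermitian|by apply: hermitianD; exact: spectral_hermitian|].
move=> x; have [m [hm _ _]] := spectral_form x.
rewrite repD !ipE ReD; apply/EFin_inj; rewrite EFinD -!hm//.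
exact: measureU.
Qed.

Lemma spectral_set0 : E set0 = 0.
Proof.
apply: (addrI (E set0)); rewrite addr0 -spectralU ?setIid//; first by rewrite setUid.
Qed.

Lemma spectralC B : measurable B -> E (~` B) = 1 - E B.
Proof.
move=> mB; apply/eqP; rewrite eq_sym subr_eq -spectralU ?setICl//; last exact: measurableC.
by rewrite setUCl spectral_setT.
Qed.

(** Two projections whose sum is a projection anticommute, hence annihilate each
other. *)
Lemma projection_orth b c : projection_elt b -> projection_elt c -> projection_elt (b + c) ->
  b * c = 0.
Proof.
move=> [_ bb] [_ cc] [_]; rewrite mulrDl !mulrDr bb cc => h.
have anti : b * c = - (c * b).
  apply/eqP; rewrite -addr_eq0; move/eqP: h.
  by rewrite -addrA (addrA (b * c)) (inj_eq (addrI b)) -subr_eq0 addrK.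
have : b * c = c * b.
  by rewrite -{1}bb -mulrA anti mulrN mulrA anti mulNr opprK -mulrA bb.
rewrite {1}anti => /eqP; rewrite eq_sym -subr_eq0 opprK -mulr2n -scaler_nat.
rewrite scaler_eq0 pnatr_eq0 /= => /eqP cb; by rewrite anti cb oppr0.
Qed.

Lemma spectral_orth B C : measurable B -> measurable C -> B `&` C = set0 -> E B * E C = 0.
Proof.
move=> mB mC BC; apply: projection_orth; try exact: spectral_projection.
by rewrite -spectralU//; apply: spectral_projection; exact: measurableU.
Qed.

Lemma spectral_sub0 B C : measurable B -> measurable C -> B `<=` C -> E C = 0 -> E B = 0.
Proof.
move=> mB mC BC EC; have mD : measurable (C `\` B) by exact: measurableD.
have : E B * E (B `|` (C `\` B)) = 0 by rewrite setDUK// EC mulr0.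
have [_ bb] := spectral_projection mB.
by rewrite spectralU ?setDIK// mulrDr (spectral_orth mB mD) ?setDIK// addr0 bb.
Qed.

Lemma spectral_bigU (B : nat -> set TR) n : (forall i, measurable (B i)) ->
  trivIset setT B -> E (\big[setU/set0]_(i < n) B i) = \sum_(i < n) E (B i).
Proof.
move=> mB tB; elim: n => [|n ih]; first by rewrite !big_ord0 spectral_set0.
rewrite !big_ord_recr /= spectralU//.
- by rewrite ih.
- exact: bigsetU_measurable.
- rewrite -bigcup_mkord setI_bigcupl; apply: bigcup0 => i /= ilt.
  apply/seteqP; split => // x [Bi Bn].
  have := tB i n I I (ex_intro _ x (conj Bi Bn)) => e.
  by rewrite e ltnn in ilt.
Qed.

Lemma spectral_norm_sqr B x : measurable B ->
  complex.Re (ip (rep (E B) x) x) = hnorm (rep (E B) x) ^+ 2.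
Proof. by move=> mB; rewrite projection_form//; exact: spectral_projection. Qed.

(** Operator-norm form of the spectral theorem: the quadratic form of the difference
is estimated by [integral_step_approx], which suffices by [opbound_form]. *)
Lemma spectral_step_approx (K : set TR) (n : nat) (B : nat -> set TR) (c : nat -> R) (e : R) :
  measurable K -> E K = 1 -> (forall i, measurable (B i)) -> trivIset setT B -> 0 <= e ->
  (forall t, K t -> exists i, [/\ (i < n)%N, B i t & `|t - c i| <= e]) ->
  opbound (a - \sum_(i < n) (c i)%:C *: E (B i)) e /\ \sum_(i < n) E (B i) = 1.
Proof.
move=> mK EK mB tB e0 hB.
have mKC x (m : {measure set TR -> \bar R}) :
    (forall B, measurable B -> m B = (complex.Re (ip (rep (E B) x) x))%:E) ->
    m (~` K) = 0%E.
  by move=> hm; rewrite hm; [rewrite spectralC// EK subrr rep0 /ip linear0l|exact: measurableC].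
split; last first.
  rewrite -spectral_bigU//; set U := \big[setU/set0]_(i < n) B i.
  have mU : measurable U by exact: bigsetU_measurable.
  have KU : K `<=` U.
    by move=> t /hB[i [ilt Bit _]]; rewrite /U -bigcup_mkord; exists i.
  have E0 : E (~` U) = 0.
    apply: (@spectral_sub0 _ (~` K)); try exact: measurableC; first exact: subsetC.
    by rewrite spectralC// EK subrr.
  by rewrite -[U]setCK spectralC ?E0 ?subr0//; exact: measurableC.
have ha : hermitian_elt a by case: hE.
apply: opbound_form => //.
  rewrite /hermitian_elt -scaleN1r; apply: hermitianD => //.
  rewrite scaleN1r /hermitian_elt starN; congr (- _).
  by apply: hermitian_sum => i _; apply: hermitianZ; exact: spectral_hermitian.
move=> x; have [m [hm hT hint]] := spectral_form x.
have [] := integral_step_approx (g := idfun) mK hT (mKC x m hm) mB tB _ e0 hB.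
  exact: measurable_id.
move=> _; rewrite /Rintegral hint /=.
suff -> : complex.Re (ip (rep (a - \sum_(i < n) (c i)%:C *: E (B i)) x) x) =
  complex.Re (ip (rep a x) x) - \sum_(i < n) c i * fine (m (B i)) by [].
rewrite repB !ipE ReD ReN; congr (_ - _).
have rs : rep (\sum_(i < n) (c i)%:C *: E (B i)) x = \sum_(i < n) (c i)%:C *: rep (E (B i)) x.
  rewrite (big_morph (fun b => rep b x) (fun b d => repD b d x) (rep0 x)).
  by apply: eq_bigr => i _; rewrite repZ.
rewrite rs (big_morph (fun y => ip y x) (fun y z => ipDl y z x) (linear0l _ _)).
rewrite (big_morph (@complex.Re R) (@ReD R) (erefl _)).
by apply: eq_bigr => i _; rewrite ipZl ReM /= mul0r subr0 hm.
Qed.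

End SpectralResolution.

Section SpectralSums.
Context {R : realType} {M : vonNeumannAlgebra R}.
Local Notation H := (vn_space M).
Local Notation rep := (@vn_rep R M).
Local Notation TR := (measurableTypeR R).
Implicit Types (x y : H).
Context (a : M) (E : set TR -> M) (n : nat) (B : nat -> set TR).
Hypotheses (hE : spectral_resolution a E) (mB : forall i, measurable (B i))
  (tB : trivIset setT B).

(** The Riemann sum attached to a step function with values [c i] on [B i]. *)
Definition spectral_sum (c : nat -> R) : M := \sum_(i < n) (c i)%:C *: E (B i).

Lemma spectral_sumM c d :
  spectral_sum c * spectral_sum d = spectral_sum (fun i => c i * d i).
Proof.
rewrite /spectral_sum mulr_suml; apply: eq_bigr => i _; rewrite mulr_sumr (bigD1 i)//=.
have [_ ee] := spectral_projection hE (mB i).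
rewrite -scalerAr -scalerAl ee scalerA -rmorphM /= mulrC big1 ?addr0// => j ji.
rewrite -scalerAr -scalerAl (spectral_orth hE)// ?scaler0//.
apply/seteqP; split => // t bb.
have := @tB i j I I (ex_intro _ t bb) => /ord_inj e.
by move: ji; rewrite e eqxx.
Qed.

Lemma spectral_sum_hermitian c : hermitian_elt (spectral_sum c).
Proof.
by apply: hermitian_sum => i _; apply: hermitianZ; exact: (spectral_hermitian hE).
Qed.

(** A spectral sum acts on orthogonal pieces by scalars, so its quadratic form is a
weighted sum of the squared norms of the pieces. *)
Lemma spectral_sum_opbound c (k : R) : \sum_(i < n) E (B i) = 1 -> 0 <= k ->
  (forall i, (i < n)%N -> `|c i| <= k) -> opbound (spectral_sum c) k.
Proof.
move=> E1 k0 ck; apply: opbound_form => //; first exact: spectral_sum_hermitian.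
have form d x : complex.Re (ip (rep (spectral_sum d) x) x) =
    \sum_(i < n) d i * hnorm (rep (E (B i)) x) ^+ 2.
  have -> : rep (spectral_sum d) x = \sum_(i < n) (d i)%:C *: rep (E (B i)) x.
    rewrite (big_morph (fun b => rep b x) (fun b e => repD b e x) (rep0 x)).
    by apply: eq_bigr => i _; rewrite repZ.
  rewrite (big_morph (fun y => ip y x) (fun y z => ipDl y z x) (linear0l _ _)).
  rewrite (big_morph (@complex.Re R) (@ReD R) (erefl _)).
  by apply: eq_bigr => i _; rewrite ipZl ReM /= mul0r subr0 (spectral_norm_sqr hE).
move=> x; have -> : hnorm x ^+ 2 = complex.Re (ip (rep (spectral_sum (fun=> 1)) x) x).
  rewrite /spectral_sum; under eq_bigr => i _ do rewrite scale1r.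
  by rewrite E1 vn_rep1 ipee.
rewrite !form mulr_sumr; apply: (le_trans (ler_norm_sum _ _ _)); apply: ler_sum => i _.
by rewrite normrM (ger0_norm (sqr_ge0 _)) mul1r ler_wpM2r ?sqr_ge0// ck.
Qed.

Lemma tau_spectral_sum (tau : M -> R[i]) c : faithful_normal_tracial_state tau ->
  complex.Re (tau (spectral_sum c)) = \sum_(i < n) c i * complex.Re (tau (E (B i))).
Proof.
move=> htau; rewrite /spectral_sum (tau_sum htau).
rewrite (big_morph (@complex.Re R) (@ReD R) (erefl _)).
by apply: eq_bigr => i _; rewrite (tauZ htau) ReM /= mul0r subr0.
Qed.

End SpectralSums.

Section TwoPointSpectrum.
Context {R : realType} {M : vonNeumannAlgebra R} {tau : M -> R[i]}.
Hypothesis htau : faithful_normal_tracial_state tau.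
Local Notation TR := (measurableTypeR R).

(** By faithfulness of [tau] the spectral resolution is carried by the two points,
and the symmetry is the difference of the two spectral projections. *)
Lemma two_point_symmetry (a : M) (al al' : R) : al != al' ->
  spectral_measure tau a (two_point al al') ->
  exists u, [/\ hermitian_elt u, u * u = 1, tau u = 0 &
    a = ((al + al') / 2)%:C%:A + ((al' - al) / 2)%:C *: u].
Proof.
move=> ne [E hE hmu].
pose B (i : nat) : set TR := if i == 0%N then [set al] else if i == 1%N then [set al'] else set0.
pose c (i : nat) : R := if i == 0%N then al else al'.
have mB i : measurable (B i).
  by rewrite /B; case: ifP => _; [exact: measurable_set1|case: ifP => _; [exact: measurable_set1|]].
have tB : trivIset setT B.
  move=> [|[|i]] [|[|j]] _ _ // [t]; rewrite /B /= => -[]//= -> e; move: ne; rewrite e eqxx//.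
pose K : set TR := [set al] `|` [set al'].
have mK : measurable K by apply: measurableU; exact: measurable_set1.
have BE : \big[setU/set0]_(i < 2) B i = K by rewrite !big_ord_recl big_ord0 setU0.
have tauE C : measurable C -> tau (E C) = (fine (two_point al al' C))%:C.
  move=> mC; rewrite hmu//=; apply: complex_ext => //=.
  exact: (tau_hermitian_Im htau (spectral_hermitian hE mC)).
have EK : E K = 1.
  have mKC : measurable (~` K) by exact: measurableC.
  have t0 : tau (E (~` K)) = 0.
    have k1 : ~ (~` K) al by move=> h; apply: h; left.
    have k2 : ~ (~` K) al' by move=> h; apply: h; right.
    by rewrite tauE// /two_point !diracE (memNset k1) (memNset k2) !mule0 adde0.
  have [h1 h2] := spectral_projection hE mKC.
  have E0 : E (~` K) = 0.
    by case: htau => _ _ fa _ _; apply: fa; rewrite h1 h2.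
  by rewrite -[K]setCK (spectralC hE)// E0 subr0.
have [bound E2] : opbound (a - \sum_(i < 2) (c i)%:C *: E (B i)) 0 /\ \sum_(i < 2) E (B i) = 1.
  apply: (spectral_step_approx hE mK EK mB tB) => // t [->|->].
    by exists 0%N; rewrite /c /= subrr normr0.
  by exists 1%N; rewrite /c /= subrr normr0.
set e := E (B 0%N); set e' := E (B 1%N).
have ee1 : e + e' = 1 by rewrite -E2 !big_ord_recl big_ord0 addr0.
have aE : a = al%:C *: e + al'%:C *: e'.
  apply/eqP; rewrite -subr_eq0; apply/eqP; apply: opbound_small => r r0.
  apply: opbound_le (ltW r0) _; move: bound.
  by rewrite !big_ord_recl big_ord0 addr0.
have [he pe] := spectral_projection hE (mB 0%N); have [he' pe'] := spectral_projection hE (mB 1%N).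
have BB : B 0%N `&` B 1%N = set0.
  by apply/seteqP; split => // t [] -> /eqP; rewrite (negbTE ne).
have oe : e * e' = 0 by exact: (spectral_orth hE).
have oe' : e' * e = 0 by apply: (spectral_orth hE) => //; rewrite setIC.
have te : tau e = (2^-1)%:C.
  rewrite tauE// /two_point !diracE /B /= mem_set// memNset; last first.
    by move=> /= h; move: ne; rewrite h eqxx.
  by apply: complex_ext => //=; rewrite mulr1 mulr0 addr0.
have te' : tau e' = (2^-1)%:C.
  rewrite tauE// /two_point !diracE /B /= memNset; last first.
    by move=> /= h; move: ne; rewrite h eqxx.
  by rewrite mem_set//; apply: complex_ext => //=; rewrite mulr1 mulr0 add0r.
exists (e' - e); split.
- by rewrite /hermitian_elt starB he he'.
- rewrite mulrBl !mulrBr -/e -/e' pe pe' oe oe' -ee1; by rewrite subr0 sub0r opprK addrC.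
- by rewrite (tauB htau) te te' subrr.
- rewrite aE -ee1 scalerBr scalerDr [X in _ = _ + X]addrC [RHS]addrACA -scalerBl -scalerDl.
  by congr (_ *: _ + _ *: _); apply: complex_ext; rewrite /=; field.
Qed.

End TwoPointSpectrum.

Section SpectralMeasureOfPositive.
Context {R : realType} {M : vonNeumannAlgebra R} {tau : M -> R[i]}.
Hypothesis htau : faithful_normal_tracial_state tau.
Local Notation H := (vn_space M).
Local Notation rep := (@vn_rep R M).
Local Notation TR := (measurableTypeR R).
Context (a : M) (E : set TR -> M) (mu : {measure set TR -> \bar R}).
Hypotheses (hE : spectral_resolution a E)
  (hmu : forall B, measurable B -> mu B = (complex.Re (tau (E B)))%:E).

Lemma spectral_measure_setT : mu setT = 1%:E.
Proof. by rewrite hmu// (spectral_setT hE) (tau1 htau). Qed.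

Lemma spectral_measure_null B : measurable B -> E B = 0 -> mu B = 0%E.
Proof. by move=> mB EB; rewrite hmu// EB (tau0 htau). Qed.

(** Half-open cells of equal length, the mesh of the Riemann sums. *)
Lemma cells_trivIset (u d : R) : 0 < d ->
  trivIset setT (fun i : nat => `[(u + i%:R * d), (u + i.+1%:R * d)[%classic : set TR).
Proof.
move=> d0 i j _ _ [t []] /=; rewrite !in_itv /= => /andP[h1 h2] /andP[h3 h4].
have l1 : i%:R * d < j.+1%:R * d by lra.
have l2 : j%:R * d < i.+1%:R * d by lra.
move: l1 l2; rewrite !ltr_pM2r// !ltr_nat !ltnS => ij ji.
by apply/eqP; rewrite eqn_leq ij ji.
Qed.

Lemma cells_cover (u d : R) n (t : R) : 0 < d -> u <= t < u + n%:R * d ->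
  exists i, [/\ (i < n)%N, u + i%:R * d <= t & t < u + i.+1%:R * d].
Proof.
move=> d0; elim: n => [|n ih]; first by rewrite mul0r addr0 => /andP[h1 /(le_lt_trans h1)]; rewrite ltxx.
move=> /andP[h1 h2]; have [h3|h3] := ltP t (u + n%:R * d).
  by have [|i [h4 h5 h6]] := ih; rewrite ?h1//; exists i; split => //; exact: ltnW.
by exists n.
Qed.

(** Both sides are within a multiple of the mesh of the trace of a spectral sum. *)
Lemma spectral_resolvent (eps : R) (Q : M) : 0 < eps ->
  Q * (a * a + eps%:C%:A) = 1 ->
  complex.Re (tau Q) = \int[mu]_t (t ^+ 2 + eps)^-1.
Proof.
move=> e0 hQ.
have [r0 Er] : exists r : R, E `[- r, r]%classic = 1 by case: hE.
pose r : R := `|r0|; pose K : set TR := `[- r, r]%classic.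
have mK : measurable K by exact: measurable_itv.
have EK : E K = 1.
  have m0 : measurable (`[- r0, r0]%classic : set TR) by exact: measurable_itv.
  rewrite -[K]setCK (spectralC hE); last exact: measurableC.
  rewrite (spectral_sub0 hE (C := ~` `[- r0, r0]%classic)) ?subr0//; try exact: measurableC.
    apply: subsetC => t /=; rewrite !in_itv /= => /andP[h1 h2].
    have h3 : r0 <= r by exact: ler_norm.
    by rewrite /K /= in_itv /= (le_trans _ h1) ?lerN2//= (le_trans h2).
  by rewrite (spectralC hE)// Er subrr.
have mKC : mu (~` K) = 0%E.
  by apply: spectral_measure_null; [exact: measurableC|rewrite (spectralC hE)// EK subrr].
have rr : 0 <= r by rewrite normr_ge0.
have [ka ka0 hka] := opbound_ex a; have [kq kq0 hkq] := opbound_ex Q.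
pose L := 1 + eps^-1.
have L0 : 0 < L by rewrite addr_gt0// invr_gt0.
pose C := 2 * (kq * ((ka + 1) + ka) * eps^-1) + 2 * L / eps.
have C0 : 0 < C.
  by rewrite /C; repeat (apply: addr_gt0 || apply: mulr_gt0 || rewrite invr_gt0 || done).
suff key (d : R) : 0 < d -> d <= 1 ->
    `|complex.Re (tau Q) - \int[mu]_t (t ^+ 2 + eps)^-1| <= C * d.
  apply/eqP; rewrite -subr_eq0 -normr_le0; apply/ler_addgt0Pr => s s0; rewrite add0r.
  have [s1|s1] := leP (s / C) 1.
    have -> : s = C * (s / C) by field; exact: lt0r_neq0.
    by apply: key; rewrite ?divr_gt0.
  apply: (le_trans (key 1 ltr01 (lexx _))); move: s1; rewrite ltr_pdivlMr// mul1r mulr1.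
  exact: ltW.
move=> d0 d1.
pose B (i : nat) : set TR := `[(- r + i%:R * d), (- r + i.+1%:R * d)[%classic.
have mB i : measurable (B i) by exact: measurable_itv.
have tB : trivIset setT B by exact: cells_trivIset.
pose n := (Num.truncn (2 * r / d)).+1.
have nd : r < - r + n%:R * d.
  have : 2 * r / d < n%:R by apply: truncnS_gt.
  by rewrite ltr_pdivrMr//; lra.
pose c (i : nat) : R := - r + i%:R * d.
have cover t : K t -> exists i, [/\ (i < n)%N, B i t & `|t - c i| <= d].
  rewrite /K /= in_itv /= => /andP[h1 h2].
  have [|i [h3 h4 h5]] := @cells_cover (- r) d n t d0; first by rewrite h1 (le_lt_trans h2).
  exists i; split => //; first by rewrite /B /= in_itv /= h4 h5.
  rewrite /c ger0_norm ?subr_ge0//; move: h5; rewrite -natr1 mulrDl mul1r; lra.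
have [aT E1] := spectral_step_approx hE mK EK mB tB (ltW d0) cover.
rewrite -[X in opbound (_ - X) _]/(spectral_sum E n B c) in aT.
pose f (t : R) := (t ^+ 2 + eps)^-1.
have fp t : 0 < t ^+ 2 + eps by rewrite ltr_wpDl ?sqr_ge0.
set Ts := spectral_sum E n B c in aT.
pose Tc := spectral_sum E n B (f \o c).
have TsTc : (Ts * Ts + eps%:C%:A) * Tc = 1.
  have -> : eps%:C%:A = spectral_sum E n B (fun=> eps).
    by rewrite /spectral_sum -scaler_sumr E1.
  rewrite (spectral_sumM n hE mB tB).
  have -> : spectral_sum E n B (fun i => c i * c i) + spectral_sum E n B (fun=> eps) =
      spectral_sum E n B (fun i => c i ^+ 2 + eps).
    rewrite /spectral_sum -big_split /=; apply: eq_bigr => i _.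
    by rewrite -scalerDl -rmorphD /= expr2.
  rewrite (spectral_sumM n hE mB tB) -E1; apply: eq_bigr => i _.
  by rewrite /= /f mulfV ?scale1r// lt0r_neq0.
have Tcb : opbound Tc eps^-1.
  apply: (spectral_sum_opbound hE mB E1) => [|i _]; first by rewrite invr_ge0 ltW.
  rewrite /= /f ger0_norm ?invr_ge0 ?(ltW (fp _))//.
  by rewrite lef_pV2 ?posrE// lerDr sqr_ge0.
have Tsb : opbound Ts (ka + 1).
  have -> : Ts = a - (a - Ts) by rewrite opprB addrC subrK.
  apply: opboundD => //; apply: opboundN; exact: opbound_le aT.
have diff : Q - Tc = Q * ((Ts * (Ts - a) + (Ts - a) * a) * Tc).
  have -> : Ts * (Ts - a) + (Ts - a) * a = (Ts * Ts + eps%:C%:A) - (a * a + eps%:C%:A).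
    by rewrite mulrBr mulrBl addrA subrK opprD addrACA subrr addr0.
  by rewrite mulrBl TsTc mulrBr mulr1 mulrA hQ mul1r.
have dT : opbound (Ts - a) d by rewrite -opprB; exact: opboundN.
have dbound : opbound (Q - Tc) (kq * (((ka + 1) * d + d * ka) * eps^-1)).
  rewrite diff; apply: opboundM => //; first exact: ltW.
  have k1 : 0 <= ka + 1 by rewrite addr_ge0// ltW.
  apply: opboundM => //; first by rewrite addr_ge0// mulr_ge0// ltW.
  by apply: opboundD; apply: opboundM => //; exact: ltW.
have t1 := cabs_tau_le htau _ dbound.
have t2 : `|complex.Re (tau Q) - complex.Re (tau Tc)| <=
    2 * (kq * (((ka + 1) * d + d * ka) * eps^-1)).
  rewrite -ReN -ReD -(tauB htau); apply: le_trans (ler_Re_cabs _) (t1 _).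
  apply: mulr_ge0; first exact: ltW.
  rewrite mulr_ge0 ?invr_ge0 ?(ltW e0)//.
  by rewrite addr_ge0// mulr_ge0 ?addr_ge0// ltW.
have mf : measurable_fun (setT : set TR) (f : TR -> R).
  apply: continuous_measurable_fun => t; apply: cvgV; first exact: lt0r_neq0.
  by apply: cvgD; [exact: exprn_continuous|exact: cvg_cst].
have fL s t : `|s - t| <= d -> `|f s - f t| <= 2 * L / eps * d.
  move=> st; rewrite /f.
  have -> : (s ^+ 2 + eps)^-1 - (t ^+ 2 + eps)^-1 =
     (t - s) * ((t + s) / ((s ^+ 2 + eps) * (t ^+ 2 + eps))).
    by field; rewrite !lt0r_neq0.
  rewrite normrM distrC mulrC.
  have Ls u : `|u| <= L * (u ^+ 2 + eps).
    have -> : L * (u ^+ 2 + eps) = u ^+ 2 + eps + (u ^+ 2) / eps + 1.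
      by rewrite /L; field; exact: lt0r_neq0.
    have q0 : 0 <= u ^+ 2 / eps by rewrite divr_ge0 ?sqr_ge0// ltW.
    have : 0 <= (`|u| - 1) ^+ 2 by exact: sqr_ge0.
    rewrite sqrrB1 real_normK ?num_real//; have := sqr_ge0 u; nra.
  apply: ler_pM => //.
  rewrite normrM normfV (gtr0_norm (mulr_gt0 _ _))// ler_pdivrMr ?mulr_gt0//.
  apply: (le_trans (ler_normD _ _)).
  have p1 := fp s; have p2 := fp t.
  have -> : 2 * L / eps * ((s ^+ 2 + eps) * (t ^+ 2 + eps)) =
    (L * (t ^+ 2 + eps)) * ((s ^+ 2 + eps) / eps) + (L * (s ^+ 2 + eps)) * ((t ^+ 2 + eps) / eps).
    by field; exact: lt0r_neq0.
  have ge1 u : 1 <= (u ^+ 2 + eps) / eps by rewrite ler_pdivlMr// mul1r lerDr sqr_ge0.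
  apply: lerD; (apply: le_trans (Ls _) _; rewrite ler_peMr ?ge1// mulr_ge0 ?ltW//).
have q0 : 0 <= 2 * L / eps * d.
  by rewrite mulr_ge0 ?(ltW d0)// divr_ge0 ?(ltW e0)// mulr_ge0// ltW.
have gs t : K t -> exists i, [/\ (i < n)%N, B i t & `|f t - (f \o c) i| <= 2 * L / eps * d].
  by move=> /cover[i [h1 h2 h3]]; exists i; split => //; exact: fL.
have [_] := integral_step_approx mK spectral_measure_setT mKC mB tB mf q0 gs.
rewrite mulr1.
have -> : \sum_(i < n) (f \o c) i * fine (mu (B i)) = complex.Re (tau Tc).
  by rewrite (tau_spectral_sum E n B _ htau); apply: eq_bigr => i _; rewrite hmu.
move=> t3.
have -> : complex.Re (tau Q) - \int[mu]_t f t =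
  (complex.Re (tau Q) - complex.Re (tau Tc)) + - (\int[mu]_t f t - complex.Re (tau Tc)).
  by rewrite opprB addrA subrK.
apply: (le_trans (ler_normD _ _)); rewrite normrN.
apply: (le_trans (lerD t2 t3)).
rewrite /C le_eqVlt; apply/orP; left; apply/eqP; field; exact: lt0r_neq0.
Qed.

End SpectralMeasureOfPositive.

(** * The Fuglede-Kadison determinant from resolvents *)

Section LogarithmicMoment.
Context {R : realType}.
Local Notation TR := (measurableTypeR R).
Context (mu : {measure set TR -> \bar R}) (r : R).
Local Notation K := (`[0, r]%classic : set TR).
Hypotheses (r0 : 0 <= r) (muT : mu setT = 1%:E) (muK : mu (~` K) = 0%E).

Let mK : measurable K. Proof. exact: measurable_itv. Qed.

Lemma measurable_ln_sqrD (e : R) : 0 < e -> measurable_fun setT (fun t : TR => ln (t ^+ 2 + e)).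
Proof.
move=> e0; apply: continuous_measurable_fun => t.
apply: (@continuous_comp _ _ _ (fun t : R => t ^+ 2 + e) (@ln R)).
  by apply: cvgD; [exact: exprn_continuous|exact: cvg_cst].
by apply: continuous_ln; rewrite ltr_wpDl ?sqr_ge0.
Qed.

Lemma integrable_ln_sqrD (e : R) : 0 < e -> mu.-integrable setT (fun t : TR => (ln (t ^+ 2 + e))%:E).
Proof.
move=> e0; apply: (integrable_bounded mK muT muK (g := fun t : TR => ln (t ^+ 2 + e))).
  exact: measurable_ln_sqrD.
exists (`|ln e| + `|ln (r ^+ 2 + e)|) => t /=; rewrite in_itv /= => /andP[t0 tr].
have p u : 0 < u ^+ 2 + e by rewrite ltr_wpDl ?sqr_ge0.
have h1 : ln e <= ln (t ^+ 2 + e) by rewrite ler_ln ?posrE// lerDr sqr_ge0.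
have h2 : ln (t ^+ 2 + e) <= ln (r ^+ 2 + e).
  by rewrite ler_ln ?posrE// lerD2r ler_sqr// nnegrE.
have := ler_norm (ln (r ^+ 2 + e)); have := ler_norm (- ln e); rewrite normrN => h3 h4.
have := normr_ge0 (ln e); have := normr_ge0 (ln (r ^+ 2 + e)).
by rewrite ler_norml => *; apply/andP; split; lra.
Qed.

Lemma harmonic_cvg_right : (harmonic n : R) @[n --> \oo] --> (0 : R)^'+.
Proof.
move=> A /= [e e0 hA]; have /cvgrPdist_lt/(_ e e0) := @cvg_harmonic R.
by apply: filterS => n h; apply: hA => //=; exact: harmonic_gt0.
Qed.

(** The shift of [t ^+ 2] by [1 / (n + 1)] removes the singularity of the logarithm at
0; at [t = 0] the limit is [+oo]. *)
Lemma lne_shifted_limit (C t : R) : 0 <= t ->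
  (C - 2^-1 * ln (t ^+ 2 + harmonic n))%:E @[n --> \oo] --> (C%:E - lne t%:E)%E.
Proof.
rewrite le_eqVlt => /orP[/eqP <-|t0].
  rewrite /= lexx /= expr0n /=; apply/cvgeyPge => A.
  have : ln (harmonic n) @[n --> \oo] --> (-oo : set_system R).
    exact: (cvg_comp _ _ harmonic_cvg_right (@lnNy R)).
  move=> /cvgrNyPle/(_ (2 * (C - A))); apply: filterS => n h.
  by rewrite lee_fin add0r; lra.
rewrite /= leNgt t0 /= -EFinB; apply: cvg_EFin; first by near=> n.
have -> : C - ln t = C - 2^-1 * ln (t ^+ 2 + 0).
  by rewrite addr0 lnXn//; congr (_ - _); lra.
apply: cvgB; first exact: cvg_cst.
apply: cvgMr.
apply: (cvg_comp (fun n => t ^+ 2 + harmonic n) (@ln R)).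
  by apply: cvgD; [exact: cvg_cst|exact: cvg_harmonic].
by apply: continuous_ln; rewrite addr0 exprn_gt0.
Unshelve. all: by end_near.
Qed.

(** Monotone convergence, applied to [C - ln (t ^+ 2 + 1 / (n + 1)) / 2] with [C] large
enough to make the functions nonnegative on the support of [mu]. *)
Lemma integral_lne_limit (l : R) :
  \int[mu]_t ln (t ^+ 2 + harmonic n) @[n --> \oo] --> l ->
  (\int[mu]_(t in `[0%R, +oo[) lne t%:E = (l / 2)%:E)%E.
Proof.
move=> hl.
pose C := 2^-1 * ln (r ^+ 2 + 1).
pose G n (t : TR) : \bar R := (C - 2^-1 * ln (t ^+ 2 + harmonic n))%:E.
pose W (t : TR) : \bar R := (C%:E - lne t%:E)%E.
have muK1 : mu K = 1%:E.
  have h := measureU mu mK (measurableC mK) (setICr K).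
  have h1 : mu (K `|` ~` K) = 1%:E by rewrite setUCr; exact: muT.
  have h2 := etrans h (etrans (congr1 (fun y => mu K + y)%E muK) (adde0 _)).
  exact: etrans (esym h2) h1.
have Kge t : K t -> 0 <= t by rewrite /= in_itv /= => /andP[].
have hp n : 0 < (harmonic n : R) by exact: harmonic_gt0.
have mlnK n : mu.-integrable K (fun t : TR => (ln (t ^+ 2 + harmonic n))%:E).
  by apply: (integrableS measurableT) => //; exact: integrable_ln_sqrD.
have mGS S n : measurable_fun (S : set TR) (G n).
  apply/measurable_EFinP; apply: measurable_funB; first exact: measurable_cst.
  apply: measurable_funM; first exact: measurable_cst.
  by apply: measurable_funTS; exact: measurable_ln_sqrD.
have mG n : measurable_fun K (G n) by [].
have G0 n t : K t -> (0%R <= G n t)%E.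
  rewrite /= in_itv /= => /andP[t0 tr]; rewrite lee_fin /C -mulrBr mulr_ge0 ?invr_ge0// subr_ge0.
  rewrite ler_ln ?posrE ?ltr_wpDl ?sqr_ge0//.
  apply: lerD; first by rewrite ler_sqr// nnegrE.
  by rewrite /harmonic /= invf_le1// ler1n.
have ndG t : K t -> {homo G^~ t : n m / (n <= m)%N >-> (n <= m)%E}.
  move=> _ n m nm; rewrite lee_fin lerD2l lerN2 ler_pM2l ?invr_gt0//.
  rewrite ler_ln ?posrE ?ltr_wpDl ?sqr_ge0// lerD2l /harmonic /=.
  by rewrite lef_pV2 ?posrE// ler_nat ltnS.
have GW t : K t -> G n t @[n --> \oo] --> W t by move=> /Kge; exact: lne_shifted_limit.
have mW : measurable_fun K W by apply: (emeasurable_fun_cvg G).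
have intG n : (\int[mu]_(t in K) G n t = (C - 2^-1 * \int[mu]_t ln (t ^+ 2 + harmonic n))%:E)%E.
  rewrite (Rintegral_concentrated mK muK); last exact: integrable_ln_sqrD.
  have -> : (\int[mu]_(t in K) G n t =
      \int[mu]_(t in K) (C%:E - (2^-1)%:E * (ln (t ^+ 2 + harmonic n))%:E))%E by [].
  have iZ : mu.-integrable K (fun t : TR => ((2^-1)%:E * (ln (t ^+ 2 + harmonic n))%:E)%E).
    exact: integrableZl.
  have iC : mu.-integrable K (fun=> C%:E).
    apply: measurable_bounded_integrable => //; first by rewrite muK1 ltry.
    by exists `|C|; split; [exact: num_real|move=> y /ltW Cy x _].
  have ye : (\int[mu]_(t in K) (ln (t ^+ 2 + harmonic n))%:E =
      (\int[mu]_(t in K) ln (t ^+ 2 + harmonic n))%:E)%E.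
    by rewrite /Rintegral fineK//; exact: integrable_fin_num.
  by rewrite integralB// integral_cst// [X in (_ * X)%E]muK1 mule1 (integralZl mK (mlnK n)) ye.
have lim1 : (\int[mu]_(t in K) G n t)%E @[n --> \oo] --> (C - 2^-1 * l)%:E.
  under eq_fun do rewrite intG.
  apply: cvg_EFin; first by near=> n.
  by apply: cvgB; [exact: cvg_cst|exact: cvgMr].
have lim2 := cvg_monotone_convergence mK mG G0 ndG.
have intW : (\int[mu]_(t in K) W t = (C - 2^-1 * l)%:E)%E.
  have -> : (\int[mu]_(t in K) W t = \int[mu]_(t in K) limn (G^~ t))%E.
    apply: eq_integral => t; rewrite inE => Kt; apply/esym.
    exact: (@cvg_lim (\bar R) _ _ _ _ _ _ (GW t Kt)).
  exact: (cvg_unique _ (lim2 mu) lim1).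
have iW : mu.-integrable K W.
  apply/integrableP; split => //.
  have -> : (\int[mu]_(t in K) `|W t| = \int[mu]_(t in K) W t)%E.
    apply: eq_integral => t; rewrite inE => Kt; apply: gee0_abs.
    rewrite -(cvg_lim _ (GW t Kt))//; apply: lime_ge.
      by apply/cvg_ex; exists (W t); exact: GW.
    by near=> n; exact: G0.
  by rewrite intW ltry.
have iC : mu.-integrable K (fun=> C%:E).
  apply: measurable_bounded_integrable => //; first by rewrite muK1 ltry.
  by exists `|C|; split; [exact: num_real|move=> y /ltW Cy x _].
have lneE t : lne t%:E = (C%:E - W t)%E.
  by rewrite /W oppeB ?fin_num_adde_defr// addeA subee// add0e.
have lneF : (fun t : TR => lne t%:E) = (fun t => C%:E - W t)%E by exact/funext.
have ilne : mu.-integrable K (fun t : TR => lne t%:E).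
  by rewrite lneF; exact: integrableB.
pose D := (`[0, +oo[%classic : set TR).
have mD : measurable D by exact: measurable_itv.
have DK : D `\` (D `\` K) = K.
  by rewrite setDD; apply/setIidr => t; rewrite /D /= !in_itv /= => /andP[->].
have nDK : mu (D `\` K) = 0%E.
  apply/eqP; rewrite eq_le measure_ge0 andbT -muK; apply: le_measure; rewrite ?inE//.
  - exact: measurableD.
  - exact: measurableC.
have mlneD : measurable_fun D (fun t : TR => lne t%:E).
  rewrite lneF; apply: emeasurable_funB; first exact: measurable_cst.
  apply: (emeasurable_fun_cvg G) => // t.
  by rewrite /D /= in_itv /= andbT; exact: lne_shifted_limit.
rewrite -[X in integral _ X _]/D.
have iD : mu.-integrable D (fun t : TR => lne t%:E).
  by apply/(negligible_integrable (measurableD mD mK) mD mlneD nDK); rewrite DK.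
rewrite (negligible_integral (measurableD mD mK) mD iD nDK) DK.
have -> : (\int[mu]_(t in K) lne t%:E = \int[mu]_(t in K) (C%:E - W t))%E.
  by apply: eq_integral => t _; exact: lneE.
rewrite integralB// integral_cst//= muK1 mule1 intW -EFinB; congr (_%:E); lra.
Unshelve. all: by end_near.
Qed.

End LogarithmicMoment.

Section Determinant.
Context {R : realType} {M : vonNeumannAlgebra R} {tau : M -> R[i]}.
Hypothesis htau : faithful_normal_tracial_state tau.
Local Notation H := (vn_space M).
Local Notation rep := (@vn_rep R M).
Local Notation TR := (measurableTypeR R).

(** A vector in the range of a negative spectral projection has a negative
quadratic form, which is impossible for a positive element. *)
Lemma spectral_positive (a : M) (E : set TR -> M) (d : R) :
  spectral_resolution a E -> vn_pos a -> 0 < d -> E [set t | t <= - d] = 0.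
Proof.
move=> hE [y ay] d0; set N : set TR := [set t | t <= - d].
have mN : measurable N by rewrite /N -set_itvNyc; exact: measurable_itv.
have [r0 Er] : exists r : R, E `[- r, r]%classic = 1 by case: hE.
have mK : measurable (`[- r0, r0]%classic : set TR) by exact: measurable_itv.
apply: rep_eq => x; rewrite rep0; set xi := rep (E N) x.
have [m [hm mT mint]] := spectral_form hE xi.
have mNC : m (~` N) = 0%E.
  have mC : measurable (~` N) by exact: measurableC.
  rewrite hm// /xi -vn_repM (spectral_orth hE) ?setICl// rep0 /ip linear0l//.
have mKC : m (~` `[- r0, r0]%classic) = 0%E.
  by rewrite hm ?(spectralC hE)// ?Er ?subrr ?rep0 /ip ?linear0l//; exact: measurableC.
have iid : m.-integrable setT (EFin \o (idfun : TR -> R)).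
  apply: (integrable_bounded mK mT mKC); first exact: measurable_id.
  by exists r0 => t; rewrite /= in_itv /= ler_norml.
have apos : complex.Re (ip (rep a xi) xi) = hnorm (rep y xi) ^+ 2.
  by rewrite ay vn_repM ip_rep starK ipee.
have fin_m : (m N < +oo)%E.
  by rewrite ltey_eq (fin_measure mT mN).
have : \int[m]_t t <= - d * hnorm xi ^+ 2.
  rewrite (Rintegral_concentrated (g := idfun) mN mNC iid).
  apply: (@le_trans _ _ (\int[m]_(t in N) cst (- d) t)).
    apply: le_Rintegral => //; first exact: (integrableS measurableT).
    apply: measurable_bounded_integrable => //.
    by exists `|- d|; split; [exact: num_real|move=> z /ltW dz t _].
  rewrite Rintegral_cst// ler_nM2l ?oppr_lt0//.
  have : m setT = m N.
    have h := measureU m mN (measurableC mN) (setICr N).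
    have h2 := etrans h (etrans (congr1 (fun y => m N + y)%E mNC) (adde0 _)).
    by rewrite setUCr in h2; exact: h2.
  by move=> <-; rewrite mT.
rewrite /Rintegral mint /= apos => h; apply: hnorm_eq0; apply/eqP; rewrite -sqrf_eq0.
rewrite eq_le sqr_ge0 andbT leNgt; apply/negP => p.
have := sqr_ge0 (hnorm (rep y xi)); have := mulr_gt0 d0 p; move: h; lra.
Qed.

(** The logarithm of the Fuglede-Kadison determinant from the traces of the
resolvents: [Phi] is identified with the logarithmic potential
[eps |-> tau (ln (x^* x + eps))] because both have the same derivative and the
same behaviour at infinity. *)
Lemma FK_det_resolvent (x : M) (D : \bar R) (Q : R -> M) (Phi : R -> R) (l : R) :
  FK_det tau x D ->
  (forall e : R, 0 < e -> Q e * (star x * x + e%:C%:A) = 1) ->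
  (forall e : R, 0 < e -> is_derive e 1 Phi (complex.Re (tau (Q e)))) ->
  Phi t - ln t @[t --> +oo] --> 0 ->
  Phi t @[t --> (0 : R)^'+] --> l ->
  lne D = (l / 2)%:E.
Proof.
move=> [a [mu [[apos aa] [E hE hmu] ->]]] hQ dPhi Phioo Phi0; rewrite expeRK.
have muT : mu setT = 1%:E := spectral_measure_setT htau hE hmu.
have [r [r0 muK]] : exists r : R, 0 <= r /\ mu (~` `[0, r]%classic) = 0%E.
  have [r0 Er] : exists r : R, E `[- r, r]%classic = 1 by case: hE.
  exists `|r0|; split => //.
  pose N n : set TR := [set t | t <= - (n.+1%:R^-1)].
  have mN n : measurable (N n) by rewrite /N -set_itvNyc; exact: measurable_itv.
  have mK0 : measurable (`[- r0, r0]%classic : set TR) by exact: measurable_itv.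
  have mK : measurable (`[0, `|r0|]%classic : set TR) by exact: measurable_itv.
  apply: measure_negligible; first exact: measurableC.
  have neg1 : mu.-negligible (~` `[- r0, r0]%classic `|` \bigcup_n N n).
    apply: negligibleU.
      apply/negligibleP; first exact: measurableC.
      apply: (spectral_measure_null htau hmu); first exact: measurableC.
      by rewrite (spectralC hE)// Er subrr.
    apply: negligible_bigcup => n; apply/negligibleP => //.
    apply: (spectral_measure_null htau hmu) => //.
    by apply: (spectral_positive hE) => //; rewrite invr_gt0.
  apply: negligibleS neg1 => t /= nt.
  have [t0|t0] := ltP t 0.
    right; exists (Num.truncn (- t)^-1) => //; rewrite /N /= lerNr.
    rewrite -[leRHS]invrK lef_pV2 ?posrE ?invr_gt0 ?oppr_gt0 ?ltr0n//.
    by apply: ltW; apply: truncnS_gt.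
  left => tr; apply: nt; move: tr; rewrite !in_itv /= t0 /= => /andP[_ tr].
  exact: le_trans tr (ler_norm _).
apply: (integral_lne_limit r0 muT muK).
pose K : set TR := `[0, r]%classic.
have mK : measurable K by exact: measurable_itv.
pose f (e : R) (t : TR) : R := ln (t ^+ 2 + e).
pose phi (e : R) : R := \int[mu]_(t in K) f e t.
have p (t e : R) : 0 < e -> 0 < t ^+ 2 + e by move=> e0; rewrite ltr_wpDl ?sqr_ge0.
have fi (e : R) : 0 < e -> mu.-integrable K (EFin \o f e).
  by move=> e0; apply: (integrableS measurableT) => //; exact: (integrable_ln_sqrD r0 muT muK).
have phiE (e : R) : 0 < e -> \int[mu]_t ln (t ^+ 2 + e) = phi e.
  move=> e0; apply: (Rintegral_concentrated (g := f e) mK muK).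
  exact: (integrable_ln_sqrD r0 muT muK).
have df (t e : R) : 0 < e -> is_derive e 1 (fun u => ln (t ^+ 2 + u)) (t ^+ 2 + e)^-1.
  move=> e0; have := @is_derive1_comp R (@ln R) (fun u => t ^+ 2 + u) e _ 1 (is_derive1_ln (p t e e0)).
  rewrite mulr1; apply.
  have h := is_deriveD (is_derive_cst (t ^+ 2 : R) e 1) (is_derive_id e 1).
  by rewrite add0r in h; exact: h.
have dphi (e : R) : 0 < e -> is_derive e 1 phi (complex.Re (tau (Q e))).
  move=> e0.
  have -> : complex.Re (tau (Q e)) = \int[mu]_(t in K) partial1of2 f e t.
    have hQ' : Q e * (a * a + e%:C%:A) = 1 by rewrite aa hQ.
    rewrite (spectral_resolvent htau hE hmu e0 hQ').
    rewrite (Rintegral_concentrated mK muK); last first.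
      apply: (integrable_bounded mK muT muK (g := fun t : TR => (t ^+ 2 + e)^-1)).
        apply: continuous_measurable_fun => t; apply: cvgV; first by rewrite lt0r_neq0// p.
        by apply: cvgD; [exact: exprn_continuous|exact: cvg_cst].
      exists e^-1 => t _; rewrite ger0_norm ?invr_ge0 ?(ltW (p _ _ e0))//.
      by rewrite lef_pV2 ?posrE ?p// lerDr sqr_ge0.
    apply: eq_Rintegral => t _; rewrite /partial1of2 derive1E /f.
    by have [_ ->] := df t e e0.
  have e2 : 0 < e / 2 by rewrite divr_gt0.
  apply/is_derive_cvg.
  apply: (@cvg_differentiation_under_integral R _ _ mu f K mK e (e / 2) (e + 1) _ _ _
    (fun=> (e / 2)^-1)).
  - by rewrite /= in_itv /= ltrDl ltr01 andbT; lra.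
  - by move=> u /=; rewrite in_itv /= => /andP[u0 _]; apply: fi; exact: lt_trans u0.
  - move=> u t /=; rewrite in_itv /= => /andP[u0 _] _.
    by have [] := df t u (lt_trans e2 u0).
  - by move=> t; rewrite invr_ge0 ltW.
  - apply: measurable_bounded_integrable => //.
      by rewrite ltey_eq (fin_measure muT).
    by exists `|(e / 2)^-1|; split; [exact: num_real|move=> z /ltW dz t _].
  - move=> u t /=; rewrite in_itv /= => /andP[u0 _] _.
    have u00 := lt_trans e2 u0.
    rewrite /partial1of2 derive1E /f; have [_ ->] := df t u u00.
    rewrite ger0_norm ?invr_ge0 ?(ltW (p _ _ u00))//.
    rewrite lef_pV2 ?posrE ?p//; apply: (le_trans (ltW u0)); by rewrite lerDr sqr_ge0.
(* the two potentials differ by a constant, which vanishes at infinity *)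
have cstD (s t : R) : 0 < s -> s < t -> phi t - Phi t = phi s - Phi s.
  move=> s0 st.
  have dD (u : R) : 0 < u -> is_derive u 1 (phi - Phi) 0.
    move=> u0; have h1 := dphi u u0; have h2 := dPhi u u0.
    by apply: is_derive_eq; rewrite subrr.
  have [||c _] := @MVT R (phi - Phi) (fun=> 0) s t st.
  - by move=> u; rewrite in_itv /= => /andP[su _]; apply: dD; exact: lt_trans su.
  - apply: derivable_within_continuous => u; rewrite in_itv /= => /andP[su _].
    by have [] := dD u (lt_le_trans s0 su).
  by rewrite mul0r => /eqP; rewrite subr_eq0 => /eqP.
have muK1 : fine (mu K) = 1.
  have h := measureU mu mK (measurableC mK) (setICr K).
  have h2 := etrans h (etrans (congr1 (fun y => mu K + y)%E muK) (adde0 _)).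
  by rewrite setUCr in h2; rewrite -(congr1 fine h2) (congr1 fine muT).
have phioo : phi t - ln t @[t --> +oo] --> 0.
  have h0 : r ^+ 2 * t^-1 @[t --> +oo] --> (0 : R).
    rewrite -[X in _ --> X](mulr0 (r ^+ 2)); apply: cvgMr.
    apply/cvgrPdist_lt => e e0; near=> u.
    have u0 : 0 < u by near: u; exact: nbhs_pinfty_gt.
    rewrite sub0r normrN gtr0_norm ?invr_gt0// invf_plt ?posrE//.
    by near: u; apply: nbhs_pinfty_gt; exact: num_real.
  apply: (squeeze_cvgr _ (cvg_cst 0) h0); near=> t.
  have t0 : 0 < t by near: t; exact: nbhs_pinfty_gt.
  have -> : phi t - ln t = \int[mu]_(u in K) (f t u - ln t).
    rewrite RintegralB//; [|exact: fi|].
      rewrite Rintegral_cst//.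
      by rewrite muK1 mulr1.
    apply: measurable_bounded_integrable => //.
      by rewrite ltey_eq (fin_measure muT).
    by exists `|ln t|; split; [exact: num_real|move=> z /ltW dz u _].
  have t1 u : K u -> 0 <= f t u - ln t <= r ^+ 2 * t^-1.
    rewrite /K /= in_itv /= => /andP[u0 ur]; rewrite /f subr_ge0 ler_ln ?posrE ?p//.
    rewrite lerDr sqr_ge0 /= -ln_div ?posrE ?p//.
    have -> : (u ^+ 2 + t) / t = 1 + u ^+ 2 * t^-1 by field; exact: lt0r_neq0.
    have q0 : 0 <= u ^+ 2 * t^-1 by rewrite mulr_ge0 ?sqr_ge0// invr_ge0 ltW.
    apply: (le_trans (le_ln1Dx _)); first by rewrite (lt_le_trans _ q0)// oppr_lt0.
    by rewrite ler_wpM2r ?invr_ge0 ?(ltW t0)// ler_sqr// nnegrE.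
  have ic (c : R) : mu.-integrable K (EFin \o (cst c : TR -> R)).
    apply: measurable_bounded_integrable => //.
      by rewrite ltey_eq (fin_measure muT).
    by exists `|c|; split; [exact: num_real|move=> z /ltW dz u _].
  have id' : mu.-integrable K (EFin \o (fun u => f t u - ln t)).
    exact: (integrableB mK (fi t t0) (ic (ln t))).
  apply/andP; split.
    rewrite -[leLHS](_ : \int[mu]_(u in K) cst 0 u = 0); last by rewrite Rintegral_cst// mul0r.
    by apply: le_Rintegral => // u /t1/andP[].
  apply: (@le_trans _ _ (\int[mu]_(u in K) cst (r ^+ 2 * t^-1) u)).
    by apply: le_Rintegral => // u /t1/andP[].
  by rewrite Rintegral_cst// muK1 mulr1.
have zero (s : R) : 0 < s -> phi s = Phi s.
  move=> s0; apply/eqP; rewrite -subr_eq0; apply/eqP.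
  have l1 : (phi t - ln t) - (Phi t - ln t) @[t --> +oo] --> (0 : R).
    by rewrite -[X in _ --> X](subrr 0); exact: cvgB.
  have l2 : (phi t - ln t) - (Phi t - ln t) @[t --> +oo] --> phi s - Phi s.
    apply: cvg_near_cst; near=> t.
    rewrite opprB addrA subrK; apply: cstD => //.
    by near: t; apply: nbhs_pinfty_gt; exact: num_real.
  exact: (cvg_unique _ l2 l1).
have : Phi (harmonic n) @[n --> \oo] --> l by exact: (cvg_comp _ _ harmonic_cvg_right Phi0).
apply: cvg_trans; apply: near_eq_cvg; near=> n.
by rewrite phiE ?zero//; exact: harmonic_gt0.
Unshelve. all: by end_near.
Qed.

End Determinant.

(** * Two free symmetries *)

Section FreeSymmetries.
Context {R : realType} {M : vonNeumannAlgebra R} {tau : M -> R[i]}.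
Hypothesis htau : faithful_normal_tracial_state tau.
Implicit Types (y a b : M) (z c : R[i]).

Fixpoint alternating (u v : M) (n : nat) : M :=
  if n is k.+1 then u * alternating v u k else 1.

(** Two symmetries all of whose alternating products have trace zero: the
consequence of freeness from which every trace below is computed. *)
Definition free_symmetries (u v : M) :=
  [/\ hermitian_elt u /\ hermitian_elt v, u * u = 1 /\ v * v = 1,
      forall n, tau (alternating u v n.+1) = 0 & forall n, tau (alternating v u n.+1) = 0].

Lemma alternating_double u v n : alternating u v n.*2 = (u * v) ^+ n.
Proof. by elim: n => [|n ih]; rewrite ?expr0// doubleS /= ih mulrA exprS. Qed.

Lemma alternating_doubleS u v n : alternating u v n.*2.+1 = u * (v * u) ^+ n.
Proof. by rewrite /= alternating_double. Qed.

(** The algebra generated by a non-scalar affine function of [u] contains [u]. *)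
Lemma in_star_alg_affine (p u : M) (c d : R[i]) : p = c%:A + d *: u -> d != 0 -> in_star_alg p u.
Proof.
move=> pE d0.
have h0 : in_star_alg p 0.
  have -> : 0 = (-1) *: 1 + 1 :> M by rewrite scaleN1r addNr.
  apply: in_star_alg_comb; exact: in_star_alg_one.
have -> : u = d^-1 *: p + ((- (d^-1 * c)) *: 1 + 0).
  rewrite pE scalerDr !scalerA mulVf// scale1r scaleNr addr0 addrAC.
  by rewrite subrr add0r.
apply: in_star_alg_comb; first exact: in_star_alg_gen.
by apply: in_star_alg_comb => //; exact: in_star_alg_one.
Qed.

(** The letters [u] and [v] have trace zero, so every alternating product of them is
a word to which free independence applies. *)
Lemma freely_independent_symmetries (p q u v : M) (c c' d d' : R[i]) :
  freely_independent tau p q -> p = c%:A + d *: u -> q = c'%:A + d' *: v ->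
  d != 0 -> d' != 0 -> hermitian_elt u -> hermitian_elt v -> u * u = 1 -> v * v = 1 ->
  tau u = 0 -> tau v = 0 -> free_symmetries u v.
Proof.
move=> free pE qE d0 d0' hu hv uu vv tu tv.
pose letter (s : bool) := if s then u else v.
pose fix word (s : bool) (n : nat) : seq (bool * M) :=
  if n is k.+1 then (s, letter s) :: word (~~ s) k else [::].
have sizew s n : size (word s n) = n by elim: n s => //= n ih s; rewrite ih.
have pathw s n : path (fun l m : bool * M => l.1 != m.1) (s, letter s) (word (~~ s) n).
  by elim: n s => //= n ih s; rewrite ih andbT /=; case: s.
have lettersw s n l : l \in word s n ->
    in_star_alg (if l.1 then p else q) l.2 /\ tau l.2 = 0.
  elim: n s => //= n ih s; rewrite inE => /orP[/eqP ->|]; last exact: ih.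
  by case: s => /=; split => //; [exact: (in_star_alg_affine pE)|exact: (in_star_alg_affine qE)].
have tw s n : tau (\prod_(l <- word s n.+1) l.2) = 0.
  apply: free; [by rewrite sizew|exact: pathw|].
  by move=> l; apply: lettersw.
have prodw s n : \prod_(l <- word s n) l.2 = alternating (letter s) (letter (~~ s)) n.
  elim: n s => [|n ih] s /=; first by rewrite big_nil.
  by rewrite big_cons ih negbK.
by split => // n; [have := tw true n|have := tw false n]; rewrite prodw.
Qed.

Section Traces.
Context (u v : M).
Hypothesis huv : free_symmetries u v.

Let uu : u * u = 1. Proof. by case: huv => _ []. Qed.
Let vv : v * v = 1. Proof. by case: huv => _ []. Qed.
Let hu : star u = u. Proof. by case: huv => [[]]. Qed.
Let hv : star v = v. Proof. by case: huv => [[]]. Qed.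

Lemma trace_alternating n : tau (alternating u v n.+1) = 0.
Proof. by case: huv. Qed.

Lemma trace_alternating' n : tau (alternating v u n.+1) = 0.
Proof. by case: huv. Qed.

Lemma trace_u : tau u = 0.
Proof. by have := trace_alternating 0; rewrite /= mulr1. Qed.

Lemma trace_v : tau v = 0.
Proof. by have := trace_alternating' 0; rewrite /= mulr1. Qed.

Definition half_sum : M := (2^-1 : R)%:C *: (u * v + v * u).
Local Notation h := half_sum.

Lemma half_sum_hermitian : star h = h.
Proof. by rewrite /h starZ conjc_real starD !starM hu hv addrC. Qed.

Lemma half_sum_commute_u : u * h = h * u.
Proof.
rewrite /h -scalerAr -scalerAl; congr (_ *: _).
by rewrite mulrDr mulrDl !mulrA uu mul1r -[v * u * u]mulrA uu mulr1 addrC.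
Qed.

Lemma half_sum_commute_v : v * h = h * v.
Proof.
rewrite /h -scalerAr -scalerAl; congr (_ *: _).
by rewrite mulrDr mulrDl !mulrA vv mul1r -[u * v * v]mulrA vv mulr1 addrC.
Qed.

(** The case of interest: [y] is 1, [u] or [v], and [U] is [u v] or [v u]. *)
Definition neutral_for (U y : M) := forall n, tau (y * U ^+ n.+1) = 0.

(** Expanding [V] as the series of the [c^n U^n] to a finite order leaves a remainder of
size [c^n]; the terms of positive degree have trace zero. *)
Lemma trace_neumann (U y V : M) c : opbound U 1 -> cabs c < 1 -> V = 1 + c *: (U * V) ->
  neutral_for U y -> tau (y * V) = tau y.
Proof.
move=> U1 c1 VE hy; have [k k0 yk] := opbound_ex y; have [l l0 Vl] := opbound_ex V.
have Ub n : opbound (U ^+ n) 1.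
  elim: n => [|n ih]; first by rewrite expr0; exact: opbound1.
  by rewrite exprS -[X in opbound _ X]mulr1; apply: opboundM.
have expand n : tau (y * V) = tau y + c ^+ n.+1 * tau (y * (U ^+ n.+1 * V)).
  elim: n => [|n ->].
    by rewrite {1}VE mulrDr mulr1 (tauD htau) -scalerAr (tauZ htau) !expr1.
  rewrite {1}VE mulrDr mulr1 mulrDr (tauD htau) hy add0r -!scalerAr (tauZ htau).
  by rewrite (exprSr c n.+1) (exprSr U n.+1) !mulrA.
apply/eqP; rewrite -subr_eq0 -cabs_eq0; apply/eqP/le_anti; rewrite cabs_ge0 andbT.
have bound n : cabs (tau (y * V) - tau y) <= cabs c ^+ n * (2 * (k * l)).
  rewrite (expand n) addrAC subrr add0r cabsM.
  have b : opbound (y * (U ^+ n.+1 * V)) (k * l).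
    apply: opboundM => //; first exact: ltW.
    by rewrite -[X in opbound _ X]mul1r; apply: opboundM.
  have kl : 0 <= k * l by rewrite mulr_ge0// ltW.
  apply: ler_pM; rewrite ?cabs_ge0//; last exact: cabs_tau_le.
  have -> : cabs (c ^+ n.+1) = cabs c ^+ n.+1.
    by elim: (n.+1) => [|m ih]; rewrite ?expr0 ?cabs1// !exprS cabsM ih.
  by rewrite exprS ler_piMl ?exprn_ge0 ?cabs_ge0// ltW.
have lim : cabs c ^+ n * (2 * (k * l)) @[n --> \oo] --> (0 : R).
  rewrite -[X in _ --> X](mul0r (2 * (k * l))); apply: cvgMl; apply: cvg_expr.
  by rewrite ger0_norm ?cabs_ge0.
rewrite -(cvg_lim _ lim)//; apply: limr_ge; first by apply/cvg_ex; exists 0.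
by near=> n; exact: bound.
Unshelve. all: by end_near.
Qed.

Lemma unitary_opbound (U : M) : star U * U = 1 -> opbound U 1.
Proof.
move=> UU x; rewrite mul1r -ler_sqr ?nnegrE ?hnorm_ge0//.
by rewrite [leLHS]hnorm_sqr ip_rep -vn_repM UU vn_rep1 ipee.
Qed.

Lemma neutral_uv1 : neutral_for (u * v) 1.
Proof. by move=> n; rewrite mul1r -alternating_double doubleS trace_alternating. Qed.

Lemma neutral_vu1 : neutral_for (v * u) 1.
Proof. by move=> n; rewrite mul1r -alternating_double doubleS trace_alternating'. Qed.

Lemma neutral_uvu : neutral_for (u * v) u.
Proof.
move=> n; rewrite exprS !mulrA uu mul1r.
by have := alternating_doubleS v u n; move=> <-; exact: trace_alternating'.
Qed.

Lemma neutral_uvv : neutral_for (u * v) v.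
Proof. by move=> n; rewrite -alternating_doubleS trace_alternating'. Qed.

Lemma neutral_vuu : neutral_for (v * u) u.
Proof. by move=> n; rewrite -alternating_doubleS trace_alternating. Qed.

Lemma neutral_vuv : neutral_for (v * u) v.
Proof.
move=> n; rewrite exprS !mulrA vv mul1r.
by have := alternating_doubleS u v n; move=> <-; exact: trace_alternating.
Qed.

Lemma inverse_commute (b r y : M) : r * b = 1 -> b * r = 1 -> y * b = b * y -> y * r = r * y.
Proof.
move=> rb br yb.
by rewrite -[LHS]mul1r -rb -mulrA (mulrA b) -yb -(mulrA y) br mulr1.
Qed.

(** The resolvent of [h = (u v + v u) / 2]. With [z = (n + n^-1) / 2], the element
[2 n (z - h)] factors as [(1 - n u v) (1 - n v u)], and the trace of the inverse
is read off from the two Neumann series: [h] has the arcsine distribution. *)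
Lemma half_sum_resolvent z : cabs (joukowski_inv z) < 1 ->
  exists r, [/\ r * (z%:A - h) = 1, (z%:A - h) * r = 1 &
    [/\ u * r = r * u, v * r = r * v, tau r = arcsine_cauchy z,
        tau (u * r) = 0 & tau (v * r) = 0]].
Proof.
set n := joukowski_inv z => n1.
have n0 : n != 0 := joukowski_inv_neq0 z.
have UU' : (u * v) * (v * u) = 1 by rewrite mulrA -[u * v * v]mulrA vv mulr1.
have U'U : (v * u) * (u * v) = 1 by rewrite mulrA -[v * u * u]mulrA uu mulr1.
have b1 : opbound (u * v) 1 by apply: unitary_opbound; rewrite starM hu hv.
have b2 : opbound (v * u) 1 by apply: unitary_opbound; rewrite starM hu hv.
have [V [V1 V2 Vc]] := neumann b1 n1; have [W [W1 W2 Wc]] := neumann b2 n1.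
have VA : V * (1 - n *: (u * v)) = 1 by rewrite mulrBr mulr1 -scalerAr {1}V2 addrK.
have AV : (1 - n *: (u * v)) * V = 1 by rewrite mulrBl mul1r -scalerAl {1}V1 addrK.
have WB : W * (1 - n *: (v * u)) = 1 by rewrite mulrBr mulr1 -scalerAr {1}W2 addrK.
have BW : (1 - n *: (v * u)) * W = 1 by rewrite mulrBl mul1r -scalerAl {1}W1 addrK.
have AB : (1 - n *: (u * v)) * (1 - n *: (v * u)) = (2 * n) *: (z%:A - h).
  rewrite mulrBl mul1r mulrBr mulr1 -scalerAl -scalerAr UU'.
  have -> : (2 * n) *: (z%:A - h) = (1 + n * n)%:A - n *: (u * v + v * u).
    rewrite scalerBr scalerA.
    have -> : 2 * n * z = 1 + n * n.
      have e := joukowski_invP z; rewrite -/n in e.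
      have -> : 2 * n * z = n * (2 * z - n) + n * n by ring.
      by rewrite e.
    rewrite /h scalerA; congr (_ - _ *: _).
    by rewrite mulrAC -(rmorph_nat (real_complex R) 2) -rmorphM /= divff ?mul1r// pnatr_eq0.
  rewrite scalerDl scale1r scalerDr !scalerA (opprB (n *: _)) addrACA.
  by rewrite -(opprD (n *: (v * u))) [X in _ - X]addrC.
have d0 : 2 * n != 0 by rewrite mulf_neq0// pnatr_eq0.
have nn : 1 - n ^+ 2 != 0 := joukowski_sqr_neq1 n1.
pose r := (2 * n) *: (W * V).
have rz : r * (z%:A - h) = 1.
  rewrite /r -scalerAl scalerAr -AB mulrA -[W * V * _]mulrA VA mulr1 WB//.
have zr : (z%:A - h) * r = 1.
  rewrite /r -scalerAr scalerAl -AB mulrA -[_ * _ * W]mulrA BW mulr1 AV//.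
have comm y : y * h = h * y -> y * r = r * y.
  move=> yh.
  have e : y * (z%:A - h) = (z%:A - h) * y.
    by rewrite mulrBr mulrBl yh mulr_algl mulr_algr.
  exact: inverse_commute e.
have sum : (1 - n ^+ 2) *: (W * V) = V + W - 1.
  have wE : W - 1 = n *: (W * (v * u)) by rewrite {1}W2 addrC addKr.
  have vE : V - 1 = n *: (u * v * V) by rewrite {1}V1 addrC addKr.
  have : (W - 1) * (V - 1) = (n ^+ 2) *: (W * V).
    rewrite wE vE -scalerAl -scalerAr scalerA -expr2; congr (_ *: _).
    by rewrite -(mulrA W) (mulrA (v * u)) U'U mul1r.
  rewrite scalerBl scale1r => <-; rewrite mulrBl mul1r mulrBr mulr1.
  by rewrite (opprB (W * V - W)) (opprB (W * V)) addrCA [X in _ + X]addrC subrK addrAC.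
have trr y : neutral_for (u * v) y -> neutral_for (v * u) y ->
    tau (y * r) = arcsine_cauchy z * tau y.
  move=> y1 y2.
  have : (1 - n ^+ 2) * tau (y * (W * V)) = tau y.
    rewrite -(tauZ htau) scalerAr sum mulrDr mulrDr mulrN mulr1 !(tauD htau) (tauN htau).
    by rewrite (trace_neumann b1 n1 V1 y1) (trace_neumann b2 n1 W1 y2) addrK.
  move=> e; rewrite /r -scalerAr (tauZ htau) -e /arcsine_cauchy -/n.
  by field.
exists r; split => //; split.
- exact: comm half_sum_commute_u.
- exact: comm half_sum_commute_v.
- by have := trr 1 neutral_uv1 neutral_vu1; rewrite mul1r (tau1 htau) mulr1.
- by rewrite (trr u neutral_uvu neutral_vuu) trace_u mulr0.
- by rewrite (trr v neutral_uvv neutral_vuv) trace_v mulr0.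
Qed.

End Traces.
End FreeSymmetries.

(** * The resolvent of [x^* x] *)

(* decides equalities of sums up to associativity and commutativity *)
Ltac sum_AC :=
  rewrite -?addrA;
  repeat match goal with
  | |- ?a + _ = _ =>
      first [ refine (f_equal (fun y => a + y) _)
            | rewrite ![in RHS](addrCA _ a); refine (f_equal (fun y => a + y) _)
            | rewrite [in RHS](addrC _ a) -?[in RHS]addrA ?[in RHS](addrCA _ a);
              refine (f_equal (fun y => a + y) _) ]
  end; try done.

Section Factorization.
Context {R : realType} {M : vonNeumannAlgebra R} {tau : M -> R[i]}.
Hypothesis htau : faithful_normal_tracial_state tau.
Context (u v : M).
Hypothesis huv : free_symmetries (tau := tau) u v.
Implicit Types (y : M) (z w c : R[i]).
Local Notation h := (half_sum u v).

Let uu : u * u = 1. Proof. by case: huv => _ []. Qed.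
Let vv : v * v = 1. Proof. by case: huv => _ []. Qed.
Let hu : star u = u. Proof. by case: huv => [[]]. Qed.
Let hv : star v = v. Proof. by case: huv => [[]]. Qed.

(** [y] commutes with everything generated by [u] and [v]. *)
Definition central y := u * y = y * u /\ v * y = y * v.

Lemma centralD y y' : central y -> central y' -> central (y + y').
Proof. by move=> [h1 h2] [h3 h4]; split; rewrite mulrDl mulrDr ?h1 ?h2 ?h3 ?h4. Qed.

Lemma centralM y y' : central y -> central y' -> central (y * y').
Proof.
by move=> [h1 h2] [h3 h4]; split; rewrite mulrA ?h1 ?h2 -mulrA ?h3 ?h4 mulrA.
Qed.

Lemma centralZ c y : central y -> central (c *: y).
Proof. by move=> [h1 h2]; split; rewrite -scalerAr -scalerAl ?h1 ?h2. Qed.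

Lemma central_scalar c : central c%:A.
Proof. by split; rewrite mulr_algl mulr_algr. Qed.

Lemma centralN y : central y -> central (- y).
Proof. by rewrite -scaleN1r; exact: centralZ. Qed.

Lemma central_h : central h.
Proof. by split; [exact: half_sum_commute_u huv|exact: half_sum_commute_v huv]. Qed.

Lemma central_star y : central y -> central (star y).
Proof. by move=> [h1 h2]; split; [rewrite -{1}hu -starM -h1 starM hu|rewrite -{1}hv -starM -h2 starM hv]. Qed.

Definition affine (c0 c1 c2 : R[i]) : M := c0%:A + c1 *: u + c2 *: v.

Lemma central_affine y c0 c1 c2 : central y -> affine c0 c1 c2 * y = y * affine c0 c1 c2.
Proof.
move=> [h1 h2]; rewrite /affine !mulrDl !mulrDr mulr_algl mulr_algr.
by rewrite -!scalerAl -!scalerAr h1 h2.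
Qed.

Lemma star_affine c0 c1 c2 : star (affine c0 c1 c2) = affine (conjc c0) (conjc c1) (conjc c2).
Proof. by rewrite /affine !starD star_scalar !starZ hu hv. Qed.

(** Since [u^2 = v^2 = 1], the product of two affine elements leaves only two
quadratic terms. *)
Lemma affineM c0 c1 c2 d0 d1 d2 : affine c0 c1 c2 * affine d0 d1 d2 =
  affine (c0 * d0 + c1 * d1 + c2 * d2) (c0 * d1 + c1 * d0) (c0 * d2 + c2 * d0) +
  ((c1 * d2) *: (u * v) + (c2 * d1) *: (v * u)).
Proof.
rewrite /affine !mulrDl !mulrDr !mulr_algl -!scalerAl -!scalerAr !mulr1 uu vv !scalerA.
by rewrite !scalerDl; move: (u * v) (v * u) => p q; sum_AC.
Qed.

Lemma quadE c c' : (c%:A - h) * (c'%:A - h) = (c * c')%:A - (c + c') *: h + h * h.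
Proof.
rewrite mulrBr !mulrBl !mulr_algl mulr_algr scalerA scalerDl.
by rewrite (opprB (c *: h)) (opprD (c *: h)); sum_AC.
Qed.

(** The inverse of [(z - h) (z^* - h)] and the traces it enters, from the resolvent
identity. *)
Lemma half_sum_square_resolvent z : cabs (joukowski_inv z) < 1 -> complex.Im z != 0 ->
  exists N, [/\ N * ((z%:A - h) * ((conjc z)%:A - h)) = 1, central N,
    tau N = (arcsine_square z)%:C /\ tau (u * N) = 0 /\ tau (v * N) = 0 &
    tau (((complex.Re z)%:C%:A - h) * N) = (complex.Re (arcsine_cauchy z))%:C /\
    tau (u * (((complex.Re z)%:C%:A - h) * N)) = 0 /\
    tau (v * (((complex.Re z)%:C%:A - h) * N)) = 0].
Proof.
move=> n1 iz; have [r [rz zr [ru rv tr tur tvr]]] := half_sum_resolvent htau huv n1.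
have hz : star (z%:A - h) = (conjc z)%:A - h.
  by rewrite starB star_scalar (half_sum_hermitian huv).
have rsz : star r * ((conjc z)%:A - h) = 1 by rewrite -hz -starM zr star1.
have zrs : ((conjc z)%:A - h) * star r = 1 by rewrite -hz -starM rz star1.
have cr : central r by split.
have crs := central_star cr.
have trs y (hy : star y = y) : tau (y * star r) = conjc (tau (y * r)).
  by rewrite -(tau_star htau) starM hy (tau_mulC htau).
have czh c : central (c%:A - h).
  by apply: centralD; [exact: central_scalar|apply: centralN; exact: central_h].
pose N := r * star r.
have hr : h * r = r * h.
  by apply: (inverse_commute rz zr); rewrite mulrBr mulrBl mulr_algl mulr_algr.
have diff : star r - r = (z - conjc z) *: N.
  have -> : (z - conjc z) *: N = r * ((z%:A - h) - ((conjc z)%:A - h)) * star r.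
    rewrite opprB addrA subrK -scalerBl -scalerAr mulr1 -scalerAl//.
  by rewrite mulrBr mulrBl rz mul1r -mulrA zrs mulr1.
have zN : (z%:A - h) * N = star r by rewrite /N mulrA zr mul1r.
have zz : z - conjc z = (2 * complex.Im z)%:C * 'i%C.
  by apply: complex_ext; case: z {n1 iz r rz zr ru rv tr tur tvr hz rsz zrs cr crs trs N hr diff zN} => p q; rewrite /= ?ReM ?ImM ?ReD ?ImD /=; ring.
have zz0 : z - conjc z != 0.
  rewrite zz mulf_neq0//.
    by rewrite eq_complex /= eqxx andbT mulf_neq0// pnatr_eq0.
  by rewrite eq_complex /= oner_eq0 andbF.
have NE : N = (z - conjc z)^-1 *: (star r - r) by rewrite diff scalerA mulVf// scale1r.
have RzN : ((complex.Re z)%:C%:A - h) * N = star r - ((complex.Im z)%:C * 'i%C) *: N.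
  rewrite -zN !mulrBl !mulr_algl addrAC; congr (_ - _).
  by rewrite -scalerBl; congr (_ *: _); apply: complex_ext; case: z {n1 iz r rz zr ru rv tr tur tvr hz rsz zrs cr crs trs N hr diff zN zz zz0 NE} => p q; rewrite /= ?ReM ?ImM ?ReD ?ImD ?ReN ?ImN ?ReM ?ImM /=; ring.
have tN : tau N = (arcsine_square z)%:C.
  have e := arcsine_squareE n1.
  rewrite NE (tauZ htau) (tauB htau) tr.
  have -> : tau (star r) = conjc (arcsine_cauchy z).
    by rewrite (tau_star htau) tr.
  apply: (mulfI zz0); rewrite mulrA divff// mul1r zz.
  move: e; case: (arcsine_cauchy z) => p q /= e.
  by apply: complex_ext; rewrite /= ?ReM ?ImM ?ReM ?ImM ?ReD ?ImD /=; [ring|rewrite -mulrA mulrDl; nra].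
have tyN y : star y = y -> tau (y * r) = 0 -> tau (y * N) = 0.
  move=> hy ty; rewrite NE -scalerAr (tauZ htau) mulrBr (tauB htau) (trs y hy) ty conjc0.
  by rewrite subrr mulr0.
have tuN := tyN u hu tur; have tvN := tyN v hv tvr.
exists N; split => //.
- have [c1 c2] := czh z; have [c3 c4] := crs.
  have e : star r * (z%:A - h) = (z%:A - h) * star r.
    apply/esym; apply: (inverse_commute rsz zrs).
    by rewrite !quadE (mulrC z) (addrC z).
  by rewrite /N -mulrA (mulrA (star r)) e -(mulrA (z%:A - h)) rsz mulr1.
- by apply: centralM.
- rewrite RzN; split.
    rewrite (tauB htau) (tauZ htau) tN (tau_star htau) tr.
    have e := arcsine_squareE n1; move: e; case: (arcsine_cauchy z) => p q /= e.
    by apply: complex_ext; rewrite /= ?ReD ?ImD ?ReN ?ImN ?ReM ?ImM /= ?ReM ?ImM /=; [ring|nra].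
  by split; rewrite mulrBr (tauB htau) -scalerAr (tauZ htau) ?tuN ?tvN trs// ?tur ?tvr conjc0 mulr0 subrr.
Qed.

End Factorization.

Section Resolvent.
Context {R : realType} {M : vonNeumannAlgebra R} {tau : M -> R[i]}.
Hypothesis htau : faithful_normal_tracial_state tau.
Context (u v : M) (a b : R) (w : R[i]).
Hypotheses (huv : free_symmetries (tau := tau) u v) (a0 : a != 0) (b0 : b != 0).
Local Notation h := (half_sum u v).
Local Notation A := (a%:C).
Local Notation B := (0 +i* b).

(** For [x = w - (a u + i b v)] the product [x (w + (a u + i b v))] equals
[2 i a b (kappa - h)]. *)
Definition kappa : R[i] := (w ^+ 2 - (a ^+ 2 - b ^+ 2)%:C) / (0 +i* (2 * a * b)).

(** Half of the scalar [x^* x + cofactor cofactor^*], see [sumE] below. *)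
Definition scale2 : R := cabs w ^+ 2 + a ^+ 2 + b ^+ 2.

(** The point with the real part of [kappa] such that
[x^* x + e] and its cofactor multiply to [4 a^2 b^2 (zeta - h) (zeta^* - h)]. *)
Definition zeta (e : R) : R[i] := complex.Re kappa +i*
  Num.sqrt (complex.Im kappa ^+ 2 + (2 * scale2 * e + e ^+ 2) / (4 * a ^+ 2 * b ^+ 2)).

(** The operator [w - (a u + i b v)], that is [z - X] with [w] the position of [z]
relative to the centre [tau X]. *)
Definition model : M := affine u v w (- A) (- B).

(** The product [x * cofactor] is central, so the inverse of [x^* x + e] is a product
of a central inverse with the quadratic element [cofactor * cofactor^* + e]. *)
Let cofactor : M := affine u v w A B.

Let hu : star u = u. Proof. by case: huv => [[]]. Qed.
Let hv : star v = v. Proof. by case: huv => [[]]. Qed.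

Let k2 : R[i] := 0 +i* (2 * a * b).
Let k20 : k2 != 0.
Proof. by rewrite eq_complex /= eqxx /= !mulf_neq0// pnatr_eq0. Qed.
Let conjk2 : conjc k2 = - k2. Proof. by apply: complex_ext; rewrite /= ?oppr0. Qed.
Let AB : 2 * A * B = k2.
Proof. by apply: complex_ext; rewrite mulr_natl mulr2n ?ReM ?ImM ?ReD ?ImD /=; ring. Qed.
Let BB : B * B = - (b ^+ 2)%:C.
Proof. by apply: complex_ext; rewrite ?ReM ?ImM /=; ring. Qed.
Let conjA : conjc A = A. Proof. exact: conjc_real. Qed.
Let conjB : conjc B = - B. Proof. by apply: complex_ext; rewrite /= ?oppr0. Qed.
Let conjNA : conjc (- A) = - A. Proof. by apply: complex_ext; rewrite /= ?oppr0. Qed.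
Let conjNB : conjc (- B) = B. Proof. by apply: complex_ext; rewrite /= ?oppr0 ?opprK. Qed.
Let ww : w * conjc w = (cabs w ^+ 2)%:C.
Proof. by rewrite cabs_sqr; case: w => p q; apply: complex_ext; rewrite ?ReM ?ImM /=; ring. Qed.

Let d : M := k2 *: (kappa%:A - h).

Let dE : d = (w ^+ 2 - (a ^+ 2 - b ^+ 2)%:C)%:A - (A * B) *: (u * v + v * u).
Proof.
rewrite /d scalerBr scalerA mulrC /kappa divfK// /half_sum scalerA; congr (_ - _ *: _).
by rewrite -AB; apply: complex_ext; rewrite mulr_natl mulr2n ?(ReM, ImM, ReD, ImD) /=; field.
Qed.

Let model_cofactor : model * cofactor = d.
Proof.
rewrite /model /cofactor (affineM huv) dE /affine.
have -> : w * w + - A * A + - B * B = w ^+ 2 - (a ^+ 2 - b ^+ 2)%:C.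
  by rewrite mulNr mulNr BB rmorphB rmorphXn /= rmorphXn /=; ring.
have -> : w * A + - A * w = 0 by ring.
have -> : w * B + - B * w = 0 by ring.
by rewrite !scale0r !addr0 mulNr mulNr (mulrC B) -scalerDr scaleNr.
Qed.

Let cofactor_model : cofactor * model = d.
Proof.
rewrite /model /cofactor (affineM huv) dE /affine.
have -> : w * w + A * - A + B * - B = w ^+ 2 - (a ^+ 2 - b ^+ 2)%:C.
  by rewrite mulrN mulrN BB rmorphB rmorphXn /= rmorphXn /=; ring.
have -> : w * - A + A * w = 0 by ring.
have -> : w * - B + B * w = 0 by ring.
by rewrite !scale0r !addr0 mulrN mulrN (mulrC B) -scalerDr scaleNr.
Qed.

Let sumE : star model * model + cofactor * star cofactor = (2 * scale2)%:C%:A.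
Proof.
rewrite /model /cofactor !(star_affine huv) conjNA conjNB conjA conjB !(affineM huv) /affine.
have add4 (p1 p2 p3 q1 q2 q3 r s : M) :
    p1 + p2 + p3 + (r + s) + (q1 + q2 + q3 + (- r + - s)) = (p1 + q1) + ((p2 + q2) + (p3 + q3)).
  by rewrite addrACA -opprD subrr addr0; sum_AC.
have -> : A * - B = - (- A * - B) by ring.
have -> : B * A = - (B * - A) by ring.
rewrite !scaleNr add4 -!scalerDl.
have -> : conjc w * - A + - A * w + (w * A + A * conjc w) = 0 by ring.
have -> : conjc w * - B + B * w + (w * - B + B * conjc w) = 0 by ring.
rewrite !scale0r !addr0; congr (_ *: _).
rewrite !mulrN !mulNr !opprK BB (mulrC (conjc w)) ww /scale2.
by apply: complex_ext; rewrite ?(ReD, ImD, ReN, ImN, ReM, ImM) /=; ring.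
Qed.

Let k4 : R := 4 * a ^+ 2 * b ^+ 2.
Let k40 : 0 < k4.
Proof.
have a2 : 0 < a ^+ 2 by rewrite lt_def sqrf_eq0 a0 sqr_ge0.
have b2 : 0 < b ^+ 2 by rewrite lt_def sqrf_eq0 b0 sqr_ge0.
by apply: mulr_gt0 => //; apply: mulr_gt0.
Qed.

Let zeta_arg (e : R) := complex.Im kappa ^+ 2 + (2 * scale2 * e + e ^+ 2) / k4.

Lemma scale2_gt0 : 0 < scale2.
Proof. by rewrite /scale2 ltr_wpDl ?addr_ge0 ?sqr_ge0// lt_def sqrf_eq0 b0 sqr_ge0. Qed.

Lemma zeta_arg_gt0 e : 0 < e -> 0 < zeta_arg e.
Proof.
move=> e0; rewrite /zeta_arg ltr_wpDl ?sqr_ge0// divr_gt0// addr_gt0 ?exprn_gt0//.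
by rewrite !mulr_gt0// scale2_gt0.
Qed.

Lemma Im_zeta_gt0 e : 0 < e -> 0 < complex.Im (zeta e).
Proof. by move=> e0; rewrite sqrtr_gt0; exact: zeta_arg_gt0. Qed.

(** Strictly above the real axis [joukowski_inv] cannot have modulus 1, since the
image of the unit circle is [-1, 1]. *)
Lemma cabs_joukowski_zeta e : 0 < e -> cabs (joukowski_inv (zeta e)) < 1.
Proof.
move=> /Im_zeta_gt0 i0; rewrite lt_neqAle cabs_joukowski_inv_le1 andbT.
apply/eqP => c1; have := Im_joukowski (zeta e).
by rewrite c1 expr1n invr1 subrr mulr0 => /eqP; rewrite mulf_eq0 pnatr_eq0 (gt_eqF i0).
Qed.

Let product e : 0 <= e -> d * star d + (2 * scale2 * e + e ^+ 2)%:C%:A =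
  k4%:C *: (((zeta e)%:A - h) * ((conjc (zeta e))%:A - h)).
Proof.
move=> e0; have hh : star h = h := half_sum_hermitian huv.
rewrite /d starZ conjk2 starB star_scalar hh -scalerAl -scalerAr scalerA.
have -> : k2 * - k2 = k4%:C.
  by apply: complex_ext; rewrite ?(ReM, ImM) /= /k4; ring.
rewrite !quadE.
have -> : (2 * scale2 * e + e ^+ 2)%:C = k4%:C * ((2 * scale2 * e + e ^+ 2) / k4)%:C.
  by rewrite -rmorphM /= [k4 * _]mulrC divfK// lt0r_neq0.
rewrite -[(k4%:C * _)%:A]scalerA -scalerDr; congr (_ *: _).
have -> : zeta e + conjc (zeta e) = kappa + conjc kappa.
  by apply: complex_ext; rewrite /zeta; case: kappa => p q; rewrite ?(ReD, ImD) /=; ring.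
have -> : zeta e * conjc (zeta e) = kappa * conjc kappa + ((2 * scale2 * e + e ^+ 2) / k4)%:C.
  have s2 : Num.sqrt (zeta_arg e) * Num.sqrt (zeta_arg e) = zeta_arg e.
    rewrite -expr2 sqr_sqrtr// /zeta_arg addr_ge0 ?sqr_ge0// divr_ge0 ?(ltW k40)//.
    by rewrite addr_ge0 ?sqr_ge0// !mulr_ge0// ltW// scale2_gt0.
  apply: complex_ext; rewrite /zeta; move: s2; rewrite /zeta_arg /k4; case: kappa => p q /= s2.
    by rewrite ?(ReD, ReM) /= mulrN s2; ring.
  by rewrite ?(ImD, ImM) /=; ring.
by rewrite scalerDl; sum_AC.
Qed.

(** The resolvent of [x^* x], with the two traces that make up the quaternionic
Green's function. *)
Lemma model_resolvent e : 0 < e -> exists Q,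
  [/\ Q * (star model * model + e%:C%:A) = 1, (star model * model + e%:C%:A) * Q = 1,
      tau Q = ((scale2 + e) * arcsine_square (zeta e) / k4)%:C &
      tau (model * Q) = (conjc w * k2 * ((complex.Re (arcsine_cauchy (zeta e)))%:C +
        'i%C * (complex.Im kappa * arcsine_square (zeta e))%:C) +
        e%:C * w * (arcsine_square (zeta e))%:C) / k4%:C].
Proof.
move=> e0; have n1 := cabs_joukowski_zeta e0; have iz := lt0r_neq0 (Im_zeta_gt0 e0).
have [N [NP cN [tN [tuN tvN]] [tRN [tuRN tvRN]]]] := half_sum_square_resolvent htau huv n1 iz.
have cd : central u v d.
  apply: centralZ; apply: centralD; first exact: central_scalar.
  by apply: centralN; exact: (central_h huv).
have cds : central u v (star d) by exact: (central_star huv).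
have sm : star model = affine u v (conjc w) (- A) B.
  by rewrite /model (star_affine huv) conjNA conjNB.
have sc : star cofactor = affine u v (conjc w) A (- B).
  by rewrite /cofactor (star_affine huv) conjA conjB.
have ab1 : (star model * model) * (cofactor * star cofactor) = d * star d.
  rewrite -mulrA (mulrA model) model_cofactor mulrA sm (central_affine _ _ _ cd) -sm.
  by rewrite -mulrA -starM cofactor_model.
have ab2 : (cofactor * star cofactor) * (star model * model) = d * star d.
  rewrite -mulrA (mulrA (star cofactor)) -starM model_cofactor.
  by rewrite -(central_affine _ _ _ cds) mulrA cofactor_model.
set E1 := star model * model + e%:C%:A; set E2 := cofactor * star cofactor + e%:C%:A.
have shift (P1 P2 : M) (s : R[i]) : P1 + P2 = s%:A ->
    (P1 + e%:C%:A) * (P2 + e%:C%:A) = P1 * P2 + (e%:C * s + e%:C * e%:C)%:A.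
  move=> ps; rewrite mulrDr !mulrDl !mulr_algl mulr_algr scalerA scalerDl -(scalerA _ s) -ps scalerDr.
  by sum_AC.
have eE : e%:C * (2 * scale2)%:C + e%:C * e%:C = (2 * scale2 * e + e ^+ 2)%:C.
  by apply: complex_ext; rewrite ?(ReD, ImD, ReM, ImM) /=; ring.
have E12 : E1 * E2 = k4%:C *: (((zeta e)%:A - h) * ((conjc (zeta e))%:A - h)).
  by rewrite /E1 /E2 (shift _ _ _ sumE) ab1 eE product// ltW.
have E21 : E2 * E1 = k4%:C *: (((zeta e)%:A - h) * ((conjc (zeta e))%:A - h)).
  by rewrite /E1 /E2 (shift _ _ (2 * scale2)%:C) ?ab2 ?eE ?product ?(ltW e0)// addrC.
have k4C : k4%:C != 0 by rewrite eq_complex /= eqxx andbT lt0r_neq0.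
pose Q := k4%:C^-1 *: (N * E2).
have NE1 : E1 * N = N * E1.
  rewrite /E1 (mulrDl (star model * model)) (mulrDr N) mulr_algl mulr_algr; congr (_ + _).
  by rewrite -mulrA (central_affine _ _ _ cN) mulrA sm (central_affine _ _ _ cN) mulrA.
have tauaff y c0 c1 c2 : tau (u * y) = 0 -> tau (v * y) = 0 ->
    tau (affine u v c0 c1 c2 * y) = c0 * tau y.
  move=> uy vy; rewrite /affine !mulrDl mulr_algl -!scalerAl !(tauD htau) !(tauZ htau) uy vy.
  by rewrite !mulr0 !addr0.
have Nd : N * d = d * N.
  have [e1 e2] := cN.
  have hN : N * h = h * N.
    rewrite /half_sum -scalerAr -scalerAl mulrDr mulrDl; congr (_ *: (_ + _)).
      by rewrite mulrA -e1 -mulrA -e2 mulrA.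
    by rewrite mulrA -e2 -mulrA -e1 mulrA.
  by rewrite /d -scalerAr -scalerAl mulrBr mulrBl mulr_algl mulr_algr hN.
exists Q; split.
- by rewrite /Q -scalerAl -mulrA E21 -scalerAr NP scalerA mulVf// scale1r.
- by rewrite /Q -scalerAr mulrA NE1 -mulrA E12 -scalerAr NP scalerA mulVf// scale1r.
- have tNE2 : tau (N * E2) = (scale2 + e)%:C * tau N.
    have -> : (scale2 + e)%:C = scale2%:C + e%:C by exact: rmorphD.
    rewrite /E2 (mulrDr N) (tauD htau) mulr_algr (tauZ htau) (mulrDl scale2%:C); congr (_ + _).
    rewrite sc /cofactor (affineM huv) mulrDr (tauD htau) -(central_affine _ _ _ cN) tauaff//.
    rewrite mulrDr (tauD htau) -!scalerAr !(tauZ htau).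
    have -> : tau (N * (u * v)) = tau (N * (v * u)).
      have [c1 c2] := cN.
      by rewrite mulrA -c1 (tau_mulC htau) mulrA (tau_mulC htau).
    rewrite !mulrN BB ww; have -> : - (A * B) * tau (N * (v * u)) + B * A * tau (N * (v * u)) = 0 by ring.
    rewrite addr0 opprK; congr (_ * _); rewrite /scale2.
    by apply: complex_ext; rewrite ?(ReD, ImD, ReM, ImM) /=; ring.
  rewrite /Q (tauZ htau) tNE2 tN -fmorphV -!rmorphM /=.
  by congr (_%:C); rewrite mulrC.
- have XQ : model * Q = k4%:C^-1 *: (star cofactor * (d * N) + e%:C *: (model * N)).
    rewrite /Q -scalerAr; congr (_ *: _).
    rewrite /E2 (mulrDr N) mulr_algr (mulrDr model) -scalerAr; congr (_ + _).
    have mN : model * N = N * model by exact: central_affine.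
    rewrite (mulrA model) mN -(mulrA N) (mulrA model) model_cofactor.
    by rewrite sc -(central_affine _ _ _ cd) (mulrA N) -(central_affine _ _ _ cN) -mulrA Nd.
  have dN y : tau (y * (d * N)) = k2 * ('i%C * (complex.Im kappa)%:C * tau (y * N) +
      tau (y * (((complex.Re (zeta e))%:C%:A - h) * N))).
    have -> : d = k2 *: (('i%C * (complex.Im kappa)%:C)%:A + ((complex.Re (zeta e))%:C%:A - h)).
      rewrite /d addrA -scalerDl; congr (_ *: (_ *: _ - _)).
      by rewrite /zeta; case: kappa => p q; apply: complex_ext; rewrite ?(ReD, ImD, ReM, ImM) /=; ring.
    rewrite -scalerAl -scalerAr (tauZ htau) mulrDl mulr_algl mulrDr (tauD htau) -scalerAr.
    by rewrite (tauZ htau).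
  rewrite XQ (tauZ htau) (tauD htau) (tauZ htau) sc /model !tauaff//; last 2 first.
  + by rewrite dN tuN tuRN mulr0 addr0 mulr0.
  + by rewrite dN tvN tvRN mulr0 addr0 mulr0.
  rewrite -[d * N]mul1r dN !mul1r tN tRN mulrC; congr (_ / _).
  have -> : (complex.Im kappa * arcsine_square (zeta e))%:C =
            (complex.Im kappa)%:C * (arcsine_square (zeta e))%:C by exact: rmorphM.
  move: (arcsine_square _)%:C (complex.Re (arcsine_cauchy _))%:C (complex.Im kappa)%:C => T P K.
  ring.
Qed.

End Resolvent.

(** * The quaternionic Green's function *)

Section GreenMatrix.
Context {R : realType} {M : vonNeumannAlgebra R} {tau : M -> R[i]}.
Hypothesis htau : faithful_normal_tracial_state tau.
Context (X : M) (z : R[i]) (eps : R) (Q : M).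
Hypothesis eps0 : 0 < eps.
Let x : M := z%:A - X.
Let e : R[i] := (eps ^+ 2)%:C.
Hypotheses (Ql : Q * (star x * x + e%:A) = 1) (Qr : (star x * x + e%:A) * Q = 1).

Let e_neq0 : e != 0.
Proof. by rewrite /e eq_complex /= eqxx andbT expf_neq0// gt_eqF. Qed.

Let Q_hermitian : star Q = Q.
Proof.
have h : star (star x * x + e%:A) = star x * x + e%:A.
  by rewrite starD starM starK star_scalar conjc_real.
have h1 : star Q * (star x * x + e%:A) = 1.
  by rewrite -[X in _ * X = _]h -starM Qr star1.
by rewrite -[LHS]mulr1 -Qr mulrA h1 mul1r.
Qed.

Let Q2 : M := e^-1 *: (1 - x * Q * star x).

Let xxQ : star x * x * Q = 1 - e *: Q.
Proof. by apply/eqP; rewrite eq_sym subr_eq -Qr (mulrDl (star x * x)) mulr_algl. Qed.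

Let Qxx : Q * (star x * x) = 1 - e *: Q.
Proof. by apply/eqP; rewrite eq_sym subr_eq -Ql (mulrDr Q) mulr_algr. Qed.

Let eQ2 : e *: Q2 = 1 - x * Q * star x.
Proof. by rewrite /Q2 scalerA divff// scale1r. Qed.

Let sxQ2 : star x * Q2 = Q * star x.
Proof.
rewrite /Q2 -scalerAr (mulrBr (star x)) mulr1 !mulrA xxQ.
by rewrite mulrBl mul1r opprB addrCA subrr addr0 -scalerAl scalerA mulVf// scale1r.
Qed.

Let Q2x : Q2 * x = x * Q.
Proof.
rewrite /Q2 -scalerAl mulrBl mul1r -!mulrA Qxx.
by rewrite (mulrBr x) mulr1 opprB addrCA subrr addr0 -scalerAr scalerA mulVf// scale1r.
Qed.

Let tauQ2 : tau Q2 = tau Q.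
Proof.
rewrite /Q2 (tauZ htau) (tauB htau) (tau1 htau) (tau_mulC htau) mulrA xxQ.
rewrite (tauB htau) (tau1 htau) (tauZ htau) opprB addrCA subrr addr0.
by rewrite mulrA mulVf// mul1r.
Qed.

Let mx2 (a b c d : M) : 'M[M]_2 :=
  \matrix_(i, j) if i == 0 then (if j == 0 then a else b) else (if j == 0 then c else d).

Let mx2M (a b c d a' b' c' d' : M) : mx2 a b c d *m mx2 a' b' c' d' =
  mx2 (a * a' + b * c') (a * b' + b * d') (c * a' + d * c') (c * b' + d * d').
Proof.
apply/matrixP => i j; rewrite !mxE big_ord_recl big_ord1 !mxE /=.
by case: (i == 0); case: (j == 0).
Qed.

Let mx2_1 : mx2 1 0 0 1 = 1%:M.
Proof.
apply/matrixP => i j; rewrite !mxE.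
by case: i => [[|[|i]] hi] //; case: j => [[|[|j]] hj].
Qed.

(** The inverse of the matrix with rows [x, i eps] and [i eps, x^*] is given by the
resolvents of [x^* x] and [x x^*]; the trace identifies those two, and the
diagonal entries are mutually adjoint. *)
Lemma green_quat : complex.Im (tau Q) = 0 ->
  green tau X (zeps z eps) = quat (conjc (tau (x * Q))) ((- eps)%:C * tau Q).
Proof.
move=> imQ; pose ie : R[i] := 'i%C * eps%:C.
have ie2 : ie * ie = - e by rewrite /ie /e; apply: complex_ext; rewrite ?(ReM, ImM, ReN, ImN) /=; ring.
pose P := mx2 x ie%:A ie%:A (star x).
pose Y := mx2 (Q * star x) (- ie *: Q) (- ie *: Q2) (x * Q).
have PE : map_mx (fun c : R[i] => c%:A : M) (zeps z eps) - diag_star X = P.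
  apply/matrixP => i j; rewrite !mxE.
  case: i => [[|[|i]] hi] //; case: j => [[|[|j]] hj] //=; rewrite ?subr0 ?star_scalar.
  - by rewrite /ie complexiE; congr (('i * _)%:A); exact: conjc_real.
  - by rewrite /ie complexiE.
  - by rewrite /x starB star_scalar.
have PY : P *m Y = 1%:M.
  rewrite mx2M -mx2_1; congr mx2.
  - by rewrite -scalerAr mulr_algl scalerA mulNr ie2 opprK eQ2 mulrA addrC subrK.
  - by rewrite -scalerAr mulr_algl scaleNr addNr.
  - by rewrite -scalerAr mulr_algl sxQ2 scaleNr subrr.
  - by rewrite -scalerAr mulr_algl scalerA mulNr ie2 opprK mulrA xxQ addrC subrK.
have YP : Y *m P = 1%:M.
  rewrite mx2M -mx2_1; congr mx2.
  - by rewrite -scalerAl mulr_algr scalerA mulNr ie2 opprK -mulrA Qxx subrK.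
  - by rewrite -scalerAl mulr_algr scaleNr subrr.
  - by rewrite -scalerAl mulr_algr Q2x scaleNr addNr.
  - by rewrite -scalerAl mulr_algr scalerA mulNr ie2 opprK eQ2 subrK.
have inv : minv P = Y.
  rewrite /minv; case: xgetP => [Z _ [h1 h2]|/(_ Y)[]//].
  by rewrite -[Z]mulmx1 -PY mulmxA h2 mul1mx.
rewrite /green PE inv.
apply/matrixP => i j; rewrite !mxE.
case: i => [[|[|i]] hi] //; case: j => [[|[|j]] hj] //=.
- by rewrite -(tau_star htau) starM Q_hermitian.
- rewrite [X in 'i * X](_ : _ = (- eps)%:C * tau Q); last first.
    apply: complex_ext; rewrite ?ReM ?ImM /= ?imQ ?mulr0 ?mul0r ?addr0 ?subr0 //.
    - by case: (tau Q) => ? ? /=; ring.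
    - by case: (tau Q) imQ => ? ? /= ->; ring.
  by rewrite (tauZ htau) /ie -complexiE rmorphN /=; ring.
- by rewrite (tauZ htau) tauQ2 /ie -complexiE rmorphN /=; ring.
- by rewrite conjcK.
Qed.
End GreenMatrix.

Section Arc.
Context {R : realType}.
Implicit Types (a b : R) (z w : R[i]).

(** The ellipse with focal sum 2 degenerates to the segment between the foci. *)
Lemma focal_sum_segment z : (cabs (z - 1) + cabs (z + 1) <= 2) <->
  complex.Im z = 0 /\ `|complex.Re z| <= 1.
Proof.
case: z => x y; set p := cabs _; set q := cabs _ => /=.
have p2 : p ^+ 2 = (x - 1) ^+ 2 + y ^+ 2 by rewrite /p cabs_sqr ReD ImD ReN ImN /= oppr0 addr0.
have q2 : q ^+ 2 = (x + 1) ^+ 2 + y ^+ 2 by rewrite /q cabs_sqr ReD ImD /= addr0.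
have p0 : 0 <= p := cabs_ge0 _.
have q0 : 0 <= q := cabs_ge0 _.
have p1 : 1 - x <= p.
  have := ler_Re_cabs ((x +i* y) - 1); rewrite -/p ReD ReN /= => h.
  by apply: le_trans h; rewrite distrC ler_norm.
have q1 : x + 1 <= q.
  by have := ler_Re_cabs ((x +i* y) + 1); rewrite -/q ReD /= => h; apply: le_trans h; rewrite ler_norm.
clearbody p q; split=> [h|[y0 xle]].
  have s2 : q = 2 - p by lra.
  have px : p = 1 - x by move: q2; rewrite s2; nra.
  split; last by rewrite ler_norml; apply/andP; split; lra.
  by apply/eqP; rewrite -sqrf_eq0; apply/eqP; move: p2; rewrite px; nra.
move: p2 q2 xle; rewrite y0 ler_norml expr0n /= !addr0 => p2 q2 /andP[x1 x2].
have -> : p = 1 - x by apply/eqP; rewrite -(eqrXn2 (n := 2))// ?p2 ?subr_ge0// -sqrrN opprB.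
have -> : q = 1 + x by apply/eqP; rewrite -(eqrXn2 (n := 2))// ?q2 1?addrC//; lra.
lra.
Qed.

(** In coordinates centred at [tau X], the part of a rectangular hyperbola inside the
rectangle with half-sides [|a|] and [|b|]: the support of the Brown measure. *)
Definition arc a b w := complex.Re w ^+ 2 - complex.Im w ^+ 2 = a ^+ 2 - b ^+ 2 /\
  complex.Re w ^+ 2 <= a ^+ 2.

Context (a b : R) (w : R[i]).
Hypotheses (a0 : a != 0) (b0 : b != 0).

Lemma Re_kappa : complex.Re (kappa a b w) = complex.Re w * complex.Im w / (a * b).
Proof.
rewrite /kappa ReM ReV ImV cabs_sqr [w ^+ 2]expr2 !(ReD, ImD, ReN, ImN, ReM, ImM) /=.
by field; apply/andP.
Qed.

Lemma Im_kappa : complex.Im (kappa a b w) =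
  - (complex.Re w ^+ 2 - complex.Im w ^+ 2 - (a ^+ 2 - b ^+ 2)) / (2 * (a * b)).
Proof.
rewrite /kappa ImM ReV ImV cabs_sqr [w ^+ 2]expr2 !(ReD, ImD, ReN, ImN, ReM, ImM) /=.
by field; apply/andP.
Qed.

Let a2 : 0 < a ^+ 2. Proof. by rewrite exprn_even_gt0. Qed.
Let b2 : 0 < b ^+ 2. Proof. by rewrite exprn_even_gt0. Qed.
Let ab2 : 0 < (a * b) ^+ 2. Proof. by rewrite exprn_even_gt0// mulf_neq0. Qed.

(** The imaginary part of [kappa] is a multiple of the equation of the hyperbola, and on
the hyperbola the bound [|Re kappa| <= 1] amounts to
[(x^2 - a^2) (x^2 + b^2) <= 0]. *)
Lemma arc_kappa : arc a b w <->
  complex.Im (kappa a b w) = 0 /\ `|complex.Re (kappa a b w)| <= 1.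
Proof.
have Im0 : complex.Im (kappa a b w) = 0 <->
    complex.Re w ^+ 2 - complex.Im w ^+ 2 = a ^+ 2 - b ^+ 2.
  rewrite Im_kappa; split=> [/eqP|->]; last by rewrite subrr oppr0 mul0r.
  rewrite mulf_eq0 oppr_eq0 invr_eq0 !mulf_eq0 pnatr_eq0 (negPf a0) (negPf b0) !orbF.
  by rewrite subr_eq0 => /eqP.
rewrite /arc -Im0; split=> -[h1 h2]; split => //; move/Im0: h1 => h1.
- rewrite Re_kappa -(@ler_pXn2r _ 2) ?nnegrE// expr1n real_normK ?num_real//.
  rewrite expr_div_n ler_pdivrMr// mul1r !exprMn.
  move: h1 h2 a2 b2; set X := complex.Re w ^+ 2; set Y := complex.Im w ^+ 2.
  move: (a ^+ 2) (b ^+ 2) => A B; have Y0 : 0 <= Y := sqr_ge0 _; have : 0 <= X := sqr_ge0 _; nra.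
- move: h2; rewrite Re_kappa -(@ler_pXn2r _ 2) ?nnegrE// expr1n real_normK ?num_real//.
  rewrite expr_div_n ler_pdivrMr// mul1r !exprMn.
  move: h1 a2 b2; set X := complex.Re w ^+ 2; set Y := complex.Im w ^+ 2.
  move: (a ^+ 2) (b ^+ 2) => A B; have Y0 : 0 <= Y := sqr_ge0 _; have : 0 <= X := sqr_ge0 _; nra.
Qed.

Lemma cabs_joukowski_kappa_lt1 : (cabs (joukowski_inv (kappa a b w)) < 1) <-> ~ arc a b w.
Proof.
rewrite cabs_joukowski_inv_lt1 arc_kappa -focal_sum_segment ltNge.
by split=> [/negP|h]; last apply/negP.
Qed.

Lemma zeta0 : zeta a b w 0 = complex.Re (kappa a b w) +i* `|complex.Im (kappa a b w)|.
Proof. by rewrite /zeta mulr0 expr0n /= addr0 mul0r addr0 sqrtr_sqr. Qed.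

(** The two points are equal or conjugate, and the focal sum does not distinguish
conjugates. *)
Lemma cabs_joukowski_zeta0 :
  (cabs (joukowski_inv (zeta a b w 0)) < 1) = (cabs (joukowski_inv (kappa a b w)) < 1).
Proof.
rewrite !cabs_joukowski_inv_lt1 zeta0 /cabs !ReD !ImD !ReN !ImN /= !oppr0 !addr0.
by rewrite real_normK ?num_real.
Qed.

Lemma zeta_cvg (e0 : R) : ccvg (nbhs e0) (zeta a b w) (zeta a b w e0).
Proof.
split => /=; first exact: cvg_cst.
pose f (x : R) := complex.Im (kappa a b w) ^+ 2 +
  (2 * scale2 a b w * x + x ^+ 2) / (4 * a ^+ 2 * b ^+ 2).
have h : f x @[x --> e0] --> f e0.
  apply: cvgD; first exact: cvg_cst.
  apply: cvgM; last exact: cvg_cst.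
  apply: cvgD; first by apply: cvgM; [exact: cvg_cst|exact: cvg_id].
  exact: exprn_continuous.
exact: (cvg_comp _ _ h (@sqrt_continuous R _)).
Qed.

Lemma zeta_right_ccvg : ccvg (0 : R)^'+ (zeta a b w) (zeta a b w 0).
Proof.
have [h1 h2] := zeta_cvg 0.
by split; [exact: cvg_at_right_filter h1|exact: cvg_at_right_filter h2].
Qed.

Let zeta0_lt1 : ~ arc a b w -> cabs (joukowski_inv (zeta a b w 0)) < 1.
Proof. by move=> h; rewrite cabs_joukowski_zeta0; apply/cabs_joukowski_kappa_lt1. Qed.

Lemma arcsine_cauchy_zeta_cvg : ~ arc a b w ->
  ccvg (0 : R)^'+ (fun e => arcsine_cauchy (zeta a b w e)) (arcsine_cauchy (zeta a b w 0)).
Proof. by move=> /zeta0_lt1 h; apply: arcsine_cauchy_ccvg => //; exact: zeta_right_ccvg. Qed.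

Lemma arcsine_square_zeta_cvg : ~ arc a b w ->
  arcsine_square (zeta a b w e) @[e --> (0 : R)^'+] --> arcsine_square (zeta a b w 0).
Proof. by move=> /zeta0_lt1 h; apply: arcsine_square_cvg => //; exact: zeta_right_ccvg. Qed.

End Arc.

Section ArcsineCauchySigns.
Context {R : realType}.
Implicit Types z : R[i].

Lemma Re_arcsine_cauchy_sign z : cabs (joukowski_inv z) < 1 -> complex.Re z != 0 ->
  0 < complex.Re z * complex.Re (arcsine_cauchy z).
Proof.
move=> h z0; have n0 := cabs_joukowski_inv_gt0 z; have := Re_joukowski z.
rewrite Re_arcsine_cauchy; set r := complex.Re (joukowski_inv z); set n := cabs (joukowski_inv z) in h n0 *.
move=> e; have zE : complex.Re z = r * (1 + (n ^+ 2)^-1) / 2 by lra.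
have r0 : r != 0 by apply: contra_neq z0 => r0; rewrite zE r0 !mul0r.
have d0 : 0 < cabs (1 - joukowski_inv z ^+ 2) ^+ 2.
  by rewrite exprn_gt0// cabs_gt0 joukowski_sqr_neq1.
have -> : complex.Re z * (2 * r * (1 - n ^+ 2) / cabs (1 - joukowski_inv z ^+ 2) ^+ 2) =
   r ^+ 2 * ((1 + (n ^+ 2)^-1) * ((1 - n ^+ 2) / cabs (1 - joukowski_inv z ^+ 2) ^+ 2)).
  by rewrite zE; move: (cabs (1 - joukowski_inv z ^+ 2) ^+ 2)^-1 (n ^+ 2)^-1 => D N; field.
apply: mulr_gt0; first by rewrite exprn_even_gt0.
apply: mulr_gt0; first by rewrite addr_gt0// invr_gt0 exprn_gt0.
by rewrite divr_gt0// subr_gt0 expr_lt1// ltW.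
Qed.

(** As [z] approaches a point of the open segment ]-1, 1[, the root
[n = joukowski_inv z] approaches a non-real point of the unit circle: the real part
of [n] is at most [|Re z| |n|] by the arithmetic-geometric mean inequality, so its
imaginary part is bounded away from 0. *)
Lemma Im_arcsine_square_lower z : cabs (joukowski_inv z) < 1 -> 0 < complex.Im z ->
  `|complex.Re z| < 1 ->
  Num.sqrt (1 - complex.Re z ^+ 2) / (4 * (1 + cabs z)) <= complex.Im z * arcsine_square z.
Proof.
move=> h z0 z1; rewrite arcsine_squareE// Im_arcsine_cauchy.
have n0 := cabs_joukowski_inv_gt0 z; have := Re_joukowski z; have := Im_joukowski z.
have n2 : cabs (joukowski_inv z) ^+ 2 < 1 by rewrite expr_lt1// ltW.
have := cabs_sqr (joukowski_inv z); have := joukowski_invE z.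
set H := joukowski_inv z in h n0 n2 *; set n := cabs H in h n0 n2 * => HE nE imE reE.
set r := complex.Re H in nE reE *; set m := complex.Im H in nE imE *.
have nz : n != 0 by rewrite gt_eqF.
have invn : 1 < (n ^+ 2)^-1 by rewrite invf_gt1// exprn_gt0.
have m0 : m < 0 by nra.
have d0 : 0 < cabs (1 - H ^+ 2) by rewrite cabs_gt0 joukowski_sqr_neq1.
have d2 : cabs (1 - H ^+ 2) <= 2.
  apply: (le_trans (cabs_triangle _ _)); rewrite cabs1 cabsN expr2 cabsM -expr2 -/n; lra.
have nlow : 1 <= n * (2 * (1 + cabs z)).
  have : n^-1 <= 2 * cabs z + n.
    rewrite /n -cabsV -[H^-1](addrK H) [H^-1 + H]addrC HE -(cabsN H).
    apply: (le_trans (cabs_triangle _ _)); rewrite lerD2r cabsM.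
    have -> : (2 : R[i]) = (2 : R)%:C by rewrite rmorph_nat.
    by rewrite cabs_real ger0_norm.
  move=> hn; have : 1 <= n * (2 * cabs z + n) by rewrite -(ler_pdivrMl _ _ n0) mulr1.
  have : 0 <= cabs z := cabs_ge0 z; nra.
have rle : r ^+ 2 <= complex.Re z ^+ 2 * n ^+ 2.
  have -> : complex.Re z = r * (1 + (n ^+ 2)^-1) / 2 by lra.
  have -> : (r * (1 + (n ^+ 2)^-1) / 2) ^+ 2 * n ^+ 2 = r ^+ 2 * ((1 + n ^+ 2) / (2 * n)) ^+ 2.
    by field.
  have amgm : 1 <= (1 + n ^+ 2) / (2 * n).
    rewrite ler_pdivlMr ?mulr_gt0// mul1r; have := sqr_ge0 (n - 1); lra.
  by rewrite ler_peMr ?sqr_ge0// expr_ge1// (le_trans ler01).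
have mge : Num.sqrt (1 - complex.Re z ^+ 2) * n <= - m.
  rewrite -(@ler_pXn2r _ 2) ?nnegrE ?mulr_ge0 ?sqrtr_ge0 ?oppr_ge0 ?(ltW n0) ?(ltW m0)//.
  rewrite exprMn sqr_sqrtr; first by rewrite sqrrN mulrBl mul1r; lra.
  by rewrite subr_ge0 -real_normK ?num_real// expr_le1// ltW.
apply: (@le_trans _ _ (- m / 2)).
  rewrite ler_pdivrMr ?mulr_gt0 ?ltr_pwDl ?cabs_ge0//.
  apply: (@le_trans _ _ (Num.sqrt (1 - complex.Re z ^+ 2) * (n * (2 * (1 + cabs z))))).
    by rewrite ler_peMr ?sqrtr_ge0.
  have c0 : 0 < 1 + cabs z by rewrite ltr_pwDl// cabs_ge0.
  rewrite (mulrA _ n); apply: (@le_trans _ _ (- m * (2 * (1 + cabs z)))).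
    by rewrite ler_pM2r// mulr_gt0.
  lra.
rewrite -mulNr ler_pdivlMr ?exprn_gt0//.
have dd : cabs (1 - H ^+ 2) ^+ 2 <= 4 by nra.
apply: (@le_trans _ _ (- m / 2 * 4)); first by rewrite ler_pM2l// divr_gt0// oppr_gt0.
have : 0 < n ^+ 2 by rewrite exprn_gt0.
nra.
Qed.

End ArcsineCauchySigns.

Section GreenFormula.
Context {R : realType}.
Implicit Types (a b eps : R) (w : R[i]).

(** The component [A] of the quaternion [green tau X (zeps z eps)]. *)
Definition green_diag a b w eps : R[i] :=
  conjc ((conjc w * (0 +i* (2 * a * b)) *
    ((complex.Re (arcsine_cauchy (zeta a b w (eps ^+ 2))))%:C +
     'i%C * (complex.Im (kappa a b w) * arcsine_square (zeta a b w (eps ^+ 2)))%:C) +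
    (eps ^+ 2)%:C * w * (arcsine_square (zeta a b w (eps ^+ 2)))%:C) /
   (4 * a ^+ 2 * b ^+ 2)%:C).

(** The component [B] of the same quaternion, a real number. *)
Definition green_off a b w eps : R :=
  - eps * ((scale2 a b w + eps ^+ 2) * arcsine_square (zeta a b w (eps ^+ 2)) /
    (4 * a ^+ 2 * b ^+ 2)).

Lemma green_model {M : vonNeumannAlgebra R} (tau : M -> R[i]) (u v X : M) a b (z c : R[i]) eps :
  faithful_normal_tracial_state tau -> free_symmetries (tau := tau) u v ->
  a != 0 -> b != 0 -> X = affine u v c a%:C (0 +i* b) -> 0 < eps ->
  green tau X (zeps z eps) = quat (green_diag a b (z - c) eps) (green_off a b (z - c) eps)%:C.
Proof.
move=> htau huv a0 b0 XE eps0.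
have xE : z%:A - X = model u v a b (z - c).
  by rewrite XE /model /affine !opprD !addrA -scalerBl !scaleNr.
have e0 : 0 < eps ^+ 2 by rewrite exprn_gt0.
have [Q [Ql Qr tQ tmQ]] := model_resolvent htau (z - c) huv a0 b0 e0.
rewrite (green_quat htau eps0 (Q := Q)) ?xE ?tQ//; congr quat; first by rewrite tmQ.
by apply/esym; exact: rmorphM.
Qed.

Context (a b : R) (w : R[i]).
Hypotheses (a0 : a != 0) (b0 : b != 0).
Let a2 : 0 < a ^+ 2. Proof. by rewrite exprn_even_gt0. Qed.
Let b2 : 0 < b ^+ 2. Proof. by rewrite exprn_even_gt0. Qed.
Let k4 : 0 < 4 * a ^+ 2 * b ^+ 2. Proof. by apply: mulr_gt0 => //; apply: mulr_gt0. Qed.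

Let sqr_right : (fun eps : R => eps ^+ 2) @ (0 : R)^'+ --> (0 : R)^'+.
Proof.
move=> P /nbhs_ballP [d d0 hd]; apply/nbhs_ballP.
exists (Num.min 1 d); first by rewrite /= lt_min ltr01.
move=> eps; rewrite /ball /= sub0r normrN lt_min => /andP[h1 h2] eps0.
apply: hd; last by rewrite /= exprn_gt0.
rewrite /ball /= sub0r normrN normrX; apply: le_lt_trans h2.
by rewrite expr2 ler_piMr// ltW.
Qed.

(** Off the arc [arcsine_square] has a finite limit and the factor [eps] prevails. *)
Lemma green_off_cvg : ~ arc a b w -> green_off a b w eps @[eps --> (0 : R)^'+] --> (0 : R).
Proof.
move=> h; have h2 := cvg_comp _ _ sqr_right (arcsine_square_zeta_cvg a0 b0 h).
have id0 : (fun eps : R => eps) @ (0 : R)^'+ --> (0 : R) by exact: cvg_at_right_filter.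
have sq0 : (fun eps : R => eps ^+ 2) @ (0 : R)^'+ --> (0 : R) ^+ 2.
  by apply: cvg_at_right_filter; exact: exprn_continuous.
set T0 := arcsine_square (zeta a b w 0) in h2.
rewrite -[X in _ --> X](_ : - 0 * ((scale2 a b w + 0 ^+ 2) * T0 / (4 * a ^+ 2 * b ^+ 2)) = 0);
  last by rewrite oppr0 mul0r.
apply: cvgM; first exact: cvgN.
apply: cvgM; last exact: cvg_cst.
by apply: cvgM; [apply: cvgD; [exact: cvg_cst|exact: sq0]|exact: h2].
Qed.

Lemma green_diag_cvg : ~ arc a b w ->
  ccvg (0 : R)^'+ (green_diag a b w) (green_diag a b w 0).
Proof.
move=> h; have h2 := cvg_comp _ _ sqr_right (arcsine_square_zeta_cvg a0 b0 h).
have [hP _] := arcsine_cauchy_zeta_cvg a0 b0 h; have h3 := cvg_comp _ _ sqr_right hP.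
have sq0 : (fun eps : R => eps ^+ 2) @ (0 : R)^'+ --> (0 : R) ^+ 2.
  by apply: cvg_at_right_filter; exact: exprn_continuous.
have -> : green_diag a b w 0 = conjc ((conjc w * (0 +i* (2 * a * b)) *
    ((complex.Re (arcsine_cauchy (zeta a b w 0)))%:C +
     'i%C * (complex.Im (kappa a b w) * arcsine_square (zeta a b w 0))%:C) +
    ((0 : R) ^+ 2)%:C * w * (arcsine_square (zeta a b w 0))%:C) /
   (4 * a ^+ 2 * b ^+ 2)%:C).
  by rewrite /green_diag expr0n.
apply: ccvg_conj; apply: ccvgM; last exact: ccvg_cst.
apply: ccvgD.
  apply: ccvgM; first exact: ccvg_cst.
  apply: ccvgD; first exact: (ccvg_real h3).
  apply: ccvgM; first exact: ccvg_cst.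
  by apply: ccvg_real; apply: cvgM; [exact: cvg_cst|exact: h2].
apply: ccvgM; last exact: (ccvg_real h2).
by apply: ccvgM; [exact: ccvg_real|exact: ccvg_cst].
Qed.

(** Multiplied by [Re w], respectively [Im w], each of the two parts becomes a sum of
two terms of the same sign, because [Re w * Im w] equals [a b Re kappa] and
[Re kappa] has the sign of [Re (arcsine_cauchy zeta)]. This puts the quaternion in
the domain of the inverse Green's function. *)
Lemma green_diag_neq0 eps : 0 < eps -> arc a b w -> complex.Re w * complex.Im w != 0 ->
  complex.Re (green_diag a b w eps) != 0 /\ complex.Im (green_diag a b w eps) != 0.
Proof.
move=> eps0 /(arc_kappa w a0 b0)[im0 _] xy0.
have e0 : 0 < eps ^+ 2 by rewrite exprn_gt0.
have c1 := cabs_joukowski_zeta w a0 b0 e0.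
have T0 := arcsine_square_gt0 c1.
have reE : complex.Re (zeta a b w (eps ^+ 2)) = complex.Re w * complex.Im w / (a * b).
  by rewrite -Re_kappa.
have ab0 : a * b != 0 by rewrite mulf_neq0.
have re0 : complex.Re (zeta a b w (eps ^+ 2)) != 0.
  by rewrite reE mulf_neq0 ?invr_eq0.
have := Re_arcsine_cauchy_sign c1 re0; rewrite reE /green_diag im0 mul0r.
set P := complex.Re (arcsine_cauchy _); set T := arcsine_square _ in T0 *.
move=> hP; rewrite mulr0 addr0.
have hP2 : 0 < a * b * (complex.Re w * complex.Im w) * P.
  have -> : a * b * (complex.Re w * complex.Im w) * P =
    (a * b) ^+ 2 * (complex.Re w * complex.Im w / (a * b) * P) by field; apply/andP.
  by rewrite mulr_gt0// exprn_even_gt0.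
set x := complex.Re w in xy0 hP2 *; set y := complex.Im w in xy0 hP2 *.
have /andP[x0 y0] : (x != 0) && (y != 0) by move: xy0; rewrite mulf_eq0 negb_or.
have wE : w = x +i* y by apply: complex_ext.
set A := conjc _.
have reA : complex.Re A = (2 * a * b * y * P + eps ^+ 2 * x * T) / (4 * a ^+ 2 * b ^+ 2).
  rewrite /A wE; set k := (4 * a ^+ 2 * b ^+ 2); have kn : k != 0 by rewrite gt_eqF.
  rewrite -fmorphV /=; ring.
have imA : complex.Im A = - (2 * a * b * x * P + eps ^+ 2 * y * T) / (4 * a ^+ 2 * b ^+ 2).
  rewrite /A wE; set k := (4 * a ^+ 2 * b ^+ 2); have kn : k != 0 by rewrite gt_eqF.
  rewrite -fmorphV /=; ring.
have sx : 0 < eps ^+ 2 * x ^+ 2 * T by apply: mulr_gt0 => //; apply: mulr_gt0 => //; rewrite exprn_even_gt0.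
have sy : 0 < eps ^+ 2 * y ^+ 2 * T by apply: mulr_gt0 => //; apply: mulr_gt0 => //; rewrite exprn_even_gt0.
split.
- rewrite reA mulf_neq0 ?invr_eq0 ?(gt_eqF k4)//; apply/eqP => h.
  have : x * (2 * a * b * y * P + eps ^+ 2 * x * T) = 0 by rewrite h mulr0.
  lra.
- rewrite imA mulf_neq0 ?invr_eq0 ?(gt_eqF k4)// oppr_eq0; apply/eqP => h.
  have : y * (2 * a * b * x * P + eps ^+ 2 * y * T) = 0 by rewrite h mulr0.
  lra.
Qed.

(** At an interior point of the arc [Im zeta] is of the order of [eps], so that
[arcsine_square] grows like [1 / eps], which compensates the factor [eps]. *)
Lemma green_off_lower : complex.Im (kappa a b w) = 0 -> `|complex.Re (kappa a b w)| < 1 ->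
  exists2 k, 0 < k & \forall eps \near (0 : R)^'+, green_off a b w eps <= - k.
Proof.
move=> im0 re1; set c := complex.Re _ in re1.
set S := scale2 a b w; have S0 : 0 < S by apply: scale2_gt0.
pose K := Num.sqrt ((2 * S + 1) / (4 * a ^+ 2 * b ^+ 2)).
have K0 : 0 < K by rewrite sqrtr_gt0 divr_gt0// addr_gt0// mulr_gt0.
have c2 : 0 < Num.sqrt (1 - c ^+ 2).
  by rewrite sqrtr_gt0 subr_gt0 -real_normK ?num_real// expr_lt1.
pose m := Num.sqrt (1 - c ^+ 2) / (4 * (2 + K)).
have m0 : 0 < m by rewrite divr_gt0// mulr_gt0// addr_gt0.
exists (S * (m / K) / (4 * a ^+ 2 * b ^+ 2)); first by apply: divr_gt0 => //; apply: mulr_gt0 => //; apply: divr_gt0.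
near=> eps.
have eps0 : 0 < eps by near: eps; exact: nbhs_right_gt.
have eps1 : eps < 1 by near: eps; exact: nbhs_right_lt.
have e0 : 0 < eps ^+ 2 by rewrite exprn_gt0.
have c1 := cabs_joukowski_zeta w a0 b0 e0.
have s0 := Im_zeta_gt0 w a0 b0 e0.
have sK : complex.Im (zeta a b w (eps ^+ 2)) <= eps * K.
  rewrite /= im0 expr0n add0r -/S.
  have -> : (2 * S * eps ^+ 2 + eps ^+ 2 ^+ 2) / (4 * a ^+ 2 * b ^+ 2) =
      eps ^+ 2 * ((2 * S + eps ^+ 2) / (4 * a ^+ 2 * b ^+ 2)) by ring.
  have S1 : 0 < (2 * S + 1) / (4 * a ^+ 2 * b ^+ 2) by rewrite divr_gt0// addr_gt0// mulr_gt0.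
  rewrite sqrtrM ?sqr_ge0// sqrtr_sqr gtr0_norm// ler_pM2l// ler_sqrt ?(ltW S1)//.
  by rewrite ler_pM2r ?invr_gt0// lerD2l ltW// expr_lt1// ltW.
have low := Im_arcsine_square_lower c1 s0 re1.
have zb : cabs (zeta a b w (eps ^+ 2)) <= 1 + K.
  apply: (le_trans (ler_cabs_ReIm _)); apply: lerD; first exact: ltW.
  rewrite gtr0_norm//; apply: (le_trans sK); rewrite ler_piMl// ltW//.
have T0 := arcsine_square_gt0 c1.
have mT : m <= eps * K * arcsine_square (zeta a b w (eps ^+ 2)).
  apply: (@le_trans _ _ (complex.Im (zeta a b w (eps ^+ 2)) * arcsine_square (zeta a b w (eps ^+ 2)))).
    have p1 : 0 < 4 * (1 + cabs (zeta a b w (eps ^+ 2))).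
      by apply: mulr_gt0 => //; rewrite ltr_pwDl// cabs_ge0.
    have p2 : 0 < 4 * (2 + K) by apply: mulr_gt0 => //; rewrite addr_gt0.
    by apply: le_trans low; rewrite /m ler_pM2l// lef_pV2 ?posrE//; lra.
  by rewrite ler_pM2r.
rewrite /green_off mulNr lerN2 [eps * _]mulrA ler_pM2r ?invr_gt0// -/S.
set T := arcsine_square _ in T0 mT *.
have : S * (m / K) <= S * (eps * T).
  by rewrite ler_pM2l// ler_pdivrMr// mulrAC.
move=> h; apply: (le_trans h).
have -> : eps * ((S + eps ^+ 2) * T) = S * (eps * T) + eps ^+ 2 * (eps * T) by ring.
rewrite lerDl; apply: mulr_ge0; [exact: ltW|by apply: mulr_ge0; exact: ltW].
Unshelve. all: by end_near.
Qed.

End GreenFormula.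

Section QuaternionNorm.
Context {R : realType}.
Implicit Types A B : R[i].

Lemma quatB A B A' B' : quat A B - quat A' B' = quat (A - A') (B - B').
Proof.
apply/matrixP => i j; rewrite !mxE.
by case: ifP => _; case: ifP => _ //; rewrite ?rmorphB /= ?mulrBr.
Qed.

Lemma qnorm_quat A B : qnorm (quat A B) = Num.sqrt (cabs A ^+ 2 + cabs B ^+ 2).
Proof.
rewrite /qnorm (expand_det_row _ ord0) !big_ord_recl big_ord0 /cofactor !det_mx11 !mxE /=.
rewrite -complexiE !cabs_sqr; congr Num.sqrt.
by case: A B => p q [r s] /=; ring.
Qed.

(** The cuts and 0 lie on the imaginary axis, and the two eigenvalues have real parts
[Re A] and [- Im A]. *)
Lemma inv_green_domain_neq0 (al al' be be' : R) A B : complex.Re A != 0 ->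
  complex.Im A != 0 -> inv_green_domain al al' be be' (quat A B).
Proof.
case: A B => p q [r s] /= p0 q0; exists (p +i* q), (r +i* s); split => //=.
- by move=> [[y _ [pE _]]|[pE _]]; move/eqP: p0.
- by move=> [[y _ [/eqP qE _]]|[/eqP qE _]]; move: qE; rewrite oppr_eq0 (negPf q0).
Qed.

End QuaternionNorm.

Section GreenSet.
Context {R : realType} {M : vonNeumannAlgebra R} {tau : M -> R[i]}.
Hypothesis htau : faithful_normal_tracial_state tau.
Context (u v X : M) (a b : R) (c : R * R) (al al' be be' : R).
Hypotheses (huv : free_symmetries (tau := tau) u v) (a0 : a != 0) (b0 : b != 0).
Hypothesis XE : X = affine u v (toC c) a%:C (0 +i* b).
Implicit Types z : R * R.
Local Notation G z eps := (green tau X (zeps (toC z) eps)).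

Let qdist z A B eps : 0 < eps -> qnorm (G z eps - quat A B) =
  Num.sqrt (cabs (green_diag a b (toC z - toC c) eps - A) ^+ 2 +
    cabs ((green_off a b (toC z - toC c) eps)%:C - B) ^+ 2).
Proof. by move=> eps0; rewrite (green_model _ htau huv a0 b0 XE eps0) quatB qnorm_quat. Qed.

Let off_limit z A B : green_limit tau X (toC z) (quat A B) ->
  cabs ((green_off a b (toC z - toC c) eps)%:C - B) @[eps --> (0 : R)^'+] --> (0 : R).
Proof.
move=> [_ h]; apply: (@squeeze_cvgr _ _ _ _ (fun=> 0) (fun eps => qnorm (G z eps - quat A B))).
- near=> eps; rewrite cabs_ge0 qdist; last by near: eps; exact: nbhs_right_gt.
  rewrite -[leLHS]ger0_norm ?cabs_ge0// -sqrtr_sqr ler_sqrt ?lerDr ?sqr_ge0//.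
  by rewrite addr_ge0// sqr_ge0.
- exact: cvg_cst.
- exact: h.
Unshelve. all: by end_near.
Qed.

Definition green_exceptional : set (R * R) := [set z |
  (\forall eps \near (0 : R)^'+,
     inv_green_domain al al' be be' (green tau X (zeps (toC z) eps))) /\
  ((exists A B : R[i], B != 0 /\ green_limit tau X (toC z) (quat A B)) \/
   ~ (exists L : 'M[R[i]]_2, green_limit tau X (toC z) L))].

Lemma green_exceptional_arc z : green_exceptional z -> arc a b (toC z - toC c).
Proof.
move=> [_ h]; apply: contrapT => na; have oc := green_off_cvg a0 b0 na.
case: h => [[A [B [B0 L]]]|]; last first.
  apply; exists (quat (green_diag a b (toC z - toC c) 0) 0); split; first by exists (green_diag a b (toC z - toC c) 0), 0.
  have dc := green_diag_cvg a0 b0 na.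
  have f0 : Num.sqrt (cabs (green_diag a b (toC z - toC c) eps -
      green_diag a b (toC z - toC c) 0) ^+ 2 +
      cabs ((green_off a b (toC z - toC c) eps)%:C - 0) ^+ 2) @[eps --> (0 : R)^'+] --> (0 : R).
    have cabs0 : cabs (0 : R[i]) = 0 by apply/eqP; rewrite cabs_eq0.
    have e0 : Num.sqrt (cabs (green_diag a b (toC z - toC c) 0 -
       green_diag a b (toC z - toC c) 0) ^+ 2 + cabs ((0 : R)%:C - 0) ^+ 2) = 0.
      by rewrite !subrr cabs0 expr0n addr0 sqrtr0.
    have h : cabs (green_diag a b (toC z - toC c) eps -
        green_diag a b (toC z - toC c) 0) ^+ 2 +
        cabs ((green_off a b (toC z - toC c) eps)%:C - 0) ^+ 2 @[eps --> (0 : R)^'+] -->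
      cabs (green_diag a b (toC z - toC c) 0 -
       green_diag a b (toC z - toC c) 0) ^+ 2 + cabs ((0 : R)%:C - 0) ^+ 2.
      apply: cvgD; apply: ccvg_cabs2; apply: ccvgD.
      - exact: dc.
      - exact: ccvg_cst.
      - exact: ccvg_real oc.
      - exact: ccvg_cst.
    have h0 := cvg_comp _ _ h (@sqrt_continuous R _).
    by rewrite -[X in _ --> X]e0; exact: h0.
  apply: cvg_trans f0; apply: near_eq_cvg; near=> eps.
  by rewrite qdist//; near: eps; exact: nbhs_right_gt.
have := off_limit L => h.
have hB : cabs ((green_off a b (toC z - toC c) eps)%:C - B) @[eps --> (0 : R)^'+] --> cabs ((0 : R)%:C - B).
  by apply: ccvg_cabs; apply: ccvgD; [exact: ccvg_real|exact: ccvg_cst].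
have /eqP : cabs ((0 : R)%:C - B) = 0.
  by rewrite -(cvg_lim (@Rhausdorff R) hB) (cvg_lim (@Rhausdorff R) h).
by rewrite sub0r cabsN cabs_eq0 (negPf B0).
Unshelve. all: by end_near.
Qed.

(** If the limit exists, its off-diagonal part is nonzero since [green_off] is bounded
away from 0; whether it exists need not be decided. *)
Lemma arc_green_exceptional z : arc a b (toC z - toC c) ->
  complex.Re (toC z - toC c) * complex.Im (toC z - toC c) != 0 ->
  complex.Re (toC z - toC c) ^+ 2 < a ^+ 2 -> green_exceptional z.
Proof.
move=> ha xy0 xa; split.
  near=> eps; have eps0 : 0 < eps by near: eps; exact: nbhs_right_gt.
  rewrite (green_model _ htau huv a0 b0 XE eps0).
  have [h1 h2] := green_diag_neq0 a0 b0 eps0 ha xy0.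
  exact: inv_green_domain_neq0.
have [[L hL]|] := pselect (exists L, green_limit tau X (toC z) L); last by right.
left; have [[A [B LE]] _] := hL; rewrite LE in hL; exists A, B; split => //.
apply/eqP => B0; rewrite B0 in hL; have ol := off_limit hL.
have /arc_kappa[//|//|im0 re1] := ha.
have re2 : `|complex.Re (kappa a b (toC z - toC c))| < 1.
  rewrite Re_kappa// -(@ltr_pXn2r _ 2) ?nnegrE// expr1n real_normK ?num_real//.
  rewrite expr_div_n ltr_pdivrMr ?exprn_even_gt0 ?mulf_neq0// mul1r !exprMn.
  case: ha => ha _; have b2 : 0 < b ^+ 2 by rewrite exprn_even_gt0.
  move: ha xa b2; set x := complex.Re _ ^+ 2; set y := complex.Im _ ^+ 2.
  have : 0 <= x by exact: sqr_ge0.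
  have : 0 <= y by exact: sqr_ge0.
  nra.
have [k k0 hk] := green_off_lower a0 b0 im0 re2.
have : k <= 0.
  apply: (ler_cvg_to (cvg_cst k) ol); near=> eps.
  have : green_off a b (toC z - toC c) eps <= - k by near: eps.
  rewrite subr0 cabs_real => h; rewrite ler0_norm; lra.
by rewrite leNgt k0.
Unshelve. all: by end_near.
Qed.

Lemma closed_arc : closed [set z : R * R | arc a b (toC z - toC c)].
Proof.
have cx : continuous (fun z : R * R => z.1 - c.1).
  by move=> z; apply: cvgB; [exact: cvg_fst|exact: cvg_cst].
have cy : continuous (fun z : R * R => z.2 - c.2).
  by move=> z; apply: cvgB; [exact: cvg_snd|exact: cvg_cst].
have cx2 : continuous (fun z : R * R => (z.1 - c.1) ^+ 2).
  by move=> z; apply: cvgM; exact: cx.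
have cy2 : continuous (fun z : R * R => (z.2 - c.2) ^+ 2).
  by move=> z; apply: cvgM; exact: cy.
have -> : [set z : R * R | arc a b (toC z - toC c)] =
   (fun z : R * R => (z.1 - c.1) ^+ 2 - (z.2 - c.2) ^+ 2) @^-1` [set a ^+ 2 - b ^+ 2] `&`
   (fun z : R * R => (z.1 - c.1) ^+ 2) @^-1` [set t | t <= a ^+ 2].
  by apply/seteqP; split.
apply: closedI.
- apply: closed_comp; last exact: closed_eq.
  by move=> z _; apply: cvgB; [exact: cx2|exact: cy2].
- by apply: closed_comp; [move=> z _; exact: cx2|exact: closed_le].
Qed.

(** The points of the arc at which a coordinate vanishes or [kappa] is 1 or -1 are
limits of other points of the arc: the arc is parametrized by
[x^2 = a^2 - s], [y^2 = b^2 - s] with [0 <= s <= min a^2 b^2] and a choice of signs. *)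
Lemma closure_green_exceptional :
  closure green_exceptional = [set z : R * R | arc a b (toC z - toC c)].
Proof.
apply/seteqP; split.
  have /closure_id -> := closed_arc.
  exact/closureS/green_exceptional_arc.
move=> z hz B zB.
pose sgn (r : R) : R := if 0 <= r then 1 else -1.
have sgnK r : sgn r * Num.sqrt (r ^+ 2) = r.
  by rewrite sqrtr_sqr /sgn; case: ger0P => _; rewrite ?mul1r// mulrNN mul1r.
have sgn2 r : sgn r ^+ 2 = 1 by rewrite /sgn; case: ifP => _; rewrite ?sqrrN expr1n.
have sgn0 r : sgn r != 0 by rewrite -sqrf_eq0 sgn2 oner_eq0.
pose x := z.1 - c.1; pose y := z.2 - c.2; pose t := a ^+ 2 - x ^+ 2.
have [h1 h2] : x ^+ 2 - y ^+ 2 = a ^+ 2 - b ^+ 2 /\ x ^+ 2 <= a ^+ 2 by exact: hz.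
have a2 : 0 < a ^+ 2 by rewrite exprn_even_gt0.
have b2 : 0 < b ^+ 2 by rewrite exprn_even_gt0.
pose m := Num.min (a ^+ 2) (b ^+ 2).
have m0 : 0 < m by rewrite lt_min a2.
have [ma mb] : m <= a ^+ 2 /\ m <= b ^+ 2 by rewrite !ge_min !lexx orbT.
have t0 : 0 <= t by rewrite subr_ge0.
have tm : t <= m.
  by rewrite le_min /t; have := sqr_ge0 x; have := sqr_ge0 y => ? ?; apply/andP; split; lra.
pose s (th : R) := (1 - th) * t + th * (m / 2).
pose pt (th : R) : R * R := (c.1 + sgn x * Num.sqrt (a ^+ 2 - s th),
  c.2 + sgn y * Num.sqrt (b ^+ 2 - s th)).
have s00 : s 0 = t by rewrite /s subr0 mul1r mul0r addr0.
have scvg : s th @[th --> (0 : R)^'+] --> t.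
  rewrite -[X in _ --> X]s00; apply: cvg_at_right_filter; apply: cvgD.
    by apply: cvgM; [apply: cvgB; [exact: cvg_cst|exact: cvg_id]|exact: cvg_cst].
  by apply: cvgM; [exact: cvg_id|exact: cvg_cst].
have coord (k r d : R) : k ^+ 2 - t = (r - d) ^+ 2 ->
    d + sgn (r - d) * Num.sqrt (k ^+ 2 - s th) @[th --> (0 : R)^'+] --> r.
  move=> kE; have h : k ^+ 2 - s th @[th --> (0 : R)^'+] --> k ^+ 2 - t.
    by apply: cvgB; [exact: cvg_cst|exact: scvg].
  have h3 := cvg_comp _ _ h (@sqrt_continuous R _).
  have e : d + sgn (r - d) * Num.sqrt (k ^+ 2 - t) = r by rewrite kE sgnK addrC subrK.
  rewrite -[X in _ --> X]e; apply: cvgD; first exact: cvg_cst.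
  by apply: cvgM; [exact: cvg_cst|exact: h3].
have ptcvg : pt th @[th --> (0 : R)^'+] --> z.
  have e1 : a ^+ 2 - t = (z.1 - c.1) ^+ 2 by rewrite /t -/x; ring.
  have e2 : b ^+ 2 - t = (z.2 - c.2) ^+ 2 by rewrite /t -/y; lra.
  have := cvg_pair (coord _ _ _ e1) (coord _ _ _ e2).
  by move=> h; apply: cvg_trans; first exact: h.
have [th [th0 th1 Bth]] : exists th : R, [/\ 0 < th, th < 1 & B (pt th)].
  have near_th : \forall th \near (0 : R)^'+, [/\ 0 < th, th < 1 & B (pt th)].
    near=> th; split; [by near: th; exact: nbhs_right_gt|by near: th; exact: nbhs_right_lt|].
    by near: th; exact: ptcvg.
  exact: (@filter_ex _ _ _ _ near_th).
exists (pt th); split => //.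
have s0 : 0 < s th by rewrite /s ltr_wpDl ?mulr_ge0 ?mulr_gt0 ?divr_gt0// subr_ge0 ltW.
have sm : s th < m.
  have : (1 - th) * t <= (1 - th) * m by rewrite ler_wpM2l// subr_ge0 ltW.
  have : 0 < th * m by rewrite mulr_gt0.
  rewrite /s; lra.
have xE : complex.Re (toC (pt th) - toC c) = sgn x * Num.sqrt (a ^+ 2 - s th).
  by rewrite ReD ReN /= addrC addKr.
have yE : complex.Im (toC (pt th) - toC c) = sgn y * Num.sqrt (b ^+ 2 - s th).
  by rewrite ImD ImN /= addrC addKr.
have sa : 0 < a ^+ 2 - s th by lra.
have sb : 0 < b ^+ 2 - s th by lra.
have x2 : complex.Re (toC (pt th) - toC c) ^+ 2 = a ^+ 2 - s th.
  by rewrite xE exprMn sgn2 mul1r sqr_sqrtr// ltW.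
have y2 : complex.Im (toC (pt th) - toC c) ^+ 2 = b ^+ 2 - s th.
  by rewrite yE exprMn sgn2 mul1r sqr_sqrtr// ltW.
apply: arc_green_exceptional.
- by rewrite /arc x2 y2; split; lra.
- by rewrite xE yE !mulf_neq0// gt_eqF// sqrtr_gt0.
- by rewrite x2; lra.
Unshelve. all: by end_near.
Qed.

End GreenSet.

(** * The determinant of [z - X] *)

Section JoukowskiModulus.
Context {R : realType}.
Implicit Types z : R[i].

(** The modulus of [joukowski_inv], unlike the root itself, is continuous across the
segment [-1, 1]: it solves a quadratic equation in the focal sum. *)
Lemma cabs_joukowski_invE z : let C := (cabs (z - 1) + cabs (z + 1)) / 2 in
  cabs (joukowski_inv z) = C - Num.sqrt (C ^+ 2 - 1).
Proof.
move=> C; have n0 := cabs_joukowski_inv_gt0 z; have n1 := cabs_joukowski_inv_le1 z.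
have : 2 * C = cabs (joukowski_inv z) + (cabs (joukowski_inv z))^-1.
  by rewrite /C mulrC divfK// focal_sum.
move: (cabs _) n0 n1 => n n0 n1 h.
have n10 : 0 <= n^-1 - n by rewrite subr_ge0 (le_trans n1)// invf_ge1.
have CE : C = (n + n^-1) / 2 by lra.
have -> : C ^+ 2 - 1 = ((n^-1 - n) / 2) ^+ 2 by rewrite CE; field; rewrite gt_eqF.
by rewrite sqrtr_sqr ger0_norm ?divr_ge0// CE; field; rewrite gt_eqF.
Qed.

Lemma cabs_joukowski_inv_cvg {T : Type} {F : set_system T} {FF : Filter F} (f : T -> R[i]) l :
  ccvg F f l -> cabs (joukowski_inv (f x)) @[x --> F] --> cabs (joukowski_inv l).
Proof.
move=> h; rewrite cabs_joukowski_invE; under eq_fun do rewrite cabs_joukowski_invE.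
have hC : (cabs (f x - 1) + cabs (f x + 1)) / 2 @[x --> F] --> (cabs (l - 1) + cabs (l + 1)) / 2.
  apply: cvgM; last exact: cvg_cst.
  by apply: cvgD; apply: ccvg_cabs; apply: ccvgD => //; exact: ccvg_cst.
apply: cvgB; first exact: hC.
have h2 : ((cabs (f x - 1) + cabs (f x + 1)) / 2) ^+ 2 - 1 @[x --> F] -->
    ((cabs (l - 1) + cabs (l + 1)) / 2) ^+ 2 - 1.
  apply: cvgB; last exact: cvg_cst.
  by rewrite expr2; under eq_fun do rewrite expr2; apply: cvgM; exact: hC.
exact: (cvg_comp _ _ h2 (@sqrt_continuous R _)).
Qed.

Lemma cabs_joukowski_invV_bounds z :
  2 * cabs z - 1 <= (cabs (joukowski_inv z))^-1 <= 2 * cabs z + 2.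
Proof.
have := focal_sum z; have n1 := cabs_joukowski_inv_le1 z; have n0 := cabs_joukowski_inv_gt0 z.
have h1 : 2 * cabs z <= cabs (z - 1) + cabs (z + 1).
  have -> : 2 * cabs z = cabs ((z - 1) + (z + 1)).
    have -> : z - 1 + (z + 1) = (2 : R)%:C * z by rewrite rmorph_nat; ring.
    by rewrite cabsM cabs_real ger0_norm.
  exact: cabs_triangle.
have h2 : cabs (z - 1) <= cabs z + 1 by rewrite -cabs1 -(cabsN 1); exact: cabs_triangle.
have h3 : cabs (z + 1) <= cabs z + 1 by rewrite -cabs1; exact: cabs_triangle.
by move: (_^-1) => i h; apply/andP; split; lra.
Qed.

End JoukowskiModulus.

Section LogDeterminant.
Context {R : realType}.
Context (a b : R) (w : R[i]).
Hypotheses (a0 : a != 0) (b0 : b != 0).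
Let k4 : 0 < 4 * a ^+ 2 * b ^+ 2.
Proof. by apply: mulr_gt0; [apply: mulr_gt0 => //|]; rewrite exprn_even_gt0. Qed.
Let ab0 : 0 < `|a * b|. Proof. by rewrite normr_gt0 mulf_neq0. Qed.

(** A closed form for [e |-> tau (ln (x^* x + e))]. *)
Definition log_potential (e : R) : R := ln `|a * b| - ln (cabs (joukowski_inv (zeta a b w e))).

Lemma log_potential_derive (e : R) : 0 < e -> is_derive e 1 log_potential
  ((scale2 a b w + e) * arcsine_square (zeta a b w e) / (4 * a ^+ 2 * b ^+ 2)).
Proof.
move=> e0; have s0 := Im_zeta_gt0 w a0 b0 e0.
have c1 := cabs_joukowski_zeta w a0 b0 e0.
pose k := (scale2 a b w + e) / (4 * a ^+ 2 * b ^+ 2) / complex.Im (zeta a b w e).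
have dz : cderive_at (zeta a b w) e (0 +i* k).
  split => /=; first exact: is_derive_cst.
  have g0 := zeta_arg_gt0 w a0 b0 e0.
  pose g t := complex.Im (kappa a b w) ^+ 2 +
    (2 * scale2 a b w * t + t ^+ 2) / (4 * a ^+ 2 * b ^+ 2).
  have dg : is_derive e 1 g ((2 * scale2 a b w + 2 * e) / (4 * a ^+ 2 * b ^+ 2)).
    rewrite /g; apply: is_derive_eq; rewrite /GRing.scale /=; ring.
  have ds := @is_derive1_comp R Num.sqrt g e _ _ (is_derive1_sqrt g0) dg.
  apply: (is_derive_eq ds); rewrite /k /= -/(g e).
  have s1 : Num.sqrt (g e) != 0 by rewrite gt_eqF// sqrtr_gt0.
  by move: k4; set k' := (4 * _ * _) => k40; field; rewrite s1 gt_eqF.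
have dj := cderive_at_joukowski_inv dz c1.
have dl := is_derive_ln_cabs (joukowski_inv_neq0 _) dj.
apply: (is_derive_eq (is_deriveB (is_derive_cst (ln `|a * b|) e 1) dl)); rewrite sub0r.
have j0 := joukowski_inv_neq0 (zeta a b w e).
have -> : - (joukowski_inv (zeta a b w e) * arcsine_cauchy (zeta a b w e) * (0 +i* k)) /
   joukowski_inv (zeta a b w e) = - (arcsine_cauchy (zeta a b w e) * (0 +i* k)) by field.
rewrite ReN opprK ReM /= mulr0 sub0r -mulNr -arcsine_squareE// /k.
move: s0 (arcsine_square _) k4 => /=; set s := Num.sqrt _ => s0 T k40.
have s1 : s != 0 by rewrite gt_eqF.
move: k40; set k' := (4 * _ * _) => k40; have k1 : k' != 0 by rewrite gt_eqF.
by field; apply/andP.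
Qed.

Lemma log_potential_right : log_potential e @[e --> (0 : R)^'+] -->
  (ln `|a * b| - ln (cabs (joukowski_inv (kappa a b w)))).
Proof.
have E : cabs (joukowski_inv (kappa a b w)) = cabs (joukowski_inv (zeta a b w 0)).
  rewrite !cabs_joukowski_invE zeta0 /cabs !ReD !ImD !ReN !ImN /= !oppr0 !addr0.
  by rewrite real_normK ?num_real.
rewrite E; apply: cvgB; first exact: cvg_cst.
have h : cabs (joukowski_inv (zeta a b w e)) @[e --> (0 : R)^'+] -->
    cabs (joukowski_inv (zeta a b w 0)).
  exact: (cabs_joukowski_inv_cvg (zeta_right_ccvg a b w)).
have lc := continuous_ln (cabs_joukowski_inv_gt0 (zeta a b w 0)).
exact: (cvg_comp _ _ h lc).
Qed.

(** For large [t] the modulus of [zeta] is [t / (2 |a b|)] up to a bounded error, and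
[1 / |joukowski_inv zeta|] is [2 |zeta|] up to a bounded error. *)
Lemma log_potential_infty : log_potential t - ln t @[t --> +oo] --> (0 : R).
Proof.
pose S := scale2 a b w; have S0 : 0 < S by exact: scale2_gt0.
pose d := 2 * `|a * b|; have d0 : 0 < d by rewrite mulr_gt0.
pose K := S + d * (`|complex.Im (kappa a b w)| + `|complex.Re (kappa a b w)| + 2).
have K0 : 0 < K by rewrite addr_gt0// mulr_gt0// ltr_wpDl// addr_ge0.
have k4E : 4 * a ^+ 2 * b ^+ 2 = d ^+ 2.
  by rewrite /d exprMn real_normK ?num_real//; ring.
pose n t := cabs (joukowski_inv (zeta a b w t)).
have n0 t : 0 < n t := cabs_joukowski_inv_gt0 _.
have bound t : 0 < t -> 1 - K / t <= `|a * b| / (n t * t) <= 1 + K / t.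
  move=> t0; have /andP[l1 l2] := cabs_joukowski_invV_bounds (zeta a b w t).
  set s := Num.sqrt (complex.Im (kappa a b w) ^+ 2 + (2 * S * t + t ^+ 2) / d ^+ 2).
  have sE : complex.Im (zeta a b w t) = s by rewrite /zeta /= k4E.
  have s1 : t / d <= s.
    have p0 : 0 <= t / d by rewrite divr_ge0 ?ltW.
    rewrite -[leLHS]ger0_norm// -sqrtr_sqr /s ler_wsqrtr//.
    rewrite expr_div_n ler_wpDl ?sqr_ge0// ler_pM2r ?invr_gt0 ?exprn_gt0//.
    by rewrite lerDr; apply: ltW; apply: mulr_gt0 => //; apply: mulr_gt0.
  have s2 : s <= (t + S) / d + `|complex.Im (kappa a b w)|.
    have p0 : 0 <= (t + S) / d by apply: ltW; rewrite divr_gt0// addr_gt0.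
    rewrite -[leRHS]ger0_norm ?addr_ge0// -sqrtr_sqr /s ler_wsqrtr//.
    rewrite sqrrD real_normK ?num_real// addrC lerD2r expr_div_n.
    apply: (@le_trans _ _ ((t + S) ^+ 2 / d ^+ 2)); last first.
      by rewrite lerDl mulrn_wge0// mulr_ge0.
    rewrite ler_pM2r ?invr_gt0 ?exprn_gt0//; have := sqr_ge0 S; lra.
  have z1 : s <= cabs (zeta a b w t).
    by rewrite -sE; apply: le_trans (ler_Im_cabs _); rewrite ler_norm.
  have z2 : cabs (zeta a b w t) <= `|complex.Re (kappa a b w)| + s.
    have := ler_cabs_ReIm (zeta a b w t); rewrite sE (@ger0_norm _ s) ?sqrtr_ge0//.
  have -> : `|a * b| / (n t * t) = d / 2 * (n t)^-1 / t.
    by rewrite /d invfM; field; rewrite !gt_eqF.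
  rewrite -/(n t) in l1 l2; set i := (n t)^-1 in l1 l2 *.
  have -> : 1 - K / t = (t - K) / t by rewrite mulrBl divff// gt_eqF.
  have -> : 1 + K / t = (t + K) / t by field; rewrite gt_eqF.
  rewrite !ler_pM2r ?invr_gt0//.
  move: s1 s2; rewrite ler_pdivrMr// => s1 s2.
  have s3 : s * d <= t + S + `|complex.Im (kappa a b w)| * d.
    move: s2; rewrite -(ler_pM2r d0) mulrDl divfK// gt_eqF//.
  have i1 : d * (2 * s - 1) <= d * i by rewrite ler_pM2l//; lra.
  have i2 : d * i <= d * (2 * (`|complex.Re (kappa a b w)| + s) + 2) by rewrite ler_pM2l//; lra.
  have := mulr_ge0 (ltW d0) (normr_ge0 (complex.Re (kappa a b w))).
  have := mulr_ge0 (ltW d0) (normr_ge0 (complex.Im (kappa a b w))).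
  by rewrite /K => p1 p2; apply/andP; split; lra.
have inv0 : K / t @[t --> +oo] --> (0 : R).
  rewrite -[X in _ --> X](mulr0 K); apply: cvgM; first exact: cvg_cst.
  by apply/gtr0_cvgV0; [near=> t; near: t; exact: nbhs_pinfty_gt|exact: cvg_id].
have lim1 : `|a * b| / (n t * t) @[t --> +oo] --> (1 : R).
  apply: (@squeeze_cvgr _ _ _ _ (fun t => 1 - K / t) (fun t => 1 + K / t)).
  - by near=> t; apply: bound; near: t; exact: nbhs_pinfty_gt.
  - by rewrite -[X in _ --> X]subr0; apply: cvgB => //; exact: cvg_cst.
  - by rewrite -[X in _ --> X]addr0; apply: cvgD => //; exact: cvg_cst.
have ln1c := cvg_comp _ _ lim1 (continuous_ln (@ltr01 R)).
rewrite ln1 in ln1c; apply: cvg_trans ln1c; apply: near_eq_cvg; near=> t.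
have t0 : 0 < t by near: t; exact: nbhs_pinfty_gt.
rewrite /= /log_potential -/(n t) ln_div ?posrE ?mulr_gt0// lnM ?posrE//; ring.
Unshelve. all: by end_near.
Qed.

End LogDeterminant.

Lemma FK_det_model {R : realType} {M : vonNeumannAlgebra R} {tau : M -> R[i]} (u v x : M)
    (a b : R) (w : R[i]) (D : \bar R) :
  faithful_normal_tracial_state tau -> free_symmetries (tau := tau) u v ->
  a != 0 -> b != 0 -> x = model u v a b w -> FK_det tau x D ->
  lne D = ((ln `|a * b| - ln (cabs (joukowski_inv (kappa a b w)))) / 2)%:E.
Proof.
move=> htau huv a0 b0 xE hD.
have ex e : exists Q : M, 0 < e -> Q * (star x * x + e%:C%:A) = 1 /\
    complex.Re (tau Q) = (scale2 a b w + e) * arcsine_square (zeta a b w e) / (4 * a ^+ 2 * b ^+ 2).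
  have [e0|e0] := ltP 0 e; last by exists 0.
  have [Q [h1 _ h2 _]] := model_resolvent htau w huv a0 b0 e0.
  by exists Q => _; rewrite xE h1 h2.
have [Q hQ] := choice ex.
apply: (FK_det_resolvent htau hD (Q := Q) (Phi := log_potential a b w)).
- by move=> e e0; have [] := hQ e e0.
- by move=> e e0; have [_ ->] := hQ e e0; exact: log_potential_derive.
- exact: log_potential_infty.
- exact: log_potential_right.
Qed.
(** * Radial test functions *)

Section Flat.
Context {R : realType}.
Implicit Types (n : nat) (x t : R).

(** The functions [x^-n e^(-1/x)] extended by 0, a family stable under derivation. *)
Definition flat n x : R := if 0 < x then x ^- n * expR (- x^-1) else 0.

Lemma flat_le0 n x : x <= 0 -> flat n x = 0.
Proof. by rewrite /flat leNgt => /negbTE ->. Qed.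

Lemma flat_gt0 n x : 0 < x -> 0 < flat n x.
Proof. by move=> x0; rewrite /flat x0 mulr_gt0 ?expR_gt0// invr_gt0 exprn_gt0. Qed.

Lemma flat_ge0 n x : 0 <= flat n x.
Proof. by have [/flat_le0 ->//|/(flat_gt0 n)/ltW] := leP x 0. Qed.

Lemma flatS n x : x * flat n.+1 x = flat n x.
Proof.
rewrite /flat; case: ifP => [x0|]; last by rewrite mulr0.
by rewrite exprS invfM !mulrA divff ?gt_eqF// mul1r.
Qed.

(** The exponential dominates its term of degree [n + 2]; quadratic decay at 0 makes
the derivative at 0 vanish. *)
Lemma flat_bound n : exists2 k, 0 < k & forall x, flat n x <= k * x ^+ 2.
Proof.
pose k : R := (n.+2)%:R ^+ n.+2.
have k0 : 0 < k by rewrite exprn_gt0.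
exists k => // x; have [x0|x0] := leP x 0; first by rewrite flat_le0// mulr_ge0 ?sqr_ge0// ltW.
rewrite /flat x0 expRN.
have e : (n.+2%:R * x)^-1 ^+ n.+2 <= expR (x^-1).
  have -> : x^-1 = (n.+2%:R * x)^-1 * n.+2%:R by rewrite invfM mulrAC mulVf ?mul1r.
  have p0 : 0 <= (n.+2%:R * x)^-1 by rewrite invr_ge0 mulr_ge0// ltW.
  rewrite expRM_natr lerXn2r ?nnegrE ?expR_ge0//.
  by apply: le_trans (expR_ge1Dx _); rewrite lerDr.
have p0 : 0 < n.+2%:R * x by rewrite mulr_gt0.
rewrite exprVn in e.
have e2 : (expR x^-1)^-1 <= (n.+2%:R * x) ^+ n.+2.
  by rewrite -[leRHS]invrK lef_pV2 ?posrE ?expR_gt0 ?invr_gt0 ?exprn_gt0.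
apply: (@le_trans _ _ (x ^- n * (n.+2%:R * x) ^+ n.+2)).
  by rewrite ler_pM2l// invr_gt0 exprn_gt0.
rewrite exprMn mulrCA -/k ler_pM2l// -addn2 exprD mulKf// expf_neq0// gt_eqF//.
Qed.

Lemma is_derive_flat n x :
  is_derive x 1 (flat n) (flat n.+2 x - n%:R * flat n.+1 x).
Proof.
have [x0|x0|->] := ltgtP x 0.
- rewrite !flat_le0 ?ltW// mulr0 subr0.
  have c0 : (fun=> (0 : R)) @ (0 : R)^' --> (0 : R) by exact: cvg_cst.
  apply/is_derive_cvg; apply: cvg_trans c0; apply: near_eq_cvg; near=> e.
  have : `|e| < - x by near: e; apply: dnbhs0_lt; rewrite oppr_gt0.
  move=> he; rewrite !flat_le0 ?subrr ?mulr0 ?ltW//.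
  by have := ler_norm e; lra.
- have xn0 : x != 0 by rewrite gt_eqF.
  have d : is_derive x 1 (fun t => t ^- n * expR (- t^-1))
      (flat n.+2 x - n%:R * flat n.+1 x).
    have d1 := is_deriveV xn0 (is_derive_id x (1 : R)).
    have d3 := @is_derive1_comp R expR _ x _ _ (is_derive_expR _) (is_deriveN d1).
    have d4 := is_deriveX n d1.
    have d5 := is_deriveM d4 d3.
    have E : (fun t => t ^- n * expR (- t^-1)) =
        ([eta GRing.inv] : R -> R) ^+ n * (expR \o - ([eta GRing.inv] : R -> R)).
      by apply/funext => t; rewrite mulrfctE exprfctE /= exprVn.
    rewrite E; apply: (is_derive_eq d5); rewrite /flat x0 /GRing.scale /= exprfctE /= !mulr1.
    have -> : (- ([eta GRing.inv] : R -> R)) x = - x^-1 by [].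
    rewrite -!exprVn; move: (expR (- x^-1)) => y; move: x^-1 => i.
    by case: n {d4 d5 E} => [|n]; rewrite /= ?expr0 !exprS; ring.
  apply/is_derive_cvg; move/is_derive_cvg : d; apply: cvg_trans.
  apply: near_eq_cvg; near=> e.
  have : `|e| < x by near: e; apply: dnbhs0_lt.
  move=> he; have ex : 0 < e + x by have := ler_norm (- e); rewrite normrN; lra.
  by rewrite /flat x0 ex.
- rewrite !flat_le0// mulr0 subr0; apply/is_derive_cvg.
  have [k k0 hk] := flat_bound n.
  apply: norm_cvg0; apply: (@squeeze_cvgr _ _ _ _ (fun=> 0) (fun e => k * `|e|)).
  + near=> e; rewrite normr_ge0 /= addr0 (flat_le0 n (lexx 0)) subr0 normrM normfV (ger0_norm (flat_ge0 _ _)).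
    have e0 : 0 < `|e| by rewrite normr_gt0; near: e; exact: nbhs_dnbhs_neq.
    rewrite ler_pdivrMl//; apply: le_trans (hk e) _.
    by rewrite [leRHS]mulrCA -normrM -expr2 ger0_norm ?sqr_ge0.
  + exact: cvg_cst.
  + rewrite -[X in _ --> X](mulr0 k); apply: cvgM; first exact: cvg_cst.
    have h : `|e| @[e --> (0 : R)] --> `|0 : R| by apply: cvg_norm; exact: cvg_id.
    by rewrite normr0 in h; exact: cvg_within_filter h.
Unshelve. all: by end_near.
Qed.

Lemma flat_sum_le1 x : flat 0%N x + flat 1%N x <= 1.
Proof.
have [x0|x0] := leP x 0; first by rewrite !flat_le0// addr0.
rewrite /flat x0 expr0 invr1 mul1r expr1 expRN -[X in X + _]mul1r -mulrDl.
rewrite ler_pdivrMr ?expR_gt0// mul1r; exact: expR_ge1Dx.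
Qed.

Lemma continuous_flat n : continuous (flat n).
Proof.
move=> x; have [d _] := is_derive_flat n x.
exact: differentiable_continuous ((derivable1_diffP _ _).1 d).
Qed.

End Flat.

Section DirectionalDerivatives.
Context {R : realType}.

(** A directional derivative is a derivative along a line. *)
Lemma is_derive_line (f : R * R -> R) z v d :
  is_derive z v f d <-> is_derive (0 : R) 1 (fun t => f (t *: v + z)) d.
Proof.
have E : (fun h : R => h^-1 *: (f (h *: v + z) - f z)) =
   (fun h : R => h^-1 *: ((fun t => f (t *: v + z)) (h *: 1 + 0) - (fun t => f (t *: v + z)) 0)).
  by apply/funext => h /=; rewrite scale0r add0r addr0 [h *: 1]mulr1.
by split=> -[h1 h2]; split; rewrite /derivable /derive ?E// -?E// in h1 h2 *.
Qed.

Lemma is_derive_comp_real (g : R -> R) (f : R * R -> R) z v d d' :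
  is_derive z v f d -> is_derive (f z) 1 g d' -> is_derive z v (fun z => g (f z)) (d' * d).
Proof.
move=> /is_derive_line df dg; apply/is_derive_line.
pose h (t : R) := f (t *: v + z).
have h0 : h 0 = f z by rewrite /h scale0r add0r.
rewrite -h0 in dg; exact: (@is_derive1_comp R g h 0 _ _ dg df).
Qed.

End DirectionalDerivatives.

Section RadialBump.
Context {R : realType}.
Context (z0 : R * R) (del rho : R).
Hypotheses (del0 : 0 < del) (rho0 : 0 < rho).
Implicit Types (z v : R * R).

(** Syntax for a class of functions on the plane that contains the bump and is stable
under directional derivatives, so that smoothness follows by induction on the list
of directions. *)
Inductive rexpr : Type :=
  | RCst of R | RX | RY | RInv | RLog | RFlat of nat
  | RAdd of rexpr & rexpr | RMul of rexpr & rexpr.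

Definition sqdist z : R := (z.1 - z0.1) ^+ 2 + (z.2 - z0.2) ^+ 2.

Fixpoint reval (e : rexpr) z : R :=
  match e with
  | RCst c => c
  | RX => z.1 - z0.1
  | RY => z.2 - z0.2
  | RInv => (sqdist z + del)^-1
  | RLog => ln (rho * (sqdist z + del)^-1)
  | RFlat n => flat n (ln (rho * (sqdist z + del)^-1))
  | RAdd e1 e2 => reval e1 z + reval e2 z
  | RMul e1 e2 => reval e1 z * reval e2 z
  end.

(** The derivative of [sqdist] in the direction [v]. *)
Definition rsqd v := RAdd (RMul (RCst (2 * v.1)) RX) (RMul (RCst (2 * v.2)) RY).
(** The derivative of [RLog] in the direction [v]. *)
Definition rlogd v := RMul (RMul (RCst (- 1)) RInv) (rsqd v).

Fixpoint rderive v (e : rexpr) : rexpr :=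
  match e with
  | RCst _ => RCst 0
  | RX => RCst v.1
  | RY => RCst v.2
  | RInv => RMul RInv (rlogd v)
  | RLog => rlogd v
  | RFlat n => RMul (RAdd (RFlat n.+2) (RMul (RCst (- n%:R)) (RFlat n.+1))) (rlogd v)
  | RAdd e1 e2 => RAdd (rderive v e1) (rderive v e2)
  | RMul e1 e2 => RAdd (RMul e1 (rderive v e2)) (RMul (rderive v e1) e2)
  end.

Lemma sqdist_ge0 z : 0 <= sqdist z. Proof. by rewrite addr_ge0 ?sqr_ge0. Qed.

Let sd0 z : 0 < sqdist z + del. Proof. by rewrite ltr_wpDl// sqdist_ge0. Qed.

Let dX z v : is_derive z v (fun z => z.1 - z0.1) v.1.
Proof.
apply/is_derive_line => /=; apply: is_derive_eq; rewrite /GRing.scale /=; ring.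
Qed.

Let dY z v : is_derive z v (fun z => z.2 - z0.2) v.2.
Proof.
apply/is_derive_line => /=; apply: is_derive_eq; rewrite /GRing.scale /=; ring.
Qed.

Let dsq z v : is_derive z v (fun z => sqdist z + del) (reval (rsqd v) z).
Proof.
have h1 := is_deriveM (dX z v) (dX z v); have h2 := is_deriveM (dY z v) (dY z v).
have E : (fun z => sqdist z + del) = ((fun z => z.1 - z0.1) * (fun z => z.1 - z0.1)) +
  ((fun z => z.2 - z0.2) * (fun z => z.2 - z0.2)) + cst del :> (R * R -> R).
  by apply/funext => y; rewrite /sqdist !expr2.
rewrite E; apply: (is_derive_eq (is_deriveD (is_deriveD h1 h2) (is_derive_cst del z v))).
by rewrite /GRing.scale /=; ring.
Qed.

Let dinv z v : is_derive z v (reval RInv) (reval (rderive v RInv) z).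
Proof.
have n0 : sqdist z + del != 0 by rewrite gt_eqF.
have dV : is_derive (sqdist z + del) (1 : R) (fun t : R => t^-1) (- (sqdist z + del) ^- 2).
  apply: (is_derive_eq (@is_deriveV R id _ _ _ n0 (is_derive_id (sqdist z + del) (1 : R)))).
  by rewrite /GRing.scale /= mulr1.
apply: (is_derive_eq (is_derive_comp_real (dsq z v) dV)) => /=.
by move: (sqdist z + del) n0 => s n0; field.
Qed.

Let dlog z v : is_derive z v (reval RLog) (reval (rderive v RLog) z).
Proof.
have p0 : 0 < rho * (sqdist z + del)^-1 by rewrite mulr_gt0// invr_gt0.
have h := is_deriveM (is_derive_cst rho z v) (dinv z v).
apply: (is_derive_eq (is_derive_comp_real h (is_derive1_ln p0))).
rewrite /GRing.scale /= mulr0 addr0.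
have n0 : sqdist z + del != 0 by rewrite gt_eqF.
move: (sqdist z + del) n0 => s n0; field; by rewrite n0 gt_eqF.
Qed.

Lemma is_derive_reval e z v : is_derive z v (reval e) (reval (rderive v e) z).
Proof.
elim: e => [c|||||n|e1 ih1 e2 ih2|e1 ih1 e2 ih2].
- exact: is_derive_cst.
- exact: dX.
- exact: dY.
- exact: dinv.
- exact: dlog.
- apply: (is_derive_eq (is_derive_comp_real (dlog z v) (is_derive_flat n _))).
  by rewrite /=; ring.
- exact: is_deriveD.
- apply: (is_derive_eq (is_deriveM ih1 ih2)); rewrite /GRing.scale /=; ring.
Qed.

Lemma continuous_sqdist : continuous sqdist.
Proof.
move=> z; apply: cvgD; apply: cvgM; apply: cvgB; try exact: cvg_cst.
- exact: cvg_fst. - exact: cvg_fst. - exact: cvg_snd. - exact: cvg_snd.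
Qed.

Lemma continuous_reval e : continuous (reval e).
Proof.
have ci : continuous (reval RInv).
  move=> z; apply: cvgV; first by rewrite gt_eqF.
  by apply: cvgD; [exact: continuous_sqdist|exact: cvg_cst].
have cl : continuous (reval RLog).
  move=> z; have p0 : 0 < rho * (sqdist z + del)^-1 by rewrite mulr_gt0// invr_gt0.
  have h : rho * (sqdist y + del)^-1 @[y --> z] --> rho * (sqdist z + del)^-1.
    by apply: cvgM; [exact: cvg_cst|exact: ci].
  exact: (cvg_comp _ _ h (continuous_ln p0)).
elim: e => [c|||||n|e1 ih1 e2 ih2|e1 ih1 e2 ih2] z.
- exact: cvg_cst.
- by apply: cvgB; [exact: cvg_fst|exact: cvg_cst].
- by apply: cvgB; [exact: cvg_snd|exact: cvg_cst].
- exact: ci.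
- exact: cl.
- exact: (cvg_comp _ _ (cl z) (@continuous_flat R n _)).
- by apply: cvgD; [exact: ih1|exact: ih2].
- by apply: cvgM; [exact: ih1|exact: ih2].
Qed.

Lemma iter_derive_reval vs e : iter_derive vs (reval e) = reval (foldr rderive e vs).
Proof.
elim: vs => [//|v vs ih] /=; rewrite /iter_derive /= -/(iter_derive vs (reval e)) ih.
by apply/funext => z; have [_] := is_derive_reval (foldr rderive e vs) z v.
Qed.

Lemma smooth_reval e : smooth (reval e).
Proof.
move=> vs; rewrite iter_derive_reval; split; first exact: continuous_reval.
by move=> z v; have [] := is_derive_reval (foldr rderive e vs) z v.
Qed.

Definition radial_log z : R := ln (rho / (sqdist z + del)).

(** With [G = ln (rho / (|z - z0|^2 + del))], the function [Psi (G)] for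
[Psi (x) = x e^(-1/x)], which is supported in the disk of squared radius [rho].
The function [Psi] is increasing and convex. *)
Definition bump : R * R -> R := reval (RMul RLog (RFlat 0%N)).

Lemma bumpE z : bump z = radial_log z * flat 0%N (radial_log z).
Proof. by []. Qed.

Lemma radial_log_gt0 z : (0 < radial_log z) = (sqdist z + del < rho).
Proof. by rewrite /radial_log -ln1 ltr_ln ?posrE ?divr_gt0// ltr_pdivlMr// mul1r. Qed.

Lemma bump_ge0 z : 0 <= bump z.
Proof.
rewrite bumpE; have [h|h] := leP (radial_log z) 0; first by rewrite flat_le0// mulr0.
by rewrite mulr_ge0 ?flat_ge0// ltW.
Qed.

Lemma bump_gt0 z : sqdist z + del < rho -> 0 < bump z.
Proof. by rewrite -radial_log_gt0 bumpE => h; rewrite mulr_gt0// flat_gt0. Qed.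

Lemma bump_eq0 z : rho <= sqdist z -> bump z = 0.
Proof.
move=> h; rewrite bumpE flat_le0 ?mulr0// leNgt radial_log_gt0 -leNgt.
by rewrite (le_trans h)// lerDl ltW.
Qed.

(** The logarithm [G] has gradient of squared length [4 s / (s + del)^2] and Laplacian
[- 4 del / (s + del)^2], where [s] is the squared distance; these are multiplied by
the second and the first derivative of [x e^(-1/x)]. *)
Lemma laplacian_bump z : laplacian bump z =
  flat 3%N (radial_log z) * (4 * sqdist z / (sqdist z + del) ^+ 2) -
  (flat 0%N (radial_log z) + flat 1%N (radial_log z)) * (4 * del / (sqdist z + del) ^+ 2).
Proof.
rewrite /laplacian /bump !iter_derive_reval /= -/(radial_log z) /=.
have n0 : sqdist z + del != 0 by rewrite gt_eqF.
have <- := flatS 0%N (radial_log z); have <- := flatS 1%N (radial_log z).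
have <- := flatS 2%N (radial_log z); have <- := flatS 3%N (radial_log z).
move: (radial_log z) => G; move: (flat 4%N G) => F.
rewrite /sqdist in n0 *; field; exact: n0.
Qed.

Lemma test_function_bump : test_function bump.
Proof.
split; first exact: smooth_reval.
pose r := rho + 1.
exists ([set` `[z0.1 - r, z0.1 + r]%R] `*` [set` `[z0.2 - r, z0.2 + r]%R]).
  by apply: compact_setX; exact: segment_compact.
move=> z hz; apply: bump_eq0; rewrite leNgt; apply/negP => hs; apply: hz.
have r0 : 0 <= r by rewrite addr_ge0// ltW.
have rr : rho <= r ^+ 2 by rewrite /r; have := sqr_ge0 rho; have := rho0; nra.
have key (x y : R) : (x - y) ^+ 2 <= sqdist z -> x \in `[y - r, y + r]%R.
  move=> h; have : `|x - y| <= r.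
    rewrite -(@ler_pXn2r _ 2) ?nnegrE// real_normK ?num_real//.
    by apply: (le_trans h); apply: le_trans rr; exact: ltW.
  by rewrite in_itv /= ler_distl.
by split => /=; apply: key; rewrite /sqdist ?lerDl ?lerDr sqr_ge0.
Qed.

End RadialBump.

(** * Integration on the plane *)

Section PlaneMeasure.
Context {R : realType}.
Local Notation plane := (measurableTypeR R * measurableTypeR R)%type.
Local Notation leb := (@lebesgue_measure R).

(** Rational squares form a countable base of the topology. *)
Lemma open_measurable_plane (U : set (R * R)) : open U -> measurable (U : set plane).
Proof.
move=> oU.
pose B (q : rat * rat * nat) : set (R * R) :=
  ball (ratr q.1.1 : R) (q.2.+1%:R^-1) `*` ball (ratr q.1.2 : R) (q.2.+1%:R^-1).
pose F q := if `[< B q `<=` U >] then B q else set0.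
have -> : U = \bigcup_q F q.
  apply/seteqP; split => [z Uz|z [q _]]; last by rewrite /F; case: asboolP => // h; exact: h.
  have [e /= e0 he] : exists2 e : R, 0 < e & ball z e `<=` U.
    by have /nbhs_ballP[e e0 he] := open_nbhs_nbhs (conj oU Uz); exists e.
  have [n hn] : exists n : nat, n.+1%:R^-1 < e / 2.
    have := near_infty_natSinv_lt (PosNum (divr_gt0 e0 (ltr0Sn R 1))) => -[n _ hn].
    by exists n; exact: hn (leqnn n).
  have n0 : 0 < n.+1%:R^-1 :> R by rewrite invr_gt0.
  have ratnear (t : R) : exists q : rat, `|ratr q - t| < n.+1%:R^-1.
    have [|q] := @rat_in_itvoo R (t - n.+1%:R^-1) (t + n.+1%:R^-1).
      by rewrite ltrBlDr -addrA ltrDl addr_gt0.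
    by rewrite in_itv /= -ltr_distl => h; exists q.
  have [q1 h1] := ratnear z.1; have [q2 h2] := ratnear z.2.
  exists (q1, q2, n) => //; rewrite /F asboolT; first by split; rewrite /ball /=.
  have close (q : rat) (s t : R) : `|ratr q - s| < n.+1%:R^-1 -> `|ratr q - t| < n.+1%:R^-1 ->
      `|s - t| < e.
    rewrite -(distrC s) => k1 k2; apply: (le_lt_trans (ler_distD (ratr q) _ _)).
    by rewrite [ltRHS](splitr e); apply: ltrD; [exact: lt_trans hn|exact: lt_trans hn].
  move=> y [y1 y2]; apply: he; split; [exact: close h1 y1|exact: close h2 y2].
apply: countable_bigcupT_measurable; first exact: countableP.
move=> q; rewrite /F; case: asboolP => // _.
by apply: measurableX; exact: measurable_ball.
Qed.

Lemma continuous_measurable_plane (f : R * R -> R) : continuous f ->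
  measurable_fun [set: plane] (f : plane -> measurableTypeR R).
Proof.
move=> /continuousP cf; apply: (measurability _ (RGenOpens.measurableE R)).
move=> _ [_ [a [b ->] <-]]; rewrite setTI; apply: open_measurable_plane.
exact/cf/interval_open.
Qed.

Definition square (r : R) : set (R * R) := [set` `[- r, r]%R] `*` [set` `[- r, r]%R].

Lemma measurable_square r : measurable (square r : set plane).
Proof. by apply: measurableX; exact: measurable_itv. Qed.

Lemma square_finite r : ((leb \x leb)%E (square r) < +oo)%E.
Proof.
rewrite product_measure1E; [|exact: measurable_itv..].
have fin : leb [set` `[- r, r]%R] \is a fin_num.
  by rewrite lebesgue_measure_itv /=; case: ifP => _; rewrite ?fin_num0// -EFinB.
by rewrite ltey_eq fin_numM.
Qed.

(** A continuous function vanishing outside a compact set is bounded and supported in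
a set of finite measure. *)
Lemma integrable_square (f : R * R -> R) r : continuous f ->
  (forall z, ~ square r z -> f z = 0) ->
  (leb \x leb)%E.-integrable [set: plane] (EFin \o f).
Proof.
move=> cf f0.
have -> : EFin \o f = ((EFin \o f) \_ (square r)).
  apply/funext => z; rewrite patchE; case: ifPn => // /negP h.
  by rewrite /= f0// => hz; apply: h; rewrite inE.
apply/(integrable_mkcond _ (measurable_square r)).
apply: measurable_bounded_integrable.
- exact: measurable_square.
- exact: square_finite.
- by apply: measurable_funS (continuous_measurable_plane cf).
- have ck : compact (f @` square r).
    apply: continuous_compact; first by apply: continuous_subspaceT.
    by apply: compact_setX; exact: segment_compact.
  have [M [Mr hM]] := compact_bounded ck.
  by exists M; split => // k Mk z hz; apply: hM => //; exists z.
Qed.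

End PlaneMeasure.

Section GreenIdentity.
Context {R : realType}.
Local Notation leb := (@lebesgue_measure R).
Local Notation e1 := ((1, 0) : R * R).
Local Notation e2 := ((0, 1) : R * R).

Lemma integral_derivative_eq0 (W F : R -> R) (r : R) : 0 < r -> continuous F ->
  (forall t : R, is_derive t 1 W (F t)) -> (forall t, r <= `|t| -> W t = 0 /\ F t = 0) ->
  (\int[leb]_t (F t)%:E = 0)%E.
Proof.
move=> r0 cF dW out.
have cW : continuous W.
  by move=> t; have [d _] := dW t; exact: differentiable_continuous ((derivable1_diffP _ _).1 d).
have E : (\int[leb]_(t in `[(- r)%R, r]) (F t)%:E = \int[leb]_t (F t)%:E)%E.
  rewrite integral_mkcond; apply: eq_integral => t _; rewrite patchE.
  case: ifPn => // /negP ht; have [|_ ->//] := out t.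
  rewrite leNgt; apply/negP => h; apply: ht; rewrite inE /= in_itv /= -ler_norml; exact: ltW.
rewrite -E (@continuous_FTC2 _ F W).
- have [|-> _] := out r; first by rewrite ler_norm.
  have [|-> _] := out (- r); first by rewrite normrN ler_norm.
  by rewrite subee.
- by rewrite gtrN.
- exact: continuous_subspaceT.
- split.
  + by move=> t _; have [] := dW t.
  + by apply: cvg_at_right_filter; exact: cW.
  + by apply: cvg_at_left_filter; exact: cW.
- by move=> t _; rewrite derive1E; have [_] := dW t.
Qed.

Lemma square_out r (x y : R) : (r < `|x|) || (r < `|y|) -> ~ square r (x, y).
Proof.
by move=> h [/=]; rewrite !in_itv /= -!ler_norml => h1 h2; move: h; rewrite !ltNge h1 h2.
Qed.

(** Integrate first in the direction of the derivative. *)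
Lemma integral_plane_derivative_x (W F : R * R -> R) (r : R) : 0 < r -> continuous F ->
  (forall z, is_derive z e1 W (F z)) -> (forall z, ~ square r z -> W z = 0 /\ F z = 0) ->
  (\int[(leb \x leb)%E]_z (F z)%:E = 0)%E.
Proof.
move=> r0 cF dW out.
have iF : (leb \x leb)%E.-integrable setT (EFin \o F).
  by apply: (@integrable_square _ _ r) => // z /out[].
have := integral21_prod_meas1 iF; rewrite /fubini_G /= => <-.
rewrite -[RHS](integral0 leb setT); apply: eq_integral => y _.
apply: (@integral_derivative_eq0 (fun t => W (t, y)) (fun t => F (t, y)) (r + 1)).
- by rewrite addr_gt0.
- move=> t; apply: (@continuous_comp _ _ _ (fun t => (t, y)) F); last exact: cF.
  by move=> A; apply: (cvg_pair cvg_id (cvg_cst y)).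
- move=> t; have /is_derive_line/is_derive_cvg h := dW (t, y); apply/is_derive_cvg.
  apply: cvg_trans h; apply: near_eq_cvg; apply: nearW => s /=.
  rewrite scale0r add0r !addr0 [s *: (1, 0)]/GRing.scale /= /scale_pair /=.
  by congr (_ * (W _ - W _)); congr pair; rewrite /GRing.scale /= ?mulr0 ?mul0r ?mulr1 ?add0r.
- move=> t ht; apply: out; apply: square_out; apply/orP; left.
  by apply: lt_le_trans ht; rewrite ltrDl.
Qed.

Lemma integral_plane_derivative_y (W F : R * R -> R) (r : R) : 0 < r -> continuous F ->
  (forall z, is_derive z e2 W (F z)) -> (forall z, ~ square r z -> W z = 0 /\ F z = 0) ->
  (\int[(leb \x leb)%E]_z (F z)%:E = 0)%E.
Proof.
move=> r0 cF dW out.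
have iF : (leb \x leb)%E.-integrable setT (EFin \o F).
  by apply: (@integrable_square _ _ r) => // z /out[].
have := integral12_prod_meas1 iF; rewrite /fubini_F /= => <-.
rewrite -[RHS](integral0 leb setT); apply: eq_integral => x _.
apply: (@integral_derivative_eq0 (fun t => W (x, t)) (fun t => F (x, t)) (r + 1)).
- by rewrite addr_gt0.
- move=> t; apply: (@continuous_comp _ _ _ (fun t => (x, t)) F); last exact: cF.
  by move=> A; apply: (cvg_pair (cvg_cst x) cvg_id).
- move=> t; have /is_derive_line/is_derive_cvg h := dW (x, t); apply/is_derive_cvg.
  apply: cvg_trans h; apply: near_eq_cvg; apply: nearW => s /=.
  rewrite scale0r add0r !addr0 [s *: (0, 1)]/GRing.scale /= /scale_pair /=.
  by congr (_ * (W _ - W _)); congr pair; rewrite /GRing.scale /= ?mulr0 ?mul0r ?mulr1 ?add0r.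
- move=> t ht; apply: out; apply: square_out; apply/orP; right.
  by apply: lt_le_trans ht; rewrite ltrDl.
Qed.

Section Vanishing.
Context (f : R * R -> R) (K : set (R * R)).
Hypotheses (cK : closed K) (f0 : forall z, ~ K z -> f z = 0).

Lemma near_outside z : ~ K z -> \forall y \near z, ~ K y.
Proof. by move=> nK; apply: open_nbhs_nbhs; split; [exact: closed_openC|]. Qed.

Lemma derive_outside v z : ~ K z -> 'D_v f z = 0.
Proof.
move=> nK; rewrite -(derive_cst (0 : R) z v); apply: near_eq_derive.
by near=> y; apply: f0; near: y; exact: near_outside.
Unshelve. all: by end_near.
Qed.

End Vanishing.

Lemma iter_derive_outside (f : R * R -> R) (K : set (R * R)) vs : closed K ->
  (forall z, ~ K z -> f z = 0) -> forall z, ~ K z -> iter_derive vs f z = 0.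
Proof.
by move=> cK f0; elim: vs => //= v vs ih; exact: derive_outside.
Qed.

(** Green's second identity for a compactly supported function and a function
[h] harmonic near its support: both mixed terms are exact derivatives. *)
Lemma integral_laplacian_harmonic (f h hx hy hxx : R * R -> R) (K V : set (R * R)) (r : R) :
  smooth f -> closed K -> open V -> K `<=` V -> 0 < r -> K `<=` square r ->
  (forall z, ~ K z -> f z = 0) -> continuous h ->
  (forall z, V z -> [/\ is_derive z e1 h (hx z), is_derive z e2 h (hy z),
     is_derive z e1 hx (hxx z), is_derive z e2 hy (- hxx z) & {for z, continuous hxx}]) ->
  (\int[(leb \x leb)%E]_z (laplacian f z * h z)%:E = 0)%E.
Proof.
move=> sf cK oV KV r0 Kr f0 ch hV.
pose D vs := iter_derive vs f.
have dD vs z v : is_derive z v (D vs) (D (v :: vs) z) by split; [have [_] := sf vs|].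
have cD vs : continuous (D vs) by have [] := sf vs.
have D0 vs z : ~ K z -> D vs z = 0 by move=> nK; exact: iter_derive_outside nK.
pose F v w z := D [:: v; v] z * h z - w * (f z * hxx z).
have cF v w : continuous (F v w).
  move=> z; have [Kz|nK] := pselect (K z).
    apply: cvgB; first by apply: cvgM; [exact: cD|exact: ch].
    apply: cvgM; first exact: cvg_cst.
    by apply: cvgM; [exact: (cD [::])|by have [] := hV _ (KV _ Kz)].
  have F0 y : ~ K y -> F v w y = 0 by move=> nKy; rewrite /F D0// f0// !mul0r mulr0 subr0.
  rewrite /continuous_at F0//; have c0 : (fun=> (0 : R)) @ z --> (0 : R) by exact: cvg_cst.
  apply: cvg_trans c0; apply: near_eq_cvg; near=> y; apply/esym/F0.
  by near: y; exact: near_outside.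
have key v w g : (forall z, V z -> is_derive z v h (g z) /\ is_derive z v g (w * hxx z)) ->
    forall z, is_derive z v (fun z => D [:: v] z * h z - f z * g z) (F v w z).
  move=> hg z; have [Kz|nK] := pselect (K z).
    have [h1 h2] := hg _ (KV _ Kz).
    apply: (is_derive_eq (is_deriveB (is_deriveM (dD [:: v] z v) h1) (is_deriveM (dD [::] z v) h2))).
    by rewrite /F /GRing.scale /=; ring.
  have -> : F v w z = 0 by rewrite /F D0// f0// !mul0r mulr0 subr0.
  apply: (near_eq_is_derive _ (is_derive_cst (0 : R) z v)).
  near=> y; have nKy : ~ K y by near: y; exact: near_outside.
  by rewrite D0// f0// !mul0r subr0.
have out v w g z : ~ square r z -> D [:: v] z * h z - f z * g z = 0 /\ F v w z = 0.
  move=> nz; have nK : ~ K z by move=> /Kr.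
  by rewrite /F !D0// f0// !mul0r mulr0 !subr0.
have I1 : (\int[(leb \x leb)%E]_z (F e1 1 z)%:E = 0)%E.
  apply: (integral_plane_derivative_x r0 (cF e1 1) (key e1 1 hx _)).
    by move=> z /hV[h1 h2 h3 h4 h5]; rewrite mul1r.
  exact: out.
have I2 : (\int[(leb \x leb)%E]_z (F e2 (- 1) z)%:E = 0)%E.
  apply: (integral_plane_derivative_y r0 (cF e2 (- 1)) (key e2 (- 1) hy _)).
    by move=> z /hV[h1 h2 h3 h4 h5]; rewrite mulN1r.
  exact: out.
have i1 : (leb \x leb)%E.-integrable setT (EFin \o F e1 1).
  by apply: (@integrable_square _ _ r) => // z /(out e1 1 hx)[].
have i2 : (leb \x leb)%E.-integrable setT (EFin \o F e2 (- 1)).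
  by apply: (@integrable_square _ _ r) => // z /(out e2 (- 1) hx)[].
have := integralD_EFin measurableT i1 i2; rewrite /= I1 I2 adde0 => <-.
apply: eq_integral => z _; rewrite -EFinD; congr (_%:E).
have -> : laplacian f z = D [:: e1; e1] z + D [:: e2; e2] z by [].
rewrite /F; move: (D [:: e1; e1] z) (D [:: e2; e2] z) (f z) (hxx z) (h z) => p q c d k.
by ring.
Unshelve. all: by end_near.
Qed.

End GreenIdentity.

(** * The logarithm of the determinant as a function of [z] *)

Section LogPotential.
Context {R : realType}.
Context (a b : R) (c : R * R).
Hypotheses (a0 : a != 0) (b0 : b != 0).
Implicit Types z v : R * R.
Local Notation e1 := ((1, 0) : R * R).
Local Notation e2 := ((0, 1) : R * R).
Local Notation w z := (toC z - toC c).
Local Notation K z := (kappa a b (w z)).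

(** The value of [ln Delta (z - X)], see [FK_det_model]. *)
Definition log_det z : R := (ln `|a * b| - ln (cabs (joukowski_inv (K z)))) / 2.

(** The constant in the derivative [w / (i a b)] of [kappa] with respect to [w]. *)
Let iab : R[i] := 0 +i* (a * b).
Let iab0 : iab != 0.
Proof. by rewrite eq_complex /= eqxx /= mulf_neq0. Qed.

(** The gradient of [log_det] in the form [d/dx - i d/dy]: a holomorphic function off
the arc, whose Cauchy-Riemann equations make [log_det] harmonic. *)
Definition log_det_grad z : R[i] := (2^-1 : R)%:C * arcsine_cauchy (K z) * (w z / iab).

Definition log_det_grad' z : R[i] := (2^-1 : R)%:C *
  (arcsine_cauchy_deriv (K z) * (w z / iab) * (w z / iab) + arcsine_cauchy (K z) / iab).

Let w_ccvg z : ccvg (nbhs z) (fun y => w y) (w z).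
Proof.
split; rewrite ?ReD ?ImD.
  under eq_fun do rewrite ReD; apply: cvgD; last exact: cvg_cst.
  exact: cvg_fst.
under eq_fun do rewrite ImD; apply: cvgD; last exact: cvg_cst.
exact: cvg_snd.
Qed.

Let K_ccvg z : ccvg (nbhs z) (fun y => K y) (K z).
Proof.
apply: ccvgM; last exact: ccvg_cst.
by apply: ccvgD; [apply: ccvg_sqr; exact: w_ccvg|exact: ccvg_cst].
Qed.

Lemma continuous_log_det : continuous log_det.
Proof.
move=> z; apply: cvgM; last exact: cvg_cst.
apply: cvgB; first exact: cvg_cst.
have h : cabs (joukowski_inv (K y)) @[y --> z] --> cabs (joukowski_inv (K z)).
  by apply: cabs_joukowski_inv_cvg; exact: K_ccvg.
exact: (cvg_comp _ _ h (continuous_ln (cabs_joukowski_inv_gt0 _))).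
Qed.

Let dw z v : cderive_at (fun t => w (t *: v + z)) 0 (toC v).
Proof.
split; rewrite /=.
  apply: is_derive_eq; rewrite /GRing.scale /=; ring.
apply: is_derive_eq; rewrite /GRing.scale /=; ring.
Qed.

Let line0 z v : (0 : R) *: v + z = z. Proof. by rewrite scale0r add0r. Qed.

Let dK z v : cderive_at (fun t => K (t *: v + z)) 0 (w z / iab * toC v).
Proof.
pose k : R[i] := (0 +i* (2 * a * b))^-1.
have h := cderive_atM (cderive_atD (cderive_atM (dw z v) (dw z v))
  (cderive_at_cst (- (a ^+ 2 - b ^+ 2)%:C) 0)) (cderive_at_cst k 0).
rewrite line0 in h.
have -> : w z / iab * toC v = (w z * w z + - (a ^+ 2 - b ^+ 2)%:C) * 0 +
    (w z * toC v + toC v * w z + 0) * k.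
  have -> : k = (2^-1 : R)%:C / iab.
    apply: (mulIf iab0); rewrite divfK// /k /iab.
    by apply: complex_ext; rewrite ?(ReM, ImM, ReV, ImV, cabs_sqr) /=; field; apply/andP.
  have -> : (2^-1 : R)%:C = 2^-1 :> R[i] by rewrite fmorphV rmorph_nat.
  by move: iab iab0 => i i0; field.
exact: h.
Qed.

Lemma log_det_derive z v : ~ arc a b (w z) ->
  is_derive z v log_det (complex.Re (log_det_grad z * toC v)).
Proof.
move=> /(cabs_joukowski_kappa_lt1 _ a0 b0) l1; apply/is_derive_line.
have l2 : cabs (joukowski_inv (K ((0 : R) *: v + z))) < 1 by rewrite line0.
have dj := cderive_at_joukowski_inv (dK z v) l2.
have dl := is_derive_ln_cabs (joukowski_inv_neq0 _) dj.
pose g (t : R) : R := ln (cabs (joukowski_inv (K (t *: v + z)))).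
have dg : is_derive (0 : R) 1 g _ := dl.
have E : (fun t => log_det (t *: v + z)) = (fun t => (ln `|a * b| - g t) / 2) by [].
rewrite E; apply: is_derive_eq; rewrite /GRing.scale /= line0 /log_det_grad.
have -> : - (joukowski_inv (K z) * arcsine_cauchy (K z) * (w z / iab * toC v)) /
   joukowski_inv (K z) = - (arcsine_cauchy (K z) * (w z / iab * toC v)).
  have j0 := joukowski_inv_neq0 (K z).
  by move: (arcsine_cauchy _) (joukowski_inv _) j0 (w z / iab) => A j j0 B; field.
rewrite -!mulrA ReN [in RHS]ReM /=; ring.
Qed.

Lemma log_det_grad_derive z v : ~ arc a b (w z) ->
  cderive_at (fun t => log_det_grad (t *: v + z)) 0 (log_det_grad' z * toC v).
Proof.
move=> /(cabs_joukowski_kappa_lt1 _ a0 b0) l1.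
have l2 : cabs (joukowski_inv (K ((0 : R) *: v + z))) < 1 by rewrite line0.
have da := cderive_at_arcsine_cauchy (dK z v) l2.
have h := cderive_atM (cderive_atM (cderive_at_cst (2^-1 : R)%:C 0) da)
  (cderive_atM (dw z v) (cderive_at_cst iab^-1 0)).
rewrite line0 in h; rewrite /log_det_grad.
set D := (X in cderive_at _ _ X) in h.
have -> : log_det_grad' z * toC v = D by rewrite /D /log_det_grad'; ring.
exact: h.
Qed.

Lemma log_det_harmonic z : ~ arc a b (w z) ->
  [/\ is_derive z e1 log_det (complex.Re (log_det_grad z)),
      is_derive z e2 log_det (- complex.Im (log_det_grad z)),
      is_derive z e1 (fun z => complex.Re (log_det_grad z)) (complex.Re (log_det_grad' z)),
      is_derive z e2 (fun z => - complex.Im (log_det_grad z)) (- complex.Re (log_det_grad' z)) &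
      {for z, continuous (fun z => complex.Re (log_det_grad' z))}].
Proof.
move=> na; have l1 := (cabs_joukowski_kappa_lt1 _ a0 b0).2 na.
have [dx _] := log_det_grad_derive e1 na; have [_ dy] := log_det_grad_derive e2 na.
split.
- by apply: (is_derive_eq (log_det_derive e1 na)); rewrite ReM /=; ring.
- by apply: (is_derive_eq (log_det_derive e2 na)); rewrite ReM /=; ring.
- by apply/is_derive_line; apply: (is_derive_eq dx); rewrite ReM /=; ring.
- apply/is_derive_line; apply: (is_derive_eq (is_deriveN dy)); rewrite ImM /=; ring.
- have [h _] : ccvg (nbhs z) log_det_grad' (log_det_grad' z); last exact: h.
  apply: ccvgM; first exact: ccvg_cst.
  have wc : ccvg (nbhs z) (fun y => w y / iab) (w z / iab).
    by apply: ccvgM; [exact: w_ccvg|exact: ccvg_cst].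
  apply: ccvgD.
    apply: ccvgM => //; apply: ccvgM => //.
    by apply: arcsine_cauchy_deriv_ccvg => //; exact: K_ccvg.
  apply: ccvgM; last exact: ccvg_cst.
  by apply: arcsine_cauchy_ccvg => //; exact: K_ccvg.
Qed.

(** On the arc [joukowski_inv kappa] has modulus 1, elsewhere less: the arc is the set
of minima of [log_det]. *)
Lemma log_det_ge z : ln `|a * b| / 2 <= log_det z.
Proof.
rewrite /log_det ler_pM2r// lerBrDl gerDr.
by rewrite -ln1 ler_ln ?posrE ?cabs_joukowski_inv_gt0 ?cabs_joukowski_inv_le1.
Qed.

Lemma log_det_arc z : arc a b (w z) -> log_det z = ln `|a * b| / 2.
Proof.
move=> ha; rewrite /log_det.
have -> : cabs (joukowski_inv (K z)) = 1.
  apply/eqP; rewrite eq_le cabs_joukowski_inv_le1 leNgt; apply/negP.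
  by move=> /(cabs_joukowski_kappa_lt1 _ a0 b0).
by rewrite ln1 subr0.
Qed.

Lemma log_det_gt z : ~ arc a b (w z) -> ln `|a * b| / 2 < log_det z.
Proof.
move=> /(cabs_joukowski_kappa_lt1 _ a0 b0) h; rewrite /log_det ltr_pM2r// ltrBrDl gtrDr.
by rewrite -ln1 ltr_ln ?posrE ?cabs_joukowski_inv_gt0.
Qed.

End LogPotential.

(** * The support of the Brown measure *)

Section SupportOutside.
Context {R : realType}.
Local Notation plane := (measurableTypeR R * measurableTypeR R)%type.
Local Notation leb := (@lebesgue_measure R).

Lemma measure_superlevel_eq0 (mu : {measure set plane -> \bar R}) (f : R * R -> R) (k : R) :
  continuous f -> (forall z, 0 <= f z) -> 0 < k -> (\int[mu]_z (f z)%:E = 0)%E ->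
  mu [set z | k < f z] = 0%E.
Proof.
move=> cf f0 k0 if0; set U := [set z | _].
have oU : open U by exact: (@open_comp _ _ f [set t | k < t]) (fun z _ => cf z) (@open_gt _ k).
have mU : measurable (U : set plane) := open_measurable_plane oU.
have mf : measurable_fun [set: plane] (fun z => (f z)%:E).
  by apply/measurable_EFinP; exact: continuous_measurable_plane.
have h : (k%:E * mu U <= 0)%E.
  rewrite -if0 -integral_cst//; apply: (@le_trans _ _ (\int[mu]_(z in U) (f z)%:E)%E).
    apply: ge0_le_integral => //.
    - by move=> z _; rewrite lee_fin ltW.
    - exact: measurable_funS mf.
    - by move=> z Uz; rewrite lee_fin ltW.
  by apply: ge0_subset_integral => // z _; rewrite lee_fin.
apply/eqP; rewrite eq_le measure_ge0 andbT.
by move: h; rewrite pmule_rle0 ?lte_fin.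
Qed.

Lemma sqdist_square (z0 z : R * R) (r : R) : 0 <= r -> sqdist z0 z <= r ^+ 2 ->
  `|z.1 - z0.1| <= r /\ `|z.2 - z0.2| <= r.
Proof.
have key (t s : R) : 0 <= r -> t ^+ 2 <= s -> s <= r ^+ 2 -> `|t| <= r.
  move=> r0 h1 h2; rewrite -(@ler_pXn2r _ 2) ?nnegrE// real_normK ?num_real//.
  exact: le_trans h2.
by move=> r0 h; split; apply: (key _ _ r0 _ h); rewrite /sqdist ?lerDl ?lerDr sqr_ge0.
Qed.

Lemma disk_square (z0 : R * R) (r : R) : 0 <= r ->
  [set z | sqdist z0 z <= r ^+ 2] `<=` square (`|z0.1| + `|z0.2| + r + 1).
Proof.
move=> r0 z /= /(sqdist_square r0)[h1 h2].
have := normr_ge0 z0.1; have := normr_ge0 z0.2 => n2 n1.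
split; rewrite /= in_itv /= -ler_norml.
  have := ler_normD (z.1 - z0.1) z0.1; rewrite subrK; lra.
have := ler_normD (z.2 - z0.2) z0.2; rewrite subrK; lra.
Qed.

Lemma closed_disk (z0 : R * R) (r : R) : closed [set z | sqdist z0 z <= r].
Proof.
apply: (@closed_comp _ _ (sqdist z0) [set t | t <= r]); last exact: closed_le.
by move=> z _; exact: continuous_sqdist.
Qed.

Context (a b : R) (c : R * R) (mu : {measure set plane -> \bar R}).
Hypotheses (a0 : a != 0) (b0 : b != 0).

Hypothesis mu_laplacian : forall f : R * R -> R, test_function f ->
  (\int[mu]_z (f z)%:E = ((2 * pi)^-1)%:E *
     \int[(leb \x leb)%E]_z ((laplacian f z)%:E * (log_det a b c z)%:E))%E.

(** Off the arc [log_det] is harmonic, so the Brown measure integrates to 0 a bump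
that is positive near [z0]. *)
Lemma support_arc z0 : msupport mu z0 -> arc a b (toC z0 - toC c).
Proof.
move=> sz0; apply: contrapT => nz0.
pose V := ~` [set z : R * R | arc a b (toC z - toC c)].
have oV : open V by apply: closed_openC; exact: closed_arc.
have /nbhs_ballP[e /= e0 he] : nbhs z0 V by exact: open_nbhs_nbhs.
pose r := e / 2; have r0 : 0 < r by rewrite divr_gt0.
have re : r < e by rewrite /r; lra.
pose rho := r ^+ 2; have rho0 : 0 < rho by rewrite exprn_gt0.
pose del := rho / 2; have del0 : 0 < del by rewrite divr_gt0.
have dr : del < rho by rewrite /del; lra.
pose f := bump z0 del rho.
have KV : [set z | sqdist z0 z <= rho] `<=` V.
  move=> z /= /(sqdist_square (ltW r0))[h1 h2]; apply: he.
  by split; rewrite /ball /= distrC; apply: le_lt_trans re.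
have lap0 : (\int[(leb \x leb)%E]_z (laplacian f z * log_det a b c z)%:E = 0)%E.
  apply: (@integral_laplacian_harmonic _ f (log_det a b c)
    (fun z => complex.Re (log_det_grad a b c z)) (fun z => - complex.Im (log_det_grad a b c z))
    (fun z => complex.Re (log_det_grad' a b c z)) [set z | sqdist z0 z <= rho] V
    (`|z0.1| + `|z0.2| + r + 1)).
  - exact: smooth_reval.
  - exact: closed_disk.
  - exact: oV.
  - exact: KV.
  - by rewrite ltr_wpDl// !addr_ge0// ltW.
  - exact: disk_square (ltW r0).
  - by move=> z /= /negP; rewrite -ltNge => /ltW; exact: bump_eq0.
  - exact: continuous_log_det.
  - by move=> z Vz; exact: log_det_harmonic.
have if0 : (\int[mu]_z (f z)%:E = 0)%E.
  rewrite mu_laplacian; last exact: test_function_bump.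
  by under eq_integral do rewrite -EFinM; rewrite lap0 mule0.
have fz0 : 0 < f z0 by apply: bump_gt0 => //; rewrite /sqdist !subrr expr0n addr0 add0r.
have cf : continuous f by exact: continuous_reval.
have k0 : 0 < f z0 / 2 by rewrite divr_gt0.
have f0 z : 0 <= f z by exact: bump_ge0.
have := measure_superlevel_eq0 cf f0 k0 if0.
have oU : open [set z | f z0 / 2 < f z].
  exact: (@open_comp _ _ f [set t | f z0 / 2 < t]) (fun z _ => cf z) (@open_gt _ _).
have /(sz0 _ oU) : [set z | f z0 / 2 < f z] z0 by rewrite /=; lra.
by move=> h h0; rewrite h0 ltxx in h.
Qed.

End SupportOutside.

Section CauchyKernel.
Context {R : realType}.
Local Notation plane := (measurableTypeR R * measurableTypeR R)%type.
Local Notation leb := (@lebesgue_measure R).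

Definition cauchy_kernel (k x0 x : R) : R := ((x - x0) ^+ 2 + k ^+ 2)^-1.

Lemma cauchy_kernel_ge0 k x0 x : 0 <= cauchy_kernel k x0 x.
Proof. by rewrite invr_ge0 addr_ge0 ?sqr_ge0. Qed.

Lemma continuous_cauchy_kernel k x0 : k != 0 -> continuous (cauchy_kernel k x0).
Proof.
move=> k0 x; apply: cvgV.
  by rewrite gt_eqF// ltr_wpDl ?sqr_ge0// exprn_even_gt0.
apply: cvgD; last exact: cvg_cst.
by apply: cvgM; apply: cvgB; [exact: cvg_id|exact: cvg_cst|exact: cvg_id|exact: cvg_cst].
Qed.

Lemma integral_cauchy_kernel (x0 k r : R) : 0 < k -> 0 < r ->
  (\int[leb]_(x in `[(x0 - r)%R, (x0 + r)%R]) (cauchy_kernel k x0 x)%:E <= (pi / k)%:E)%E.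
Proof.
move=> k0 r0; have kn : k != 0 by rewrite gt_eqF.
pose F x := atan ((x - x0) / k) / k.
have dF (x : R) : is_derive x 1 F (cauchy_kernel k x0 x).
  have d1 : is_derive x 1 (fun x => (x - x0) / k) k^-1.
    by apply: is_derive_eq; rewrite /GRing.scale /=; ring.
  have d2 := @is_derive1_comp R atan (fun x => (x - x0) / k) x _ _ (is_derive1_atan _) d1.
  pose g x := atan ((x - x0) / k).
  have dg : is_derive x 1 g _ := d2.
  have E : F = (fun x => g x / k) by [].
  rewrite E; apply: is_derive_eq; rewrite /GRing.scale /= /cauchy_kernel.
  have s0 : (x - x0) ^+ 2 + k ^+ 2 != 0.
    by rewrite gt_eqF// ltr_wpDl ?sqr_ge0// exprn_gt0.
  have s1 : 1 + ((x - x0) / k) ^+ 2 != 0 by rewrite gt_eqF// ltr_pwDl// sqr_ge0.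
  field; rewrite s0 kn //=.
have cF : continuous F.
  by move=> x; have [d _] := dF x; exact: differentiable_continuous ((derivable1_diffP _ _).1 d).
rewrite (@continuous_FTC2 _ _ F).
- rewrite -EFinB lee_fin /F -mulrBl ler_pM2r ?invr_gt0//.
  have := atan_ltpi2 ((x0 + r - x0) / k); have := atan_gtNpi2 ((x0 - r - x0) / k); lra.
- by rewrite ltrD2l gtrN.
- by apply: continuous_subspaceT; exact: continuous_cauchy_kernel.
- split.
  + by move=> t _; have [] := dF t.
  + by apply: cvg_at_right_filter; exact: cF.
  + by apply: cvg_at_left_filter; exact: cF.
- by move=> t _; rewrite derive1E; have [_] := dF t.
Qed.

Definition square_at (z0 : R * R) (r : R) : set (R * R) :=
  [set` `[z0.1 - r, z0.1 + r]%R] `*` [set` `[z0.2 - r, z0.2 + r]%R].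

Lemma measurable_square_at z0 r : measurable (square_at z0 r : set plane).
Proof. by apply: measurableX; exact: measurable_itv. Qed.

Lemma square_at_measure z0 r : 0 <= r ->
  ((leb \x leb)%E (square_at z0 r) = ((2 * r) ^+ 2)%:E)%E.
Proof.
move=> r0; rewrite product_measure1E; [|exact: measurable_itv..].
have side (x : R) : leb [set` `[x - r, x + r]%R] = (2 * r)%:E.
  rewrite lebesgue_measure_itv /= lte_fin; case: ifPn => h.
    by rewrite -EFinB; congr (_%:E); ring.
  have -> : r = 0 by apply/eqP; rewrite eq_le r0 andbT; move: h; rewrite -leNgt; lra.
  by rewrite mulr0.
by transitivity ((2 * r)%:E * (2 * r)%:E)%E; [congr (_ * _)%E; exact: side|rewrite -EFinM expr2].
Qed.

(** Products of kernels of one variable are used as majorants of the approximate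
identity [4 del / (|z - z0|^2 + del)^2], see [cauchy_kernel_majorant]; their
integrals are elementary. *)
Lemma integral_cauchy_kernel2 (z0 : R * R) (k r : R) : 0 < k -> 0 < r ->
  (\int[(leb \x leb)%E]_(z in square_at z0 r)
     (cauchy_kernel k z0.1 z.1 * cauchy_kernel k z0.2 z.2)%:E <= ((pi / k) ^+ 2)%:E)%E.
Proof.
move=> k0 r0; have kn : k != 0 by rewrite gt_eqF.
pose g (x0 x : R) : R := (cauchy_kernel k x0 \_ [set` `[x0 - r, x0 + r]%R]) x.
have g0 x0 x : 0 <= g x0 x by rewrite /g patchE; case: ifP => _ //; exact: cauchy_kernel_ge0.
have mg x0 : measurable_fun [set: measurableTypeR R] (g x0 : measurableTypeR R -> measurableTypeR R).
  apply/(measurable_restrictT _ (measurable_itv _)).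
  apply: measurable_funTS; apply: continuous_measurable_fun; exact: continuous_cauchy_kernel.
have ig x0 : (\int[leb]_x (g x0 x)%:E <= (pi / k)%:E)%E.
  apply: le_trans (integral_cauchy_kernel x0 k0 r0); rewrite [leRHS]integral_mkcond.
  rewrite le_eqVlt; apply/orP; left; apply/eqP; apply: eq_integral => x _.
  by rewrite /g !patchE; case: ifP.
have E : (\int[(leb \x leb)%E]_(z in square_at z0 r)
     (cauchy_kernel k z0.1 z.1 * cauchy_kernel k z0.2 z.2)%:E =
   \int[(leb \x leb)%E]_z (g z0.1 z.1 * g z0.2 z.2)%:E)%E.
  rewrite integral_mkcond; apply: eq_integral => -[x y] _; rewrite /g !patchE /=.
  have -> : ((x, y) \in square_at z0 r) = (x \in [set` `[z0.1 - r, z0.1 + r]%R]) &&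
       (y \in [set` `[z0.2 - r, z0.2 + r]%R]).
    apply/idP/andP; rewrite !inE => -[] // h1 h2; split; rewrite ?inE//.
  by case: (x \in _); case: (y \in _); rewrite /= ?mul0r ?mulr0.
rewrite E fubini_tonelli1; last 2 first.
- apply/measurable_EFinP; apply: measurable_funM.
    by apply: measurableT_comp; [exact: mg|exact: measurable_fst].
  by apply: measurableT_comp; [exact: mg|exact: measurable_snd].
- by move=> z; rewrite lee_fin mulr_ge0.
rewrite /fubini_F /=.
have inner x : (\int[leb]_y (g z0.1 x * g z0.2 y)%:E = (g z0.1 x)%:E * \int[leb]_y (g z0.2 y)%:E)%E.
  under eq_integral do rewrite EFinM.
  apply: ge0_integralZl => //; last by rewrite lee_fin.
    by apply/measurable_EFinP; exact: mg.
  by move=> y _; rewrite lee_fin.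
under eq_integral do rewrite inner.
rewrite ge0_integralZr//; last 3 first.
- by apply/measurable_EFinP; exact: mg.
- by move=> x _; rewrite lee_fin.
- by apply: integral_ge0 => y _; rewrite lee_fin.
rewrite expr2 EFinM; apply: lee_pmul => //; by apply: integral_ge0 => y _; rewrite lee_fin.
Qed.

End CauchyKernel.

Section BumpParts.
Context {R : realType}.
Context (z0 : R * R) (del rho : R).
Hypotheses (del0 : 0 < del) (rho0 : 0 < rho).

Let rsq : @rexpr R := RAdd (RMul RX RX) (RMul RY RY).
Let inv2 : @rexpr R := RMul RInv RInv.

(** The Laplacian of the bump is [lap_pos - lap_neg]. As [del] tends to 0, the
second part concentrates at the centre like an approximate identity, while the
first one stays spread out over the disk. *)
Definition lap_pos : R * R -> R :=
  reval z0 del rho (RMul (RFlat 3%N) (RMul (RMul (RCst 4) rsq) inv2)).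
Definition lap_neg : R * R -> R :=
  reval z0 del rho (RMul (RAdd (RFlat 0%N) (RFlat 1%N)) (RMul (RCst (4 * del)) inv2)).

Lemma lap_posE z : lap_pos z =
  flat 3%N (radial_log z0 del rho z) * (4 * sqdist z0 z / (sqdist z0 z + del) ^+ 2).
Proof. by rewrite /lap_pos /= /sqdist !expr2 invfM. Qed.

Lemma lap_negE z : lap_neg z =
  (flat 0%N (radial_log z0 del rho z) + flat 1%N (radial_log z0 del rho z)) *
  (4 * del / (sqdist z0 z + del) ^+ 2).
Proof. by rewrite /lap_neg /= expr2 invfM. Qed.

Lemma laplacian_parts z : laplacian (bump z0 del rho) z = lap_pos z - lap_neg z.
Proof. by rewrite laplacian_bump// lap_posE lap_negE. Qed.

Let sd0 z : 0 < sqdist z0 z + del.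
Proof. by rewrite ltr_wpDl// sqdist_ge0. Qed.

Lemma lap_pos_ge0 z : 0 <= lap_pos z.
Proof.
rewrite lap_posE mulr_ge0 ?flat_ge0// divr_ge0 ?sqr_ge0//.
by rewrite mulr_ge0 ?sqdist_ge0.
Qed.

Lemma lap_neg_ge0 z : 0 <= lap_neg z.
Proof.
rewrite lap_negE mulr_ge0 ?addr_ge0 ?flat_ge0// divr_ge0 ?sqr_ge0//.
by rewrite mulr_ge0// ltW.
Qed.

Lemma lap_parts_out z : rho <= sqdist z0 z -> lap_pos z = 0 /\ lap_neg z = 0.
Proof.
move=> h; have g0 : radial_log z0 del rho z <= 0.
  by rewrite leNgt radial_log_gt0// -leNgt (le_trans h)// lerDl ltW.
by rewrite lap_posE lap_negE !flat_le0// addr0 !mul0r.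
Qed.

Lemma lap_neg_le z : lap_neg z <= 4 * del / (sqdist z0 z + del) ^+ 2.
Proof.
by rewrite lap_negE; apply: ler_piMl (flat_sum_le1 _); rewrite divr_ge0 ?sqr_ge0// mulr_ge0// ltW.
Qed.

(** The arithmetic-geometric mean inequality
[(X + Y + del)^2 >= 4 (X + del / 2) (Y + del / 2)]. *)
Lemma cauchy_kernel_majorant z :
  4 * del / (sqdist z0 z + del) ^+ 2 <= del *
  (cauchy_kernel (Num.sqrt (del / 2)) z0.1 z.1 * cauchy_kernel (Num.sqrt (del / 2)) z0.2 z.2).
Proof.
rewrite /cauchy_kernel sqr_sqrtr; last by rewrite divr_ge0// ltW.
rewrite (mulrC 4) -(mulrA del) ler_pM2l// -invfM.
set X := (z.1 - z0.1) ^+ 2; set Y := (z.2 - z0.2) ^+ 2.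
have X0 : 0 <= X := sqr_ge0 _; have Y0 : 0 <= Y := sqr_ge0 _.
have p1 : 0 < X + del / 2 by rewrite ltr_wpDl// divr_gt0.
have p2 : 0 < Y + del / 2 by rewrite ltr_wpDl// divr_gt0.
rewrite ler_pdivrMr ?exprn_gt0// mulrC ler_pdivlMr; last exact: mulr_gt0.
rewrite /sqdist -/X -/Y; have := sqr_ge0 (X - Y); lra.
Qed.

End BumpParts.

Section BumpEstimates.
Context {R : realType}.
Local Notation plane := (measurableTypeR R * measurableTypeR R)%type.
Local Notation leb := (@lebesgue_measure R).
Local Notation leb2 := (leb \x leb)%E.

(** A lower bound of [lap_pos] where the squared distance is between [s / 2] and
[rho / 2]: as soon as [del <= rho / 4], the logarithm is there between [ln (4 / 3)]
and [ln (2 rho / s)]. *)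
Definition lap_pos_bound (rho s : R) : R :=
  (ln (2 * rho / s)) ^- 3 * expR (- (ln (4 / 3))^-1) * (4 * (s / 2) / rho ^+ 2).

Let l43 : 0 < ln (4 / 3 : R). Proof. by rewrite ln_gt0//; lra. Qed.

Let ln_gt (rho s : R) : 0 < s -> s < 2 * rho -> 0 < ln (2 * rho / s).
Proof. by move=> s0 h; rewrite ln_gt0// ltr_pdivlMr// mul1r. Qed.

Lemma lap_pos_bound_gt0 (rho s : R) : 0 < s -> s < 2 * rho -> 0 < lap_pos_bound rho s.
Proof.
move=> s0 h; have rho0 : 0 < rho by lra.
apply: mulr_gt0; last by apply: divr_gt0; [lra|exact: exprn_gt0].
by rewrite mulr_gt0 ?expR_gt0// invr_gt0 exprn_gt0// ln_gt.
Qed.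

Lemma lap_pos_lower (z0 z : R * R) (del rho s : R) : 0 < del -> del <= rho / 4 -> 0 < s ->
  s / 2 < sqdist z0 z -> sqdist z0 z < rho / 2 ->
  lap_pos_bound rho s <= lap_pos z0 del rho z.
Proof.
move=> del0 dr s0 h2 h3; have rho0 : 0 < rho by lra.
have d0 : 0 < sqdist z0 z + del by lra.
have ls := @ln_gt rho s s0 _; have {}ls : 0 < ln (2 * rho / s) by apply: ls; lra.
have g1 : ln (4 / 3) <= radial_log z0 del rho z.
  by rewrite ler_ln ?posrE ?divr_gt0// ler_pdivlMr//; lra.
have g2 : radial_log z0 del rho z <= ln (2 * rho / s).
  rewrite ler_ln ?posrE ?divr_gt0 ?mulr_gt0// ler_pdivrMr// mulrAC ler_pdivlMr//.
  have hs : s <= 2 * (sqdist z0 z + del) by lra.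
  by have := ler_wpM2l (ltW rho0) hs; lra.
have g0 : 0 < radial_log z0 del rho z by apply: lt_le_trans g1.
have fq : (ln (2 * rho / s)) ^- 3 * expR (- (ln (4 / 3))^-1) <= flat 3%N (radial_log z0 del rho z).
  rewrite /flat g0; apply: ler_pM; rewrite ?expR_ge0 ?invr_ge0 ?exprn_ge0 ?(ltW ls)//.
    by rewrite lef_pV2 ?posrE ?exprn_gt0// lerXn2r ?nnegrE ?(ltW g0) ?(ltW ls).
  by rewrite ler_expR lerN2 lef_pV2.
rewrite lap_posE; apply: ler_pM => //.
- by rewrite mulr_ge0 ?expR_ge0// invr_ge0 exprn_ge0// ltW.
- by apply: divr_ge0; [lra|exact: sqr_ge0].
- apply: ler_pM; [lra|by rewrite invr_ge0 sqr_ge0|lra|].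
  by rewrite lef_pV2 ?posrE ?exprn_gt0// lerXn2r ?nnegrE ?(ltW d0) ?(ltW rho0)//; lra.
Qed.

Lemma lap_neg_mul_le (z0 z : R * R) (del rho ep L y : R) : 0 < del -> 0 < rho -> 0 < ep -> 0 < L ->
  0 <= y -> y <= ep + L * sqdist z0 z ^+ 2 ->
  lap_neg z0 del rho z * y <= ep * del *
    (cauchy_kernel (Num.sqrt (del / 2)) z0.1 z.1 * cauchy_kernel (Num.sqrt (del / 2)) z0.2 z.2) +
    4 * del * L.
Proof.
move=> del0 rho0 ep0 L0 y0 yle.
have d0 : 0 < sqdist z0 z + del by rewrite ltr_wpDl// sqdist_ge0.
apply: (@le_trans _ _ (4 * del / (sqdist z0 z + del) ^+ 2 * (ep + L * sqdist z0 z ^+ 2))).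
  by apply: ler_pM => //; [exact: lap_neg_ge0|exact: lap_neg_le].
rewrite mulrDr; apply: lerD.
  rewrite mulrC -(mulrA ep) ler_pM2l//; exact: cauchy_kernel_majorant.
have -> : 4 * del / (sqdist z0 z + del) ^+ 2 * (L * sqdist z0 z ^+ 2) =
  4 * del * L * (sqdist z0 z ^+ 2 / (sqdist z0 z + del) ^+ 2) by ring.
have c2 : 0 <= 4 * del * L by apply: mulr_ge0; [apply: mulr_ge0 => //|]; exact: ltW.
apply: ler_piMr => //; rewrite ler_pdivrMr ?exprn_gt0// mul1r.
by rewrite lerXn2r ?nnegrE ?sqdist_ge0 ?(ltW d0)// lerDl ltW.
Qed.

Lemma integral_kernel_bound_le (z0 : R * R) (r del ep C : R) (N : R * R -> R) :
  0 < r -> 0 < del -> 0 < ep -> 0 <= C -> continuous N -> (forall z, 0 <= N z) ->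
  (forall z, square_at z0 r z -> N z <= ep * del *
    (cauchy_kernel (Num.sqrt (del / 2)) z0.1 z.1 * cauchy_kernel (Num.sqrt (del / 2)) z0.2 z.2) + C) ->
  (\int[leb2]_(z in square_at z0 r) (N z)%:E <= (2 * ep * pi ^+ 2 + C * (2 * r) ^+ 2)%:E)%E.
Proof.
move=> r0 del0 ep0 C0 cN N0 hN.
pose k := Num.sqrt (del / 2); have k0 : 0 < k by rewrite sqrtr_gt0 divr_gt0.
pose gg z := cauchy_kernel k z0.1 z.1 * cauchy_kernel k z0.2 z.2.
have ed0 : 0 <= ep * del by apply: mulr_ge0; exact: ltW.
have gg0 z : 0 <= gg z by rewrite mulr_ge0 ?cauchy_kernel_ge0.
have mQ := measurable_square_at z0 r.
have mN : measurable_fun [set: plane] (fun z => (N z)%:E).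
  by apply/measurable_EFinP; exact: continuous_measurable_plane.
have mgg : measurable_fun [set: plane] (fun z : plane => (gg z)%:E).
  apply/measurable_EFinP; apply: continuous_measurable_plane => z.
  have ck x0 : continuous (cauchy_kernel k x0) by apply: continuous_cauchy_kernel; rewrite gt_eqF.
  apply: cvgM.
    by apply: (@continuous_comp _ _ _ fst (cauchy_kernel k z0.1)); [exact: cvg_fst|exact: ck].
  by apply: (@continuous_comp _ _ _ snd (cauchy_kernel k z0.2)); [exact: cvg_snd|exact: ck].
apply: (@le_trans _ _ (\int[leb2]_(z in square_at z0 r)
    ((ep * del)%:E * (gg z)%:E + C%:E))%E).
  apply: ge0_le_integral => //.
  - by move=> z _; rewrite lee_fin.
  - exact: measurable_funS mN.
  - apply: emeasurable_funD => //; apply: measurable_funeM.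
    exact: measurable_funS mgg.
rewrite ge0_integralD//; last 2 first.
- by move=> z _; rewrite -EFinM lee_fin mulr_ge0.
- by apply: measurable_funeM; exact: measurable_funS mgg.
rewrite EFinD; apply: leeD.
  rewrite ge0_integralZl//; last 2 first.
  - exact: measurable_funS mgg.
  - by move=> z _; rewrite lee_fin.
  have -> : 2 * ep * pi ^+ 2 = ep * del * (pi / k) ^+ 2.
    rewrite expr_div_n /k sqr_sqrtr ?divr_ge0 ?(ltW del0)//; field.
    by rewrite gt_eqF.
  by rewrite [leRHS]EFinM; apply: lee_wpmul2l; [rewrite lee_fin|exact: integral_cauchy_kernel2].
apply: (@le_trans _ _ (C%:E * leb2 (square_at z0 r))%E).
  by rewrite -(integral_cst leb2 mQ).
by rewrite square_at_measure ?(ltW r0)// -EFinM lee_fin.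
Qed.

End BumpEstimates.

Section SupportInside.
Context {R : realType}.
Local Notation plane := (measurableTypeR R * measurableTypeR R)%type.
Local Notation leb := (@lebesgue_measure R).
Local Notation leb2 := (leb \x leb)%E.

Lemma near_square (z : R * R) (P : set (R * R)) : nbhs z P ->
  exists2 r : R, 0 < r & square_at z r `<=` P.
Proof.
move=> /nbhs_ballP[e /= e0 he]; exists (e / 2); first by rewrite divr_gt0.
have re : e / 2 < e by lra.
move=> y [/=]; rewrite !in_itv /= -!ler_distl => h1 h2; apply: he.
by split; rewrite /ball /= distrC; apply: le_lt_trans re.
Qed.

Lemma disk_square_at (z0 z : R * R) (r : R) : 0 <= r -> sqdist z0 z <= r ^+ 2 -> square_at z0 r z.
Proof.
move=> r0 /(sqdist_square r0)[h1 h2].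
by split; rewrite /= in_itv /= -ler_distl.
Qed.

Lemma continuous_laplacian (f : R * R -> R) : smooth f -> continuous (laplacian f).
Proof.
move=> sf z; have [h1 _] := sf [:: (1, 0); (1, 0)]; have [h2 _] := sf [:: (0, 1); (0, 1)].
by apply: cvgD; [exact: h1|exact: h2].
Qed.

(** The negative part of the Laplacian of the bump sees [m] only near [z0], where it
is small, while the positive part sees the neighbourhood of [z1]. For small [del] the
integral is therefore positive. *)
Lemma bump_detects_minimum (m : R * R -> R) (z0 : R * R) (r : R) (z1 : R * R) :
  continuous m -> (forall z, 0 <= m z) -> m z0 = 0 -> 0 < r ->
  (forall z, sqdist z0 z <= r ^+ 2 -> m z <= 1) ->
  0 < m z1 -> 0 < sqdist z0 z1 < r ^+ 2 / 2 ->
  exists2 del : R, 0 < del < r ^+ 2 &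
    (\int[leb2]_z (laplacian (bump z0 del (r ^+ 2)) z * m z)%:E != 0)%E.
Proof.
move=> cm m0 mz0 r0 m1 mz1 /andP[s0 s1].
set s := sqdist z0 z1 in s0 s1.
pose rho := r ^+ 2; have rho0 : 0 < rho by rewrite exprn_gt0.
rewrite -/rho in s1 m1 *.
have cs : continuous (sqdist z0) by exact: continuous_sqdist.
(* on this square around [z1] the positive part is bounded below by [kk] *)
have [t t0 Dt] : exists2 t : R, 0 < t & square_at z1 t `<=`
    [set z | [/\ m z1 / 2 < m z, s / 2 < sqdist z0 z & sqdist z0 z < rho / 2]].
  apply: near_square; near=> z; split; near: z.
  - by apply: (cvgr_gt _ (cm z1)); lra.
  - by apply: (cvgr_gt _ (cs z1)); rewrite -/s; lra.
  - by apply: (cvgr_lt _ (cs z1)).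
have rho_s : s < 2 * rho by lra.
pose kk := lap_pos_bound rho s * (m z1 / 2).
have kk0 : 0 < kk by rewrite mulr_gt0 ?divr_gt0 ?lap_pos_bound_gt0.
pose B := kk * (2 * t) ^+ 2; have B0 : 0 < B by rewrite mulr_gt0// exprn_gt0// mulr_gt0.
have pi0 : 0 < (pi : R) := pi_gt0 R.
(* chosen so that the two error terms below are at most [B / 4] each *)
pose ep := B / (8 * pi ^+ 2).
have ep0 : 0 < ep by rewrite divr_gt0// mulr_gt0// exprn_gt0.
have [e2 e20 he2] : exists2 e : R, 0 < e & square_at z0 e `<=` [set z | m z < ep].
  by apply: near_square; apply: (cvgr_lt _ (cm z0)); rewrite mz0.
(* [m] is below [ep] near [z0], and below 1, hence below [L s^2], elsewhere *)
pose L := (e2 ^+ 4)^-1; have L0 : 0 < L by rewrite invr_gt0 exprn_gt0.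
have mL z : sqdist z0 z <= rho -> m z <= ep + L * sqdist z0 z ^+ 2.
  move=> h; have [h2|h2] := leP (sqdist z0 z) (e2 ^+ 2).
    have := he2 _ (disk_square_at (ltW e20) h2) => /= /ltW h3.
    by rewrite (le_trans h3)// lerDl mulr_ge0 ?sqr_ge0// ltW.
  apply: (le_trans (m1 _ h)); rewrite -[leLHS]add0r lerD// ?(ltW ep0)//.
  rewrite /L mulrC ler_pdivlMr ?exprn_gt0// mul1r (exprM _ 2 2) lerXn2r ?nnegrE ?sqr_ge0//.
    exact: sqdist_ge0.
  exact: ltW.
pose del := Num.min (rho / 4) (B / (64 * (L * rho))).
have Lr0 : 0 < L * rho by rewrite mulr_gt0.
have del0 : 0 < del by rewrite lt_min !divr_gt0// mulr_gt0.
have del1 : del <= rho / 4 by rewrite ge_min lexx.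
have del2 : del * (64 * (L * rho)) <= B.
  by rewrite -ler_pdivlMr ?mulr_gt0// ge_min lexx orbT.
exists del; first by rewrite del0 /= -/rho; lra.
apply/eqP => I0; rewrite -/rho in I0.
pose A z := lap_pos z0 del rho z * m z; pose N z := lap_neg z0 del rho z * m z.
have cA : continuous A.
  by move=> z; apply: cvgM; [exact: continuous_reval|exact: cm].
have cN : continuous N.
  by move=> z; apply: cvgM; [exact: continuous_reval|exact: cm].
have A0 z : 0 <= A z by rewrite mulr_ge0// lap_pos_ge0.
have N0 z : 0 <= N z by rewrite mulr_ge0// lap_neg_ge0.
pose r3 := `|z0.1| + `|z0.2| + r + 1.
have out z : ~ square r3 z -> rho <= sqdist z0 z.
  by move=> nz; rewrite leNgt; apply/negP => /ltW/(disk_square (ltW r0)).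
have Aout z : rho <= sqdist z0 z -> A z = 0.
  by move=> h; have [e _] := lap_parts_out del0 rho0 h; rewrite /A e mul0r.
have Nout z : rho <= sqdist z0 z -> N z = 0.
  by move=> h; have [_ e] := lap_parts_out del0 rho0 h; rewrite /N e mul0r.
pose P z := laplacian (bump z0 del rho) z * m z.
have PE z : P z = A z - N z by rewrite /P laplacian_parts// mulrBl.
have iN : leb2.-integrable setT (EFin \o N).
  by apply: (integrable_square cN (r := r3)) => z /out/Nout.
have iP : leb2.-integrable setT (EFin \o P).
  have cP : continuous P.
    have -> : P = (fun z => A z - N z) by apply/funext => z; exact: PE.
    by move=> z; apply: cvgB; [exact: cA|exact: cN].
  by apply: (integrable_square cP (r := r3)) => z /out h; rewrite PE Aout// Nout// subr0.
have AN : (\int[leb2]_z (A z)%:E = \int[leb2]_z (N z)%:E)%E.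
  have := integralD_EFin measurableT iP iN; rewrite /= I0 add0e => <-.
  by apply: eq_integral => z _; rewrite -EFinD PE subrK.
have mA : measurable_fun [set: plane] (fun z => (A z)%:E).
  by apply/measurable_EFinP; exact: continuous_measurable_plane.
have mN : measurable_fun [set: plane] (fun z => (N z)%:E).
  by apply/measurable_EFinP; exact: continuous_measurable_plane.
have lower : (B%:E <= \int[leb2]_z (A z)%:E)%E.
  have mD := measurable_square_at z1 t.
  apply: (@le_trans _ _ (\int[leb2]_(z in square_at z1 t) (A z)%:E)%E); last first.
    by apply: ge0_subset_integral => // z _; rewrite lee_fin.
  have -> : (B%:E = \int[leb2]_(z in square_at z1 t) cst kk%:E z)%E.
    transitivity (kk%:E * leb2 (square_at z1 t))%E; last exact/esym/integral_cst.
    by rewrite square_at_measure ?(ltW t0)// -EFinM.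
  apply: ge0_le_integral => //.
  - by move=> z _; rewrite lee_fin ltW.
  - exact: measurable_funS mA.
  - move=> z /Dt[h1 h2 h3]; rewrite lee_fin.
    rewrite /kk /A; apply: ler_pM.
    - exact/ltW/lap_pos_bound_gt0.
    - by rewrite divr_ge0// ltW.
    - exact: lap_pos_lower.
    - exact: ltW.
have upper : (\int[leb2]_z (N z)%:E <= (2 * ep * pi ^+ 2 + 16 * del * L * rho)%:E)%E.
  have -> : (\int[leb2]_z (N z)%:E = \int[leb2]_(z in square_at z0 r) (N z)%:E)%E.
    rewrite [RHS]integral_mkcond; apply: eq_integral => z _; rewrite patchE.
    case: ifPn => // /negP nz; rewrite Nout// leNgt; apply/negP => h; apply: nz.
    by rewrite inE; apply: disk_square_at; exact: ltW.
  have C0 : 0 <= 4 * del * L by apply: mulr_ge0; [apply: mulr_ge0 => //|]; exact: ltW.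
  have -> : 16 * del * L * rho = 4 * del * L * (2 * r) ^+ 2 by rewrite /rho; ring.
  apply: (integral_kernel_bound_le r0 del0 ep0 C0 cN N0) => z _.
  have [h|h] := leP rho (sqdist z0 z).
    rewrite Nout//; apply: addr_ge0 => //; apply: mulr_ge0; first by apply: mulr_ge0; exact: ltW.
    by apply: mulr_ge0; exact: cauchy_kernel_ge0.
  by apply: lap_neg_mul_le => //; apply: mL; exact: ltW.
have : B <= 2 * ep * pi ^+ 2 + 16 * del * L * rho.
  by rewrite -lee_fin (le_trans lower)// AN.
have -> : 2 * ep * pi ^+ 2 = B / 4.
  have pin : (pi : R) != 0 by rewrite gt_eqF.
  by rewrite /ep; move: (B) (pi : R) pin => y p pn; field.
lra.
Unshelve. all: by end_near.
Qed.

End SupportInside.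

Section ArcSupport.
Context {R : realType}.
Local Notation plane := (measurableTypeR R * measurableTypeR R)%type.
Local Notation leb := (@lebesgue_measure R).
Local Notation leb2 := (leb \x leb)%E.
Context (a b : R) (c : R * R) (mu : {measure set plane -> \bar R}).
Hypotheses (a0 : a != 0) (b0 : b != 0).

Hypothesis mu_laplacian : forall f : R * R -> R, test_function f ->
  (\int[mu]_z (f z)%:E = ((2 * pi)^-1)%:E *
     \int[leb2]_z ((laplacian f z)%:E * (log_det a b c z)%:E))%E.

(** A horizontal move away from the vertical axis of symmetry leaves the hyperbola. *)
Lemma near_arc_off_arc (z0 : R * R) (r : R) : 0 < r -> arc a b (toC z0 - toC c) ->
  exists2 z1, ~ arc a b (toC z1 - toC c) & sqdist z0 z1 = r ^+ 2.
Proof.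
move=> r0 [h _]; pose x := z0.1 - c.1; pose sg : R := if 0 <= x then 1 else -1.
have sx : 0 <= sg * x by rewrite /sg; case: ifPn => h1; rewrite ?mul1r ?mulN1r ?oppr_ge0// ltW// ltNge.
have sg2 : sg ^+ 2 = 1 by rewrite /sg; case: ifP => _; rewrite ?sqrrN expr1n.
(* [sg] points away from the axis, so that the square of the abscissa increases *)
exists (z0.1 + sg * r, z0.2); last first.
  by rewrite /sqdist /= subrr expr0n addr0 addrC addKr exprMn sg2 mul1r.
move=> [h1 _].
have hE : x ^+ 2 - (z0.2 - c.2) ^+ 2 = a ^+ 2 - b ^+ 2 by exact: h.
have h1E : (z0.1 + sg * r - c.1) ^+ 2 - (z0.2 - c.2) ^+ 2 = a ^+ 2 - b ^+ 2 by exact: h1.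
have e : (z0.1 + sg * r - c.1) ^+ 2 = x ^+ 2 + 2 * (sg * x) * r + sg ^+ 2 * r ^+ 2 by rewrite /x; ring.
have p1 : 0 <= 2 * (sg * x) * r by apply: mulr_ge0; [exact: mulr_ge0|exact: ltW].
have p2 : 0 < r ^+ 2 by rewrite exprn_gt0.
rewrite e sg2 mul1r in h1E; lra.
Qed.

(** On the arc [log_det] has a strict minimum in the weak sense of
[bump_detects_minimum]. The constant subtracted from it integrates to 0 against
Laplacians, so a bump near [z0] has nonzero integral for the Brown measure. *)
Lemma arc_support z0 : arc a b (toC z0 - toC c) -> msupport mu z0.
Proof.
move=> az0 U oU Uz0; rewrite lt0e measure_ge0 andbT; apply/eqP => muU.
pose c0 := ln `|a * b| / 2; pose m z := log_det a b c z - c0.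
have cl : continuous (log_det a b c) by exact: continuous_log_det.
have cm : continuous m by move=> z; apply: cvgB; [exact: cl|exact: cvg_cst].
have m0 z : 0 <= m z by rewrite subr_ge0 log_det_ge.
have mz0 : m z0 = 0 by rewrite /m log_det_arc// subrr.
have [r r0 hr] : exists2 r : R, 0 < r & square_at z0 r `<=` U `&` [set z | m z < 1].
  apply: near_square; apply: filterI; first exact: open_nbhs_nbhs.
  by apply: (cvgr_lt _ (cm z0)); rewrite mz0.
have r20 : 0 < r / 2 by rewrite divr_gt0.
have [z1 nz1 s1] := near_arc_off_arc r20 az0.
have m1 : 0 < m z1 by rewrite subr_gt0; exact: log_det_gt.
have rr0 : 0 < r ^+ 2 by rewrite exprn_gt0.
have [||del /andP[del0 delr]] := @bump_detects_minimum R m z0 r z1 cm m0 mz0 r0 _ m1.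
- by move=> z h; have [_ /ltW] := hr z (disk_square_at (ltW r0) h).
- by rewrite s1 expr_div_n; apply/andP; split; lra.
set f := bump z0 del (r ^+ 2) => /eqP; apply.
have fout z : ~ U z -> f z = 0.
  move=> nU; apply: bump_eq0 => //; rewrite leNgt; apply/negP => h; apply: nU.
  by have [] := hr z (disk_square_at (ltW r0) (ltW h)).
have mU : measurable (U : set plane) := open_measurable_plane oU.
have sf : smooth f by exact: smooth_reval.
have if0 : (\int[mu]_z (f z)%:E = 0)%E.
  transitivity (\int[mu]_(z in U) (f z)%:E)%E.
    rewrite [RHS]integral_mkcond; apply: eq_integral => z _; rewrite patchE.
    by case: ifPn => // /negP nU; rewrite fout// => Uz; apply: nU; rewrite inE.
  apply: null_set_integral => //; apply: measurable_funTS.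
  by apply/measurable_EFinP; apply: continuous_measurable_plane; exact: continuous_reval.
pose r3 := `|z0.1| + `|z0.2| + r + 1.
have r30 : 0 < r3 by rewrite /r3 ltr_wpDl// !addr_ge0// ltW.
have lout z : ~ square r3 z -> laplacian f z = 0.
  move=> nz; rewrite laplacian_parts//.
  have [|-> ->] := @lap_parts_out R z0 del (r ^+ 2) del0 rr0 z; last by rewrite subr0.
  by rewrite leNgt; apply/negP => /ltW/(disk_square (ltW r0)).
have clap : continuous (laplacian f) by exact: continuous_laplacian.
have int (g : R * R -> R) : continuous g ->
    leb2.-integrable setT (EFin \o (fun z => laplacian f z * g z)).
  move=> cg; apply: (integrable_square (r := r3)).
    by move=> z; apply: cvgM; [exact: clap|exact: cg].
  by move=> z /lout ->; rewrite mul0r.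
have I1 : (\int[leb2]_z (laplacian f z * log_det a b c z)%:E = 0)%E.
  have := mu_laplacian (test_function_bump z0 del0 rr0); rewrite -/f if0.
  under eq_integral do rewrite -EFinM.
  move=> /esym/eqP; rewrite mule_eq0 => /orP[|/eqP//].
  by rewrite eqe invr_eq0 mulf_eq0 pnatr_eq0 /= gt_eqF// pi_gt0.
have I2 : (\int[leb2]_z (laplacian f z * (- c0))%:E = 0)%E.
  apply: (@integral_laplacian_harmonic _ f (fun=> - c0) (fun=> 0) (fun=> 0) (fun=> 0)
    [set z | sqdist z0 z <= r ^+ 2] setT r3) => //.
  - exact: closed_disk.
  - exact: openT.
  - exact: disk_square (ltW r0).
  - by move=> z /= /negP; rewrite -ltNge => /ltW; exact: bump_eq0.
  - by move=> z; exact: cvg_cst.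
  - move=> z _; split; rewrite ?oppr0; try exact: is_derive_cst.
    exact: cvg_cst.
have := integralD_EFin measurableT (int _ cl) (int (fun=> - c0) (fun z => cvg_cst _)).
rewrite /= I1 I2 adde0 => <-.
by apply: eq_integral => z _; rewrite -EFinD /m mulrDr.
Qed.

End ArcSupport.

Theorem theorem7p1 (R : realType) (M : vonNeumannAlgebra R) (tau : M -> R[i])
    (htau : faithful_normal_tracial_state tau)
    (p q : M) (hp : hermitian_elt p) (hq : hermitian_elt q)
    (hpq : freely_independent tau p q)
    (alpha alpha' beta beta' : R)
    (halpha : alpha != alpha') (hbeta : beta != beta')
    (hmup : spectral_measure tau p (two_point alpha alpha'))
    (hmuq : spectral_measure tau q (two_point beta beta'))
    (X : M) (hX : X = p + 'i *: q)
    (mu : {measure set (measurableTypeR R * measurableTypeR R) -> \bar R})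
    (hmu : brown_measure tau X mu) :
  msupport mu =
  closure [set z : R * R |
    (\forall eps \near (0 : R)^'+,
       inv_green_domain alpha alpha' beta beta'
         (green tau X (zeps (toC z) eps))) /\
    ((exists A B : R[i], B != 0 /\ green_limit tau X (toC z) (quat A B)) \/
     ~ (exists L : 'M[R[i]]_2, green_limit tau X (toC z) L))].
Proof.
have [u [hu uu tu pE]] := two_point_symmetry htau halpha hmup.
have [v [hv vv tv qE]] := two_point_symmetry htau hbeta hmuq.
set a := (alpha' - alpha) / 2 in pE; set b := (beta' - beta) / 2 in qE.
have a0 : a != 0 by rewrite mulf_neq0// subr_eq0 eq_sym.
have b0 : b != 0 by rewrite mulf_neq0// subr_eq0 eq_sym.
have aC0 : a%:C != 0 by rewrite eq_complex /= eqxx andbT.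
have bC0 : b%:C != 0 by rewrite eq_complex /= eqxx andbT.
have huv := freely_independent_symmetries hpq pE qE aC0 bC0 hu hv uu vv tu tv.
pose c : R * R := ((alpha + alpha') / 2, (beta + beta') / 2).
have XE : X = affine u v (toC c) a%:C (0 +i* b).
  have iE (r : R) : 'i * r%:C = 0 +i* r.
    by rewrite -complexiE; apply: complex_ext; rewrite ?(ReM, ImM) /=; ring.
  rewrite hX pE qE /affine scalerDr !scalerA !iE addrACA -scalerDl addrA; congr (_ *: _ + _ + _).
  by apply: complex_ext; rewrite /= ?addr0 ?add0r.
have [Delta hDelta hmuE] := hmu.
have lneE z : lne (Delta ((toC z)%:A - X)) = (log_det a b c z)%:E.
  apply: (FK_det_model htau huv a0 b0 _ (hDelta _)).
  by rewrite XE /model /affine !opprD !addrA -scalerBl !scaleNr.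
have mu_laplacian (f : R * R -> R) : test_function f ->
    (\int[mu]_z (f z)%:E = ((2 * pi)^-1)%:E *
     \int[(@lebesgue_measure R \x @lebesgue_measure R)%E]_z
       ((laplacian f z)%:E * (log_det a b c z)%:E))%E.
  move=> tf; rewrite hmuE//; congr (_ * _)%E.
  by apply: eq_integral => z _; rewrite lneE.
have := closure_green_exceptional htau alpha alpha' beta beta' huv a0 b0 XE.
rewrite /green_exceptional => ->.
apply/seteqP; split => z; first exact: support_arc mu_laplacian z.
exact: arc_support mu_laplacian z.
Qed.
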